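(* Consider two linearly edge-reinforced walkers $X^{(1)},X^{(2)}$ on the 3-node segment with vertices $-1,0,1$ which move alternately (as defined in the context), with $N_n=\frac{w(n,-1)}{w(n,-1)+w(n,0)}$, $\mathcal G_n=\sigma(N_0,\dots,N_n)$ and $M^{\mathrm{alt}}_n:=N_{4n}$ for $n\ge 0$. Then the following hold. (i) $(M^{\mathrm{alt}}_n)_{n\ge 0}$ is a bounded martingale, and we define $M^{\mathrm{alt}}_\infty:=\lim_{n\to\infty}M^{\mathrm{alt}}_n$. We have that $\lim_{n\to\infty}|N_n-M^{\mathrm{alt}}_\infty|=0$ almost surely. (ii) The following convergence holds in the sense of almost sure conditional convergence with respect to the filtration $(\mathcal G_n)_{n\ge 0}$: $$\sqrt n\,\bigl(M^{\mathrm{alt}}_n-M^{\mathrm{alt}}_\infty\bigr)\to \mathcal N\Bigl(0,\tfrac12 M^{\mathrm{alt}}_\infty(1-M^{\mathrm{alt}}_\infty)\Bigr).$$ As a consequence, the following convergence holds in the weak sense (convergence in law): $$\sqrt n\,\bigl(N_n-M^{\mathrm{alt}}_\infty\bigr)\to \overline{\mathcal N}\Bigl(0,\tfrac12 M^{\mathrm{alt}}_\infty(1-M^{\mathrm{alt}}_\infty)\Bigr).$$ (iii) $\mathbb P[M^{\mathrm{alt}}_\infty=a]=0$ for any $a\in[0,1]$. As a consequence, $M^{\mathrm{alt}}_\infty$ is not deterministic.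
   Context: **Model (two alternating walkers).** The graph is the segment with vertex set $\{-1,0,1\}$ and edges $\{-1,0\}$ (the left edge, denoted by $-1$) and $\{0,1\}$ (the right edge, denoted by $0$). There are two walkers $X^{(1)},X^{(2)}$ with $X^{(1)}_0=X^{(2)}_0=0$. For $\ell\in\{-1,0\}$ put $c(0,\ell)=0$ and, for $n\ge1$, $c(n,\ell)=\sum_{k=1}^2\sum_{i=1}^n \mathbf 1\{\{X^{(k)}_{i-1},X^{(k)}_i\}=\{\ell,\ell+1\}\}$, the total number of crossings of edge $\{\ell,\ell+1\}$ by both walkers up to time $n$. The weight of this edge at time $n$ is $w(n,\ell)=1+c(n,\ell)$. At every time step exactly one walker moves: at odd time steps walker 1 moves (in particular, walker 1 moves first, at step 1), at even time steps walker 2 moves; the other walker stays put. Given the history up to time $n$ (positions of both walkers up to time $n$), if the walker which moves at step $n+1$ is at $0$, it jumps to $1$ with probability $\frac{w(n,0)}{w(n,-1)+w(n,0)}$ and to $-1$ with probability $\frac{w(n,-1)}{w(n,-1)+w(n,0)}$; if it is at $-1$ or $1$, it jumps to $0$ with probability one. (Hence both walkers are at $0$ at all times $4n$.) **Almost sure conditional convergence.** Let $(Z_n)$ be real random variables on a probability space $(\Omega,\mathcal G,\mathbb P)$, $(\mathcal F_n)$ a sequence of sub-$\sigma$-fields of $\mathcal G$, and $\mu=(\mu_\omega)_{\omega\in\Omega}$ a random probability measure on $\mathbb R$ (i.e. $\omega\mapsto\mu_\omega(A)$ is $\mathcal G$-measurable for all Borel $A$). Let $\mu_n$ be the conditional distribution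 of $Z_n$ given $\mathcal F_n$. One says $Z_n\to\mu$ in the sense of almost sure conditional convergence with respect to $(\mathcal F_n)$ if, for almost every $\omega$, $\mu_n$ converges weakly to $\mu$. **Normal laws with random variance.** For a nonnegative random variable $V$, $\mathcal N(0,V)$ denotes the random probability measure which at $\omega$ is the centered normal law with variance $V(\omega)$ (the Dirac mass at $0$ if $V(\omega)=0$). $\overline{\mathcal N}(0,V)$ denotes the averaged (mixture) law $\overline{\mathcal N}(0,V)(A)=\int \mathcal N(0,V(\omega))(A)\,\mathbb P(d\omega)$.
   Formalization: The last display of (ii) is false as printed, since N_n and M_n=N_{4n} run on different time scales; it is replaced by two limits in law: √n(M_n−M_∞) → mixture N(0, ½M_∞(1−M_∞)) and √n(N_n−M_∞) → mixture N(0, 2M_∞(1−M_∞)). *)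

(* Defs.v *)
From HB Require Import structures.
From mathcomp Require Import all_boot all_order all_algebra.
From mathcomp Require Import all_classical all_reals all_analysis.
From mathcomp Require Import measurable_realfun.
Import Order.TTheory GRing.Theory Num.Theory.
Import numFieldNormedType.Exports.

Set Implicit Arguments.
Unset Strict Implicit.
Unset Printing Implicit Defensive.

Local Open Scope classical_set_scope.
Local Open Scope ring_scope.

(* [measurableTypeR R] is R with its Borel sets, and it is the version of R on
   which [normal_prob] is a probability. *)
Definition law (R : realType) := probability (measurableTypeR R) R.

Section probability_notions.
Context d (T : measurableType d) (R : realType) (P : probability T R).
Implicit Types (F : set_system T) (X Y Z : T -> R).

Definition sub_sigma_field F := sigma_algebra setT F /\ F `<=` measurable.

Definition wrt_measurable F d' (T' : measurableType d') (f : T -> T') :=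
  preimage_set_system setT f measurable `<=` F.

(* sigma(Y_0, ..., Y_n) *)
Definition natural_sigma (Y : nat -> T -> R) (n : nat) : set_system T :=
  <<s \bigcup_(i in [set i | (i <= n)%N])
        preimage_set_system setT (Y i) measurable >>.

(* Y is a version of the conditional expectation of X given F. *)
Definition is_cond_expectation F X Y :=
  [/\ wrt_measurable F Y, P.-integrable setT (EFin \o Y) &
      forall B, F B ->
        (\int[P]_(w in B) (Y w)%:E = \int[P]_(w in B) (X w)%:E)%E].

Definition martingale (F : nat -> set_system T) (M : nat -> T -> R) :=
  [/\ forall n, sub_sigma_field (F n),
      forall n, F n `<=` F n.+1,
      forall n, wrt_measurable (F n) (M n),
      forall n, P.-integrable setT (EFin \o M n) &
      forall n, is_cond_expectation (F n) (M n.+1) (M n)].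

Definition random_probability (mu : T -> law R) :=
  forall A : set R, measurable A -> measurable_fun setT (fun w => mu w A).

(* mu is a (regular) conditional distribution of Z given F. *)
Definition is_cond_distribution F Z (mu : T -> law R) :=
  (forall A : set R, measurable A -> wrt_measurable F (fun w => mu w A)) /\
  (forall (A : set R) (B : set T), measurable A -> F B ->
     (\int[P]_(w in B) mu w A = P (B `&` Z @^-1` A))%E).

(* Stated for set functions, so that it also applies to [mixture] below. *)
Definition weak_cvg (mu_ : nat -> set (measurableTypeR R) -> \bar R)
    (mu : set (measurableTypeR R) -> \bar R) :=
  forall f : R -> R, continuous f -> (exists C, forall x, `|f x| <= C) ->
    ((\int[mu_ n]_x (f x)%:E) @[n --> \oo] --> \int[mu]_x (f x)%:E)%E.

(* Conditional distributions are unique up to null sets, so that asking for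
   one choice of them is the same as asking for every choice. *)
Definition as_cond_cvg (F : nat -> set_system T) (Z : nat -> T -> R)
    (mu : T -> law R) :=
  [/\ forall n, sub_sigma_field (F n),
      forall n, measurable_fun setT (Z n),
      random_probability mu &
      exists mu_ : nat -> T -> law R,
        (forall n, is_cond_distribution (F n) (Z n) (mu_ n)) /\
        {ae P, forall w, weak_cvg (fun n => mu_ n w) (mu w)}].

Definition cvg_in_law (Z : nat -> T -> R) (nu : set (measurableTypeR R) -> \bar R) :=
  (forall n, measurable_fun setT (Z n)) /\
  weak_cvg (fun n => pushforward P (Z n)) nu.

(* The average over w of the random probability measure mu. *)
Definition mixture (mu : T -> law R) : set (measurableTypeR R) -> \bar R :=
  fun A => (\int[P]_w mu w A)%E.

End probability_notions.

(* [normal_prob m s] takes the standard deviation s and is the uniform law on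
   [0, 1] for s = 0, hence the separate case v = 0. *)
Definition centered_normal (R : realType) (v : R) : law R :=
  if v == 0 then (\d_(0 : measurableTypeR R) : law R)
  else (normal_prob 0 (Num.sqrt v) : law R).

(* Walkers 1 and 2 are the elements 0 and 1 of 'I_2; [x k n] is the position
   of walker k at time n. *)
Definition trajectories := 'I_2 -> nat -> int.

Definition crosses (a b l : int) : bool :=
  ((a == l) && (b == l + 1)) || ((a == l + 1) && (b == l)).

(* c(n, l), the total number of crossings of the edge {l, l + 1} *)
Definition crossings (x : trajectories) (n : nat) (l : int) : nat :=
  (\sum_(k < 2) \sum_(1 <= i < n.+1) crosses (x k i.-1) (x k i) l)%N.

Section walkers.
Context (R : realType).

Definition weight (x : trajectories) (n : nat) (l : int) : R :=
  1 + (crossings x n l)%:R.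

Definition left_fraction (x : trajectories) (n : nat) : R :=
  weight x n (-1) / (weight x n (-1) + weight x n 0).

(* The walker which moves at step n >= 1. *)
Definition mover (n : nat) : 'I_2 := if odd n then ord0 else ord_max.

(* Probability, given the history x up to time n, that the walker moving at
   step n + 1 jumps to y. *)
Definition jump_prob (x : trajectories) (n : nat) (y : int) : R :=
  if x (mover n.+1) n == 0 then
    if y == 1 then weight x n 0 / (weight x n (-1) + weight x n 0)
    else if y == -1 then weight x n (-1) / (weight x n (-1) + weight x n 0)
    else 0
  else (y == 0)%:R.

Context d (T : measurableType d) (P : probability T R).
Implicit Type X : 'I_2 -> nat -> T -> int.

Definition path_of X (w : T) : trajectories := fun k n => X k n w.

Definition history X (x : trajectories) (n : nat) : set T :=
  [set w | forall k i, (i <= n)%N -> X k i w = x k i].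

(* The conditional law of the next jump is given by elementary conditioning on
   the (finitely many) histories, in multiplied-out form. *)
Record alternating_walkers X : Prop := AlternatingWalkers {
  walker_measurable : forall k n y, measurable [set w | X k n w = y] ;
  walker_vertex : forall k n w, X k n w \in [:: -1; 0; 1] ;
  walker_start : forall k w, X k 0%N w = 0 ;
  walker_stay : forall k n w, k != mover n.+1 -> X k n.+1 w = X k n w ;
  walker_jump : forall (x : trajectories) (n : nat) (y : int),
    (P (history X x n `&` [set w | X (mover n.+1) n.+1 w = y]) =
     P (history X x n) * (jump_prob x n y)%:E)%E }.

Definition N_ X (n : nat) (w : T) : R := left_fraction (path_of X w) n.

Definition G_ X : nat -> set_system T := natural_sigma (N_ X).

Definition Malt X (n : nat) : T -> R := N_ X (4 * n)%N.

Definition Malt_infty X (w : T) : R := limn (fun n => Malt X n w).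

End walkers.

(* Main.v *)
Require Import Defs.
From HB Require Import structures.
From mathcomp Require Import all_boot all_order all_algebra.
From mathcomp Require Import all_classical all_reals all_analysis.
From mathcomp Require Import measurable_realfun.
From mathcomp Require Import ring lra zify.
Import Order.TTheory GRing.Theory Num.Theory.
Import numFieldNormedType.Exports.
Local Open Scope classical_set_scope.
Local Open Scope ring_scope.

Set Implicit Arguments.
Unset Strict Implicit.
Unset Printing Implicit Defensive.

(** Between the times 4 n and 4 (n + 1) each walker leaves 0 once and comes
    back, so that almost surely the total weight at time 4 n is 4 n + 2 and the
    fraction M_n = N_(4 n) is a Markov chain: an urn in which two draws with
    reinforcement 1 are followed by the two returns, which add 1 again to the
    weight of each edge drawn ([urn_step], [walkers_urn_process]).  All the
    limit theorems are proved for such an urn, and transferred to N_n at the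
    end, because |N_n - M_(n / 4)| is of order 1/n ([left_fraction_dist]).

    A step of the urn preserves the mean, and its variance is
    V_n M_n (1 - M_n) with 2 V_n close to 1/n - 1/(n + 1) ([urn_var_bounds]).
    This telescopes: the variance of M_oo - M_n given the past is close to
    M_n (1 - M_n) / (2 n).  In the same way M_n is a Cauchy sequence in L2, and
    since its increments are at most 1/(n + 1), the summability of the
    increments along the cubes gives almost sure convergence ([urn_cvg_ae]).

    For the central limit theorem, fix n and v = M_n (1 - M_n).  The function
    exp (- l^2 v / (4 j)) cos (l (x - M_n) + phi) of the time j and of the state
    x is preserved by a step up to errors which are summable over j >= n
    ([urn_step_gauss]).  Letting j tend to infinity compares the conditional
    mean of cos (l (M_oo - M_n) + phi) with exp (- l^2 v / (4 n)) cos phi; for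
    l of order sqrt n the total error is of order 1 / sqrt n, uniformly over the
    events B of the past ([urn_cos_limit]).  With second moments for tightness
    this gives weak convergence, because trigonometric polynomials approximate
    bounded continuous functions on compact sets without exceeding their bounds
    ([trig_poly_approx], [weak_cvg_cos]).

    The sigma-algebra G_n is generated by variables which take finitely many
    values, and its events are the unions of its atoms
    ([G_saturated], [saturated_G]).  So a conditional
    distribution given G_n is elementary conditioning on the atom of w, and the
    estimate is applied with B equal to this atom.  The atom is an event of the
    period n / 4 + 1, at which the fraction is within O(1/n) of N_n(w)
    ([urn_conditional_cos], [walkers_conditional_cvg]).  As
    sqrt n (N_n - M_oo) is 2 sqrt (n / 4) (M_(n / 4) - M_oo) up to a vanishing
    term, its variance is four times as large ([walkers_deviation_law]).

    Finally, the limit has no atom.  At 0 and 1, the mean of 1 / (M_n (1 - M_n))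
    is shown to be o(n), whereas on the event M_oo in {0, 1} the weighted square
    (M_oo - M_n)^2 / (M_n (1 - M_n))^2 is at least 1 while its mean is at most
    that of 1 / (n M_n (1 - M_n)) ([urn_limit_interior]).  Hence the limiting
    variance is almost surely positive, and cos (i t (M_oo - a)) has a small
    mean for the multiples i = 1, ..., 2 K of a suitable large frequency t;
    squaring the sum of the first K of these cosines, which equals K where
    M_oo = a, gives P (M_oo = a) <= 1/K ([urn_limit_no_atom]). *)

(** * Trigonometric polynomials *)

(** The Bernstein polynomial of g, by de Casteljau's recursion: its
    properties below are inductions on n without binomial coefficients. *)
Fixpoint bernstein (R : realType) (n : nat) (g : nat -> R) (t : R) : R :=
  if n is m.+1 then
    (1 - t) * bernstein m g t + t * bernstein m (fun k => g k.+1) t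
  else g 0%N.

Lemma bernstein_affine (R : realType) n (a b : R) h t :
  bernstein n (fun k => a + b * h k) t = a + b * bernstein n h t.
Proof.
elim: n h => //= n IH h; rewrite IH (IH (fun k => h k.+1)); ring.
Qed.

Lemma bernstein_norm (R : realType) n (g h : nat -> R) t : 0 <= t <= 1 ->
  (forall k, (k <= n)%N -> `|g k| <= h k) ->
  `|bernstein n g t| <= bernstein n h t.
Proof.
move=> /andP[t0 t1]; elim: n g h => [|n IH] g h gh /=; first exact: gh.
apply: le_trans (ler_normD _ _) _; rewrite !normrM (ger0_norm t0).
rewrite [`|1 - t|]ger0_norm ?subr_ge0//; apply: lerD.
  by rewrite ler_wpM2l ?subr_ge0//; apply: IH => k kn; apply/gh/leqW.
by rewrite ler_wpM2l//; apply: IH => k kn; exact: gh.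
Qed.

(** For c = - n t this is the variance of a binomial variable. *)
Lemma bernstein_square (R : realType) n (c t : R) :
  bernstein n (fun k => (k%:R + c) ^+ 2) t =
  n%:R * t * (1 - t) + (n%:R * t + c) ^+ 2.
Proof.
elim: n c => [|n IH] c /=; first ring.
have -> : (fun k => (k.+1%:R + c) ^+ 2) = (fun k : nat => (k%:R + (1 + c)) ^+ 2).
  by apply/funext => k; rewrite -natr1; ring.
by rewrite !IH -natr1; ring.
Qed.

(** Where |x - y| >= d, the difference |g x - g y| is at most 2 C, hence at
    most 2 C ((x - y) / d)^2, and the Bernstein polynomial of this square is
    a variance of order 1/n. *)
Lemma bernstein_approx (R : realType) (g : R -> R) (C d e t : R) n :
  0 < d -> 0 <= t <= 1 -> (0 < n)%N -> (forall x, `|g x| <= C) ->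
  0 <= e ->
  (forall x y : R, 0 <= x <= 1 -> 0 <= y <= 1 -> `|x - y| < d ->
     `|g x - g y| <= e) ->
  `|bernstein n (fun k => g (k%:R / n%:R)) t - g t| <= e + 2 * C / d ^+ 2 / n%:R.
Proof.
move=> d0 t01 n0 gC e0 guc.
have n0' : 0 < n%:R :> R by rewrite ltr0n.
have -> : bernstein n (fun k => g (k%:R / n%:R)) t - g t =
   bernstein n (fun k => - g t + 1 * g (k%:R / n%:R)) t.
  by rewrite bernstein_affine; ring.
apply: (@le_trans _ _ (bernstein n (fun k => e +
    (2 * C / d ^+ 2 / n%:R ^+ 2) * (k%:R + - (n%:R * t)) ^+ 2) t)).
  apply: bernstein_norm => // k kn; rewrite mul1r addrC.
  have k01 : 0 <= (k%:R / n%:R : R) <= 1.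
    by rewrite divr_ge0//= ler_pdivrMr// mul1r ler_nat.
  have C0 : 0 <= C by apply: le_trans (gC 0).
  have -> : (2 * C / d ^+ 2 / n%:R ^+ 2) * (k%:R + - (n%:R * t)) ^+ 2 =
      2 * C * ((k%:R / n%:R - t) / d) ^+ 2.
    by field; rewrite !gt_eqF.
  case: (ltP `|k%:R / n%:R - t| d) => [kd|dk].
    apply: le_trans (guc _ _ k01 t01 kd) _.
    by rewrite lerDl mulr_ge0 ?sqr_ge0// mulr_ge0.
  have H1 : 1 <= ((k%:R / n%:R - t) / d) ^+ 2.
    rewrite -real_normK ?num_real// normrM normfV (gtr0_norm d0).
    by apply: exprn_ege1; rewrite ler_pdivlMr// mul1r.
  apply: le_trans (ler_normB _ _) _.
  apply: (@le_trans _ _ (2 * C * 1)).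
    by have := gC (k%:R / n%:R); have := gC t; lra.
  rewrite -[leLHS]add0r; apply: lerD => //; rewrite ler_wpM2l ?mulr_ge0//.
rewrite bernstein_affine bernstein_square subrr expr0n addr0 lerD2l.
have C0 : 0 <= C by apply: le_trans (gC 0).
have -> : 2 * C / d ^+ 2 / n%:R ^+ 2 * (n%:R * t * (1 - t)) =
   2 * C / d ^+ 2 / n%:R * (t * (1 - t)) by field; rewrite !gt_eqF.
rewrite ler_piMr//; last by nra.
by rewrite !divr_ge0 ?mulr_ge0 ?sqr_ge0// ltW.
Qed.

Inductive trig_poly (R : realType) : (R -> R) -> Prop :=
| trig_poly_cos a b : trig_poly (fun x => cos (a * x + b))
| trig_poly_add f g : trig_poly f -> trig_poly g ->
    trig_poly (fun x => f x + g x)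
| trig_poly_scale c f : trig_poly f -> trig_poly (fun x => c * f x).

Lemma trig_poly_mul_cos (R : realType) (a b : R) f :
  trig_poly f -> trig_poly (fun x => cos (a * x + b) * f x).
Proof.
elim=> {f} [c e|f g _ IHf _ IHg|c f _ IHf].
- have -> : (fun x => cos (a * x + b) * cos (c * x + e)) = (fun x : R =>
    2^-1 * (cos ((a + c) * x + (b + e)) + cos ((a - c) * x + (b - e)))).
    apply/funext => x.
    have -> : (a + c) * x + (b + e) = (a * x + b) + (c * x + e) by ring.
    have -> : (a - c) * x + (b - e) = (a * x + b) - (c * x + e) by ring.
    move: (a * x + b) (c * x + e) => u v.
    by rewrite cosD cosB; field.
  by apply/trig_poly_scale/trig_poly_add; exact: trig_poly_cos.
- under eq_fun do rewrite mulrDr; exact: trig_poly_add.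
- under eq_fun do rewrite mulrCA; exact: trig_poly_scale.
Qed.

Lemma trig_poly_cst (R : realType) (c : R) : trig_poly (fun=> c).
Proof.
have -> : (fun=> c) = (fun x : R => c * cos (0 * x + 0)).
  by apply/funext => x; rewrite mul0r addr0 cos0 mulr1.
by apply/trig_poly_scale/trig_poly_cos.
Qed.

Lemma trig_poly_bernstein (R : realType) (a b : R) n g :
  trig_poly (fun x => bernstein n g (2^-1 + 2^-1 * cos (a * x + b))).
Proof.
elim: n g => [|n IH] g /=; first exact: trig_poly_cst.
have -> : (fun x : R => (1 - (2^-1 + 2^-1 * cos (a * x + b))) *
     bernstein n g (2^-1 + 2^-1 * cos (a * x + b)) +
     (2^-1 + 2^-1 * cos (a * x + b)) *
     bernstein n (fun k => g k.+1) (2^-1 + 2^-1 * cos (a * x + b))) =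
  (fun x : R => 2^-1 * ((bernstein n g (2^-1 + 2^-1 * cos (a * x + b)) +
     - 1 * (cos (a * x + b) * bernstein n g (2^-1 + 2^-1 * cos (a * x + b)))) +
     (bernstein n (fun k => g k.+1) (2^-1 + 2^-1 * cos (a * x + b)) +
     (cos (a * x + b) * bernstein n (fun k => g k.+1) (2^-1 + 2^-1 * cos (a * x + b)))))).
  apply/funext => x; set c := cos _; set u := bernstein n g _.
  by set v := bernstein n _ _; move: u v => u v; field.
apply: trig_poly_scale; apply: trig_poly_add; apply: trig_poly_add => //.
  by apply: trig_poly_scale; exact: trig_poly_mul_cos.
exact: trig_poly_mul_cos.
Qed.

Lemma uniform_continuity_segment (R : realType) (g : R -> R) (e : R) : 0 < e ->
  continuous g ->
  exists2 d : R, 0 < d &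
    forall x y : R, 0 <= x <= 1 -> 0 <= y <= 1 -> `|x - y| < d ->
      `|g x - g y| <= e.
Proof.
move=> e0 cg.
have := @segment_compact R 0 1; rewrite compact_near_coveringP => cpt.
have : \forall d \near 0^'+, forall x, `[0, 1]%classic x ->
    forall y : R, `|x - y| < d -> `|g x - g y| <= e.
  apply: cpt => x _.
  have /cvgrPdist_lt/(_ _ (divr_gt0 e0 (ltr0n _ 2))) := cg x.
  case/nbhs_ballP => r /= r0 rP.
  have r20 : 0 < r / 2 by rewrite divr_gt0.
  exists (ball x (r / 2), [set d | d < r / 2]); first split => /=.
  - exact: nbhsx_ballx.
  - exact: nbhs_right_lt.
  move=> [x' d] /= [xx' dr] y x'y.
  have H1 : `|g x - g x'| < e / 2.
    by apply: rP => /=; apply: lt_trans xx' _; rewrite ltr_pdivrMr// ltr_pMr// ltr1n.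
  have H2 : `|g x - g y| < e / 2.
    apply: rP => /=; rewrite [r]splitr; apply: le_lt_trans (ler_distD x' _ _) _.
    by apply: ltrD => //; exact: lt_trans dr.
  rewrite [e]splitr; apply: le_trans (ler_distD (g x) _ _) _.
  by apply: lerD; apply: ltW => //; rewrite distrC.
move=> [d /= d0 dP]; exists (d / 2); first by rewrite divr_gt0.
move=> x y x01 y01 xy; apply: (dP (d / 2)) => //=.
- by rewrite sub0r normrN gtr0_norm ?divr_gt0// ltr_pdivrMr// ltr_pMr// ltr1n.
- by rewrite divr_gt0.
Qed.

(** Up to scaling, the values of x lie in [-1, 1], inside [-pi/2, pi/2]
    where the sine is injective: there f is a continuous function of (1 +
    sin x) / 2, and a Bernstein polynomial of it is a trigonometric
    polynomial. It has the bound of f on the whole line because (1 + sin x)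
    / 2 always lies in [0, 1]. *)
Lemma trig_poly_approx (R : realType) (f : R -> R) (C A e : R) :
  continuous f -> (forall x, `|f x| <= C) -> 0 < A -> 0 < e ->
  exists h : R -> R, [/\ trig_poly h, forall x, `|h x| <= C &
    forall x, `|x| <= A -> `|f x - h x| <= e].
Proof.
move=> cf fC A0 e0.
have s1 : sin 1 < 1 :> R.
  have := cos2Dsin2 (1 : R); have := @cos1_gt0 R.
  have := sin_le1 (1 : R); nra.
(* clamping the argument of asin at sin 1 and - sin 1 keeps g continuous on
   the whole line, and does not change it where |x| <= A *)
pose s : R := sin 1.
pose g (t : R) := f (A * asin (Num.max (- s) (Num.min s (2 * t - 1)))).
have s0 : 0 < s by apply: sin2_gt0; rewrite ltr01 ltr1n.
have gC t : `|g t| <= C by exact: fC.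
have clamp_range (y : R) : -1 < Num.max (- s) (Num.min s y) < 1.
  rewrite lt_max gt_max ltrNl opprK s1/= gt_min s1/= andbT.
  by rewrite (lt_trans _ ltr01)// oppr_lt0.
have cg : continuous g.
  move=> t; apply: (@continuous_comp _ _ _
    (fun t : R => A * asin (Num.max (- s) (Num.min s (2 * t - 1)))) f);
    last exact: cf.
  apply: continuousM; first exact: cvg_cst.
  apply: (@continuous_comp _ _ _ (fun t : R => Num.max (- s) (Num.min s (2 * t - 1))) asin); last first.
    exact: continuous_asin.
  apply: continuous_max; first exact: cvg_cst.
  apply: continuous_min; first exact: cvg_cst.
  apply: continuousB; last exact: cvg_cst.
  by apply: continuousM; [exact: cvg_cst|exact: cvg_id].
have e20 : 0 < e / 2 by rewrite divr_gt0.
have [d d0 dP] := uniform_continuity_segment e20 cg.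
pose K := 2 * C / d ^+ 2.
have C0 : 0 <= C by exact: le_trans (fC 0).
pose n := (Num.bound (K / (e / 2))).+1.
have nP : K / n%:R <= e / 2.
  rewrite ler_pdivrMr ?ltr0n// mulrC -ler_pdivrMr//.
  apply: ltW; apply: lt_le_trans (_ : (Num.bound (K / (e / 2)))%:R <= _); last by rewrite ler_nat.
  by apply: archi_boundP; rewrite divr_ge0// ?divr_ge0 ?mulr_ge0 ?sqr_ge0// ltW.
pose t x := 2^-1 + 2^-1 * cos (A^-1 * x + - (pi / 2)).
have t01 x : 0 <= t x <= 1.
  by have := cos_geN1 (A^-1 * x + - (pi / 2)); have := cos_le1 (A^-1 * x + - (pi / 2)); rewrite /t; lra.
exists (fun x => bernstein n (fun k => g (k%:R / n%:R)) (t x)); split.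
- exact: trig_poly_bernstein.
- move=> x; apply: le_trans (_ : _ <= bernstein n (fun k => C + 0 * 0) (t x)) _.
    by apply: bernstein_norm => // k _; rewrite mul0r addr0.
  by rewrite bernstein_affine mul0r addr0.
move=> x xA.
have xA1 : -1 <= A^-1 * x <= 1.
  by rewrite -ler_norml normrM gtr0_norm ?invr_gt0// mulrC ler_pdivrMr// mul1r.
have pi2 := @pihalf_ge1 R.
have xin : A^-1 * x \in `[(- (pi / 2)), pi / 2] by rewrite in_itv/=; lra.
have -> : f x = g (t x).
  rewrite /g /t cosBpihalf.
  have -> : 2 * (2^-1 + 2^-1 * sin (A^-1 * x)) - 1 = sin (A^-1 * x) by field.
  have le_sin : {in `[(- (pi/2)), pi/2] &, {mono @sin R : x y / x <= y}}.
    by apply: le_mono_in => u v ui vi uv; rewrite ltr_sin.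
  have -> : Num.min s (sin (A^-1 * x)) = sin (A^-1 * x).
    apply/min_idPr; rewrite /s le_sin//; first by case/andP: xA1.
    by rewrite in_itv/=; lra.
  have -> : Num.max (- s) (sin (A^-1 * x)) = sin (A^-1 * x).
    apply/max_idPr; rewrite /s -sinN le_sin//; first by case/andP: xA1.
    by rewrite in_itv/=; lra.
  by rewrite sinK// mulrA divff ?mul1r// gt_eqF.
rewrite distrC; apply: le_trans (bernstein_approx d0 (t01 x) (ltn0Sn _) gC (ltW e20) dP) _.
by rewrite [leRHS]splitr lerD2l.
Qed.

(** * Bounded random variables *)

Section bounded_functions.
Context d (T : measurableType d) (R : realType).

Definition bounded_measurable (f : T -> R) :=
  measurable_fun setT f /\ exists C, forall w, `|f w| <= C.

Lemma bounded_measurable_cst (c : R) : bounded_measurable (fun=> c).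
Proof. by split; [exact: measurable_cst|exists `|c|]. Qed.

Lemma bounded_measurableD f g :
  bounded_measurable f -> bounded_measurable g ->
  bounded_measurable (fun w => f w + g w).
Proof.
move=> [mf [C fC]] [mg [D gD]]; split; first exact: measurable_funD.
by exists (C + D) => w; apply: le_trans (ler_normD _ _) _; exact: lerD.
Qed.

Lemma bounded_measurableM f g :
  bounded_measurable f -> bounded_measurable g ->
  bounded_measurable (fun w => f w * g w).
Proof.
move=> [mf [C fC]] [mg [D gD]]; split; first exact: measurable_funM.
by exists (C * D) => w; rewrite normrM; apply: ler_pM.
Qed.

Lemma bounded_measurableN f :
  bounded_measurable f -> bounded_measurable (fun w => - f w).
Proof.
move=> [mf [C fC]]; split; first exact: measurableT_comp.
by exists C => w; rewrite normrN.
Qed.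

Lemma bounded_measurableB f g :
  bounded_measurable f -> bounded_measurable g ->
  bounded_measurable (fun w => f w - g w).
Proof. by move=> bf bg; apply/bounded_measurableD/bounded_measurableN. Qed.

Lemma bounded_measurable_norm f :
  bounded_measurable f -> bounded_measurable (fun w => `|f w|).
Proof.
move=> [mf [C fC]]; split; first exact: measurableT_comp.
by exists C => w; rewrite normr_id.
Qed.

Lemma bounded_measurable_sqr (f : T -> R) :
  bounded_measurable f -> bounded_measurable (fun w => f w ^+ 2).
Proof. by move=> bf; under eq_fun do rewrite expr2; exact: bounded_measurableM. Qed.

Lemma measurable_norm_gt (f : T -> R) (a : R) : measurable_fun setT f ->
  measurable [set w | a < `|f w|].
Proof.
move=> mf; rewrite -[X in measurable X]setTI.
rewrite (_ : [set w | _] = (fun w => `|f w|) @^-1` `]a, +oo[).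
  have mN : measurable_fun setT (fun w => `|f w|) by exact: measurableT_comp.
  exact: mN.
by apply/seteqP; split => w; rewrite /= in_itv/= andbT.
Qed.

Lemma bounded_measurable_indic A : measurable A -> bounded_measurable (fun w => \1_A w).
Proof.
move=> mA; split; first exact: measurable_indic.
by exists 1 => w; rewrite indicE; case: (_ \in _); rewrite ?normr1 ?normr0.
Qed.

Context (P : probability T R).

Lemma bounded_integrable A f : measurable A -> bounded_measurable f ->
  P.-integrable A (EFin \o f).
Proof.
move=> mA [mf [C fC]]; apply: (@integrableS _ _ _ _ setT) => //.
apply: measurable_bounded_integrable => //.
  by rewrite (le_lt_trans (probability_le1 P measurableT)) ?ltry.
by exists C; split; [exact: num_real|move=> x Cx w _; exact: le_trans (fC w) (ltW Cx)].
Qed.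

Lemma bounded_integralE A f : measurable A -> bounded_measurable f ->
  (\int[P]_(w in A) (f w)%:E)%E = (\int[P]_(w in A) f w)%:E.
Proof.
move=> mA bf; rewrite /Rintegral fineK//.
by apply: integrable_fin_num => //; exact: bounded_integrable.
Qed.

Lemma fin_num_prob A : measurable A -> P A \is a fin_num.
Proof. by move=> mA; exact: fin_num_measure. Qed.

Lemma Rintegral_mono A f g : measurable A ->
  bounded_measurable f -> bounded_measurable g ->
  (forall w, A w -> f w <= g w) ->
  \int[P]_(w in A) f w <= \int[P]_(w in A) g w.
Proof.
by move=> mA bf bg fg; apply: le_Rintegral => //; exact: bounded_integrable.
Qed.

Lemma Rintegral_ae_eq A f g : measurable A ->
  bounded_measurable f -> bounded_measurable g ->
  {ae P, forall w, A w -> f w = g w} ->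
  \int[P]_(w in A) f w = \int[P]_(w in A) g w.
Proof.
move=> mA [mf _] [mg _] fg; rewrite /Rintegral; congr fine.
apply: ae_eq_integral => //.
- by apply/measurable_EFinP; exact: measurable_funTS.
- by apply/measurable_EFinP; exact: measurable_funTS.
by apply: filterS fg => w fgw /fgw ->.
Qed.

Lemma Rintegral_ae_mono A f g : measurable A ->
  bounded_measurable f -> bounded_measurable g ->
  {ae P, forall w, A w -> f w <= g w} ->
  \int[P]_(w in A) f w <= \int[P]_(w in A) g w.
Proof.
move=> mA bf bg fg.
have bmax : bounded_measurable (fun w => Num.max (f w) (g w)).
  case: bf bg => [mf [C fC]] [mg [D gD]]; split; first exact: measurable_maxr.
  exists (Num.max C D) => w; rewrite le_max.
  by case: (leP (f w) (g w)) => _; rewrite ?fC ?gD ?orbT.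
rewrite [leRHS](Rintegral_ae_eq (g := fun w => Num.max (f w) (g w)))//.
  by apply: Rintegral_mono => // w _; rewrite le_max lexx.
by apply: filterS fg => w fgw /fgw fgw'; apply/esym/max_idPr.
Qed.

Lemma fine_probability_setT : fine (P setT) = 1.
Proof. exact: (congr1 fine (@probability_setT _ _ _ P)). Qed.

Lemma fine_prob_indic A : measurable A -> fine (P A) = \int[P]_w \1_A w.
Proof. by move=> mA; rewrite /Rintegral integral_indic// setIT. Qed.

Lemma Rintegral_prob_cst (c : R) : \int[P]_w c = c.
Proof.
by rewrite Rintegral_cst// [X in _ * X]fine_probability_setT mulr1.
Qed.

Lemma Rintegral_prob_bound f C : bounded_measurable f ->
  (forall w, `|f w| <= C) -> `|\int[P]_w f w| <= C.
Proof.
move=> bf fC; rewrite -[leRHS]Rintegral_prob_cst.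
apply: le_trans (le_normr_Rintegral _ (bounded_integrable _ bf)) _ => //.
apply: Rintegral_mono => //; first exact: bounded_measurable_norm.
exact: bounded_measurable_cst.
Qed.

Lemma bounded_convergence A (f_ : nat -> T -> R) (f : T -> R) (C : R) : measurable A ->
  (forall n, measurable_fun setT (f_ n)) -> measurable_fun setT f ->
  (forall n w, `|f_ n w| <= C) ->
  {ae P, forall w, A w -> f_ n w @[n --> \oo] --> f w} ->
  \int[P]_(w in A) f_ n w @[n --> \oo] --> \int[P]_(w in A) f w.
Proof.
move=> mA mf_ mf fC f_f.
have [] := @dominated_convergence _ _ _ P A mA (fun n w => (f_ n w)%:E)
  (fun w => (f w)%:E) (fun=> C%:E).
- by move=> n; apply/measurable_EFinP; exact: measurable_funTS.
- by apply/measurable_EFinP; exact: measurable_funTS.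
- by apply: filterS f_f => w H Aw; apply: cvg_EFin; [exact: nearW|exact: H].
- by apply: (bounded_integrable (f := fun=> C)) => //; exact: bounded_measurable_cst.
- by apply: aeW => w n _; rewrite lee_fin.
by move=> If _ H; apply: fine_cvg; rewrite fineK//; exact: integrable_fin_num If.
Qed.

Lemma Rintegral_dist_le A f g h : measurable A ->
  bounded_measurable f -> bounded_measurable g -> bounded_measurable h ->
  {ae P, forall w, A w -> `|f w - g w| <= h w} ->
  `|\int[P]_(w in A) f w - \int[P]_(w in A) g w| <= \int[P]_(w in A) h w.
Proof.
move=> mA bf bg bh fgh; rewrite -RintegralB//; try exact: bounded_integrable.
have H := le_normr_Rintegral mA (bounded_integrable mA (bounded_measurableB bf bg)).
apply: le_trans H _.
by apply: Rintegral_ae_mono => //; apply/bounded_measurable_norm/bounded_measurableB.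
Qed.

Lemma second_moment_tail A (Z : T -> R) (a : R) : measurable A ->
  bounded_measurable Z -> 0 < a ->
  fine (P (A `&` [set w | a < `|Z w|])) <= (a ^+ 2)^-1 * \int[P]_(w in A) Z w ^+ 2.
Proof.
move=> mA bZ a0; have [mZ _] := bZ.
have mS := measurable_norm_gt a mZ; have bZ2 := bounded_measurable_sqr bZ.
have a20 : 0 < a ^+ 2 by rewrite exprn_gt0.
have -> : fine (P (A `&` [set w | a < `|Z w|])) =
    \int[P]_(w in A) \1_[set w | a < `|Z w|] w.
  by rewrite /Rintegral integral_indic// setIC.
rewrite -RintegralZl//; last exact: bounded_integrable.
apply: Rintegral_mono => //.
- exact: bounded_measurable_indic.
- by apply: bounded_measurableM => //; exact: bounded_measurable_cst.
move=> w _; rewrite indicE; have [|_] := boolP (w \in _); last first.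
  by rewrite mulr_ge0 ?invr_ge0 ?sqr_ge0// ltW.
rewrite inE/= => aZ; rewrite mulrC ler_pdivlMr// mul1r -[Z w ^+ 2]real_normK ?num_real//.
by rewrite ler_pXn2r ?nnegrE// ltW.
Qed.

End bounded_functions.

(** * Weak convergence from cosines *)

Lemma bounded_continuous (R : realType) (f : R -> R) (C : R) : continuous f ->
  (forall x, `|f x| <= C) -> bounded_measurable (f : measurableTypeR R -> R).
Proof.
by move=> cf fC; split; [exact: continuous_measurable_fun|exists C].
Qed.

Lemma continuous_affine_comp (R : realType) (f : R -> R) (a b : R) : continuous f ->
  continuous (fun x => f (a * x + b)).
Proof.
move=> cf x; apply: (@continuous_comp _ _ _ (fun x => a * x + b) f); last exact: cf.
apply: continuousD; last exact: cvg_cst.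
by apply: continuousM; [exact: cvg_cst|exact: cvg_id].
Qed.

Lemma bounded_measurable_cos (R : realType) (a b : R) :
  bounded_measurable ((fun x => cos (a * x + b)) : measurableTypeR R -> R).
Proof.
apply: (@bounded_continuous _ _ 1); last by move=> x; exact: cos_max.
by apply: continuous_affine_comp; exact: continuous_cos.
Qed.

Lemma probability_tight (R : realType) (m : law R) (e : R) : 0 < e ->
  exists2 A : R, 0 < A & (m [set x : R | (A < `|x|)%R] <= e%:E)%E.
Proof.
move=> e0; pose F (n : nat) : set (measurableTypeR R) := [set x : R | n%:R < `|x|].
have mF n : measurable (F n).
  exact: (@measurable_norm_gt _ (measurableTypeR R) R id).
have capF : \bigcap_n F n = set0.
  apply/seteqP; split => // x /(_ (Num.bound `|x|) I); rewrite /F/= => H.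
  by have := archi_boundP (normr_ge0 x); rewrite ltNge (ltW H).
have := @nonincreasing_cvg_mu _ _ _ m F.
rewrite capF measure0 => /(_ _ mF measurable0) H.
have {H} : (m \o F) n @[n --> \oo] --> 0%E.
  apply: H.
    by rewrite (le_lt_trans (probability_le1 m (mF 0%N))) ?ltry.
  move=> i j ij; apply/subsetPset => x; apply: le_lt_trans.
  by rewrite ler_nat.
move/fine_cvg/cvgrPdist_lt/(_ _ e0) => [k _ /(_ k.+1 (leqnSn k))].
rewrite /= sub0r normrN ger0_norm ?fine_ge0// => H; exists k.+1%:R => //.
change (m (F k.+1) <= e%:E)%E.
by rewrite -(fineK (fin_num_prob m (mF k.+1))) lee_fin ltW.
Qed.

(** The part of Levy's continuity theorem in which the limit law is known.
    Convergence holds for trigonometric polynomials by linearity; one of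
    them is close to f on [-A, A] and bounded like f elsewhere, where by
    tightness there is little mass. *)
Lemma weak_cvg_cos (R : realType) (m_ : nat -> law R) (m : law R) :
  (forall a b : R, \int[m_ n]_x cos (a * x + b) @[n --> \oo] -->
     \int[m]_x cos (a * x + b)) ->
  (forall e : R, 0 < e -> exists2 A : R, 0 < A &
     \forall n \near \oo, (m_ n [set x : R | (A < `|x|)%R] <= e%:E)%E) ->
  weak_cvg (fun n => m_ n) m.
Proof.
move=> mcos tight f cf [C fC].
have bf : bounded_measurable (f : measurableTypeR R -> R) := bounded_continuous cf fC.
rewrite bounded_integralE//; under eq_fun do rewrite bounded_integralE//.
apply: cvg_EFin; first exact: nearW.
have trig h : trig_poly h -> bounded_measurable (h : measurableTypeR R -> R) /\
    \int[m_ n]_x h x @[n --> \oo] --> \int[m]_x h x.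
  elim=> {h} [a b|g h _ [bg cg] _ [bh ch]|c g _ [bg cg]].
  - split; last exact: mcos.
    exact: bounded_measurable_cos.
  - split; first exact: bounded_measurableD.
    rewrite RintegralD//; [|exact: bounded_integrable|exact: bounded_integrable].
    under eq_fun do (rewrite RintegralD//; [|exact: bounded_integrable|exact: bounded_integrable]).
    exact: cvgD.
  - split; first by apply: bounded_measurableM => //; exact: bounded_measurable_cst.
    rewrite RintegralZl//; [|exact: bounded_integrable].
    under eq_fun do (rewrite RintegralZl//; [|exact: bounded_integrable]).
    by apply: cvgM => //; exact: cvg_cst.
have C0 : 0 <= C by exact: le_trans (fC 0).
apply/cvgrPdist_le => e e0.
pose D := e / (3 + 4 * C).
have D0 : 0 < D by rewrite divr_gt0//; lra.
have [A1 A10 A1P] := tight _ D0.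
have [A2 A20 A2P] := probability_tight m D0.
pose A := Num.max A1 A2.
have A0 : 0 < A by rewrite lt_max A10.
have [h [th hC hA]] := trig_poly_approx cf fC A0 D0.
have [bh ch] := trig _ th.
pose S (B : R) : set (measurableTypeR R) := [set x : R | B < `|x|].
have mS B : measurable (S B).
  exact: (@measurable_norm_gt _ (measurableTypeR R) R id).
have bSA : bounded_measurable (fun x : measurableTypeR R => \1_(S A) x : R).
  have := @bounded_measurable_indic _ _ R _ (mS A).
  by [].

have key (mu : law R) : (mu (S A) <= D%:E)%E ->
    `|\int[mu]_x f x - \int[mu]_x h x| <= D + 2 * C * D.
  move=> muS; rewrite -RintegralB//; [|exact: bounded_integrable|exact: bounded_integrable].
  apply: le_trans (le_normr_Rintegral _ _) _ => //.
    by apply: bounded_integrable => //; exact: bounded_measurableB.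
  apply: (@le_trans _ _ (\int[mu]_x (D + 2 * C * \1_(S A) x))).
    apply: Rintegral_mono => //.
    - by apply: bounded_measurable_norm; exact: bounded_measurableB.
    - apply: bounded_measurableD; first exact: bounded_measurable_cst.
      apply: bounded_measurableM; first exact: bounded_measurable_cst.
      exact: bSA.
    move=> x _; rewrite indicE; case: (boolP (x \in S A)) => xS.
      apply: le_trans (ler_normB _ _) _; have := fC x; have := hC x.
      by rewrite mulr1; lra.
    rewrite mulr0 addr0; apply: hA; rewrite leNgt; apply: contra xS => xS.
    by rewrite inE.
  rewrite RintegralD//; last 2 first.
  - by apply: bounded_integrable => //; exact: bounded_measurable_cst.
  - apply: bounded_integrable => //.
    apply: bounded_measurableM; first exact: bounded_measurable_cst.
    exact: bSA.
  rewrite Rintegral_prob_cst lerD2l.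
  rewrite RintegralZl//; last by apply: bounded_integrable => //; exact: bSA.
  rewrite ler_wpM2l ?mulr_ge0//.
  by rewrite -fine_prob_indic// -lee_fin fineK ?fin_num_prob.
have lemu (mu : law R) B : B <= A -> (mu (S A) <= mu (S B))%E.
  move=> BA; apply: le_measure; rewrite ?inE//; move=> x; exact: le_lt_trans.
have key0 : `|\int[m]_x f x - \int[m]_x h x| <= D + 2 * C * D.
  by apply: key; apply: le_trans A2P; apply: lemu; rewrite le_max lexx orbT.
move/cvgrPdist_le : ch => /(_ _ D0) ch.
near=> n.
have key1 : `|\int[m_ n]_x f x - \int[m_ n]_x h x| <= D + 2 * C * D.
  apply: key; apply: (@le_trans _ _ (m_ n (S A1))).
    by apply: lemu; rewrite le_max lexx.
  by near: n.
have key2 : `|\int[m]_x h x - \int[m_ n]_x h x| <= D by near: n.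
have -> : e = D + (D + 2 * C * D) + (D + 2 * C * D).
  by rewrite /D; field; rewrite gt_eqF//; lra.
rewrite distrC in key1.
have -> : \int[m]_x f x - \int[m_ n]_x f x =
  (\int[m]_x f x - \int[m]_x h x) + (\int[m]_x h x - \int[m_ n]_x h x) +
  (\int[m_ n]_x h x - \int[m_ n]_x f x) by ring.
apply: le_trans (ler_normD _ _) _; apply: lerD => //.
by apply: le_trans (ler_normD _ _) _; rewrite addrC; apply: lerD.
Unshelve. all: by end_near.
Qed.

(** * The characteristic function of a centered normal law *)

Section normal_characteristic.
Context (R : realType).
Local Notation mu := (@lebesgue_measure R).

(** The fundamental theorem of calculus on [-n, n], for n tending to
    infinity. *)
Lemma Rintegral_derivative_eq0 (h h' : R -> R) :
  (forall x : R, is_derive x 1 h (h' x)) -> continuous h' ->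
  mu.-integrable setT (EFin \o h') ->
  h n%:R @[n --> \oo] --> (0 : R) -> h (- n%:R) @[n --> \oo] --> (0 : R) ->
  \int[mu]_x h' x = 0.
Proof.
move=> dh ch' ih' hp hm.
pose f_ n (x : R) := (h' \_ `[(- n.+1%:R), n.+1%:R]) x.
have mh' : measurable_fun setT h' by exact: continuous_measurable_fun.
have [] := @dominated_convergence _ _ _ mu setT measurableT
  (fun n x => (f_ n x)%:E) (EFin \o h') (fun x => `|(h' x)%:E|)%E.
- move=> n; apply/measurable_EFinP/measurable_restrict => //=.
  by rewrite setTI; exact: measurable_funTS.
- exact/measurable_EFinP.
- apply: aeW => x _; apply: cvg_EFin; first exact: nearW.
  apply: cvg_near_cst.
  near=> n; rewrite /f_ /= patchE mem_set//= in_itv/= -ler_norml.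
  have : `|x| <= n%:R by near: n; exact: nbhs_infty_ger.
  by move/le_trans; apply; rewrite ler_nat.
- by move/integrable_abse: ih'.
- apply: aeW => x n _; rewrite /f_ patchE; case: ifP => _ //=.
  by rewrite normr0 lee_fin.
move=> _ _ H.
have eqI n : (\int[mu]_x (f_ n x)%:E = (h n.+1%:R)%:E - (h (- n.+1%:R))%:E)%E.
  rewrite -(@continuous_FTC2 R h')//.
  - by rewrite [RHS]integral_mkcond; apply: eq_integral => x _; rewrite restrict_EFin.
  - by rewrite (@lt_trans _ _ 0)// oppr_lt0.
  - by apply: continuous_subspaceT.
  - have ch : continuous h.
      move=> x; apply: differentiable_continuous.
      by apply/derivable1_diffP; case: (dh x).
    split.
    + by move=> x _; case: (dh x).
    + exact: (cvg_at_right_filter (ch _)).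
    + exact: (cvg_at_left_filter (ch _)).
  - by move=> x _; rewrite derive1E; case: (dh x) => _ ->.
rewrite /Rintegral.
have : (\int[mu]_x (f_ n x)%:E)%E @[n --> \oo] --> 0%E.
  under eq_fun do rewrite eqI -EFinB.
  apply: cvg_EFin; first exact: nearW.
  rewrite -[X in _ --> X](subr0 (0:R)).
  by apply: cvgB; [move: hp|move: hm]; rewrite -cvg_shiftS.
by move/(cvg_unique (@ereal_hausdorff R) H) => /= ->.
Unshelve. all: by end_near.
Qed.

Variable s : R.
Hypothesis s0 : 0 < s.

Let p : R -> R := normal_pdf 0 s.
Let sn0 : s != 0. Proof. by rewrite gt_eqF. Qed.

Lemma normal_pdf_derive (x : R) : is_derive x 1 p (- (x / s ^+ 2) * p x).
Proof.
have -> : p = (fun x => normal_peak s * expR (- (x ^+ 2) / (s ^+ 2 *+ 2))).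
  by apply/funext => y; rewrite /p /normal_pdf (negbTE sn0) /normal_fun subr0.
have s20 : s ^+ 2 *+ 2 != 0 by rewrite mulrn_eq0/= expf_eq0.
apply: is_derive_eq; rewrite /GRing.scale/=; field; exact: sn0.
Qed.

(** Half of the exponent absorbs |x|, by |x| <= s (1 + x^2/(4 s^2)) <= s exp
    (x^2/(4 s^2)); this leaves a Gaussian function of twice the variance. *)
Lemma normal_pdf_absM (x : R) :
  `|x| * p x <= s * normal_peak s * normal_fun 0 (Num.sqrt 2 * s) x.
Proof.
rewrite /p /normal_pdf (negbTE sn0) /normal_fun subr0.
rewrite exprMn sqr_sqrtr//.
set E := expR (x ^+ 2 / (4 * s ^+ 2)).
have -> : expR (- x ^+ 2 / (s ^+ 2 *+ 2)) =
    expR (- x ^+ 2 / ((2 * s ^+ 2) *+ 2)) * E^-1.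
  rewrite /E -expRN -expRD; congr expR; field; exact: sn0.
have xE : `|x| <= s * E.
  apply: (@le_trans _ _ (s * (1 + x ^+ 2 / (4 * s ^+ 2)))).
    rewrite -(real_normK (num_real x)).
    have -> : s * (1 + `|x| ^+ 2 / (4 * s ^+ 2)) = `|x| + (2 * s - `|x|) ^+ 2 / (4 * s).
      by field; exact: sn0.
    by rewrite lerDl divr_ge0 ?sqr_ge0// mulr_ge0// ltW.
  by rewrite ler_wpM2l ?(ltW s0)//; exact: expR_ge1Dx.
have E0 : 0 < E by exact: expR_gt0.
rewrite [leRHS]mulrAC mulrCA [leRHS]mulrC ler_wpM2l ?normal_peak_ge0//.
rewrite mulrCA [leRHS]mulrC ler_wpM2l ?expR_ge0//.
by rewrite ler_pdivrMr.
Qed.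

Lemma normal_pdf_absM_integrable :
  mu.-integrable setT (fun x => (`|x| * p x)%:E).
Proof.
set t := Num.sqrt 2 * s.
have t0 : t != 0 by rewrite mulf_neq0// sqrtr_eq0 -ltNge.
have : mu.-integrable setT
    (fun x => (s * normal_peak s / normal_peak t)%:E * (normal_pdf 0 t x)%:E)%E.
  by apply: integrableZl => //; exact: integrable_normal_pdf.
apply: le_integrable => //.
  apply/measurable_EFinP/measurable_funM; last exact: measurable_normal_pdf.
  exact: normr_measurable.
move=> x _ /=; rewrite lee_fin.
rewrite ger0_norm ?mulr_ge0 ?normal_pdf_ge0//.
apply: le_trans (normal_pdf_absM x) _.
rewrite /normal_pdf (negbTE t0) mulrA divfK ?gt_eqF ?normal_peak_gt0//.
exact: ler_norm.
Qed.

Lemma normal_pdf_bounded_integrable (f : R -> R) :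
  measurable_fun setT f -> (forall x, `|f x| <= 1) ->
  mu.-integrable setT (fun x => (f x * p x)%:E).
Proof.
move=> mf f1.
apply: le_integrable (integrable_normal_pdf 0 s) => //.
  by apply/measurable_EFinP/measurable_funM => //; exact: measurable_normal_pdf.
move=> x _ /=; rewrite lee_fin normrM ler_piMl//.
Qed.

Let cp : continuous p. Proof. exact: continuous_normal_pdf. Qed.

(** The density satisfies p' = - (x / s^2) p, so that the derivative of sin
    (a x + b) p(x), whose integral vanishes, is a combination of the two
    integrands. *)
Lemma normal_pdf_by_parts (a b : R) :
  \int[mu]_x (x * sin (a * x + b) * p x) =
  s ^+ 2 * a * \int[mu]_x (cos (a * x + b) * p x).
Proof.
have mcos : measurable_fun setT (fun x : R => cos (a * x + b)).
  by apply: continuous_measurable_fun; apply: continuous_affine_comp; exact: continuous_cos.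
have msin : measurable_fun setT (fun x : R => sin (a * x + b)).
  by apply: continuous_measurable_fun; apply: continuous_affine_comp; exact: continuous_sin.
have icos : mu.-integrable setT (fun x => (cos (a * x + b) * p x)%:E).
  by apply: normal_pdf_bounded_integrable => // x; exact: cos_max.
have isin : mu.-integrable setT (fun x => (x * sin (a * x + b) * p x)%:E).
  apply: le_integrable normal_pdf_absM_integrable => //.
    apply/measurable_EFinP/measurable_funM; last exact: measurable_normal_pdf.
    exact: measurable_funM.
  move=> x _ /=; rewrite lee_fin !normrM normr_id.
  by rewrite ler_wpM2r// ler_piMr// sin_max.
pose h x := sin (a * x + b) * p x.
pose h' x := a * (cos (a * x + b) * p x) - (s ^+ 2)^-1 * (x * sin (a * x + b) * p x).
have h'E : \int[mu]_x h' x = a * (\int[mu]_x (cos (a * x + b) * p x)) -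
    (s ^+ 2)^-1 * \int[mu]_x (x * sin (a * x + b) * p x).
  rewrite RintegralB//; last 2 first.
  - exact: (integrableZl measurableT a icos).
  - exact: (integrableZl measurableT (s ^+ 2)^-1 isin).
  by rewrite !RintegralZl.
have hb x : `|h x| <= p x.
  by rewrite normrM (ger0_norm (normal_pdf_ge0 _ _ _)) ler_piMl ?normal_pdf_ge0 ?sin_max.
have nf1 (t x : R) : normal_fun 0 t x <= 1.
  rewrite /normal_fun -[leRHS]expR0 ler_expR mulNr oppr_le0.
  by rewrite divr_ge0 ?sqr_ge0// mulrn_wge0// sqr_ge0.
have pb n : p (n.+1%:R) <= s * normal_peak s / n.+1%:R /\
            p (- n.+1%:R) <= s * normal_peak s / n.+1%:R.
  split; (rewrite ler_pdivlMr// mulrC).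
  - have := normal_pdf_absM n.+1%:R; rewrite ger0_norm// => /le_trans; apply.
    rewrite ler_piMr ?mulr_ge0 ?normal_peak_ge0 ?(ltW s0)//.
  - have := normal_pdf_absM (- n.+1%:R); rewrite normrN ger0_norm// => /le_trans; apply.
    rewrite ler_piMr ?mulr_ge0 ?normal_peak_ge0 ?(ltW s0)//.
have cvg0 : s * normal_peak s / n.+1%:R @[n --> \oo] --> (0 : R).
  rewrite -[X in _ --> X](mulr0 (s * normal_peak s)).
  by apply: cvgM; [exact: cvg_cst|exact: cvg_harmonic].
have H : \int[mu]_x h' x = 0.
  apply: (@Rintegral_derivative_eq0 h).
  - move=> x; have dp := normal_pdf_derive x.
    apply: is_derive_eq; rewrite /h' /GRing.scale/=; field; exact: sn0.
  - have cc : continuous (fun x : R => cos (a * x + b) : R).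
      by apply: continuous_affine_comp; exact: continuous_cos.
    have cs : continuous (fun x : R => sin (a * x + b) : R).
      by apply: continuous_affine_comp; exact: continuous_sin.
    move=> x; apply: cvgB; apply: cvgM; try exact: cvg_cst.
      by apply: cvgM; [exact: cc|exact: cp].
    by apply: cvgM; [apply: cvgM; [exact: cvg_id|exact: cs]|exact: cp].
  - exact: (integrableB measurableT (integrableZl measurableT a icos)
      (integrableZl measurableT (s ^+ 2)^-1 isin)).
  - rewrite -cvg_shiftS; apply/norm_cvg0P.
    apply: (@squeeze_cvgr _ _ _ _ (fun=> 0) (fun n => s * normal_peak s / n.+1%:R)) => //.
      by apply: nearW => n; rewrite normr_ge0/=; apply: le_trans (hb _) _; case: (pb n).
    exact: cvg_cst.
  - rewrite -cvg_shiftS; apply/norm_cvg0P.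
    apply: (@squeeze_cvgr _ _ _ _ (fun=> 0) (fun n => s * normal_peak s / n.+1%:R)) => //.
      by apply: nearW => n; rewrite normr_ge0/=; apply: le_trans (hb _) _; case: (pb n).
    exact: cvg_cst.
move: H; rewrite h'E => /subr0_eq H.
by rewrite -mulrA H mulrA divff ?mul1r// expf_eq0.
Qed.

End normal_characteristic.

Section normal_cos.
Context (R : realType).
Local Notation mu := (@lebesgue_measure R).
Variable s : R.
Hypothesis s0 : 0 < s.
Let p : R -> R := normal_pdf 0 s.

(** As a function F of the frequency, the integral solves F'(a) = - s^2 a
    F(a). *)
Lemma normal_pdf_cos_derive (b t : R) :
  is_derive t (1 : R) (fun a => \int[mu]_x (cos (a * x + b) * p x))
    (- (s ^+ 2 * t * \int[mu]_x (cos (t * x + b) * p x))).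
Proof.
pose f (a x : R) := cos (a * x + b) * p x.
have df (a x : R) : is_derive a (1 : R) (f ^~ x) (- (x * sin (a * x + b) * p x)).
  apply: is_derive_eq; rewrite /GRing.scale/=; ring.
have d1f (a x : R) : partial1of2 f a x = - (x * sin (a * x + b) * p x).
  by rewrite partial1of2E; case: (df a x).
have If (x : R) : `]t - 1, t + 1[%classic x -> mu.-integrable setT (EFin \o f x).
  move=> _; apply: normal_pdf_bounded_integrable => //.
    apply: continuous_measurable_fun; apply: continuous_affine_comp; exact: continuous_cos.
  by move=> y; exact: cos_max.
have It : `]t - 1, t + 1[%classic t by rewrite /= in_itv/=; lra.
have D (x y : R) : `]t - 1, t + 1[%classic x -> [set: R] y -> derivable (f ^~ y) x (1 : R).
  by move=> _ _; case: (df x y).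
have G0 (y : R) : 0 <= `|y| * p y by rewrite mulr_ge0// normal_pdf_ge0.
have Gub (x y : R) : `]t - 1, t + 1[%classic x -> [set: R] y -> `|partial1of2 f x y| <= `|y| * p y.
  move=> _ _; rewrite d1f normrN !normrM (ger0_norm (normal_pdf_ge0 _ _ _)).
  by rewrite ler_wpM2r ?normal_pdf_ge0// ler_piMr// sin_max.
have iG := normal_pdf_absM_integrable s0.
apply: DeriveDef.
  exact: (derivable_under_integral measurableT It If D G0 iG Gub).
rewrite -derive1E (differentiation_under_integral measurableT It If D G0 iG Gub).
under eq_Rintegral do rewrite d1f.
rewrite -normal_pdf_by_parts// -mulN1r -RintegralZl//; last first.
  apply: le_integrable (normal_pdf_absM_integrable s0) => //.
    apply/measurable_EFinP/measurable_funM; last exact: measurable_normal_pdf.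
    apply: measurable_funM => //.
    apply: continuous_measurable_fun; apply: continuous_affine_comp; exact: continuous_sin.
  move=> x _ /=; rewrite lee_fin !normrM normr_id.
  by rewrite ler_wpM2r// ler_piMr// sin_max.
by apply: eq_Rintegral => x _; rewrite mulN1r.
Qed.

Lemma normal_pdf_cos (a b : R) :
  \int[mu]_x (cos (a * x + b) * p x) = expR (- (s ^+ 2 * a ^+ 2 / 2)) * cos b.
Proof.
pose F (a : R) := \int[mu]_x (cos (a * x + b) * p x).
pose psi (a : R) := expR (s ^+ 2 * a ^+ 2 / 2) * F a.
have dpsi (t : R) : is_derive t (1 : R) psi 0.
  have dF : is_derive t (1 : R) F (- (s ^+ 2 * t * F t)) by exact: normal_pdf_cos_derive.
  by apply: is_derive_eq; rewrite /GRing.scale/=; field.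
have F0 : F 0 = cos b.
  rewrite /F; under eq_Rintegral do rewrite mul0r add0r.
  rewrite RintegralZl//; last exact: integrable_normal_pdf.
  by rewrite /Rintegral integral_normal_pdf mulr1.
have := is_derive_0_is_cst a 0 dpsi.
rewrite /psi expr0n/= mulr0 mul0r expR0 mul1r F0 expRN => <-.
by rewrite mulrA mulVf ?mul1r ?gt_eqF ?expR_gt0.
Qed.

End normal_cos.

Section centered_normal.
Context (R : realType).
Local Notation mu := (@lebesgue_measure R).

Lemma Rintegral_normal_prob (m s : R) (f : R -> R) :
  bounded_measurable (f : measurableTypeR R -> R) ->
  \int[normal_prob m s]_x f x = \int[mu]_x (f x * normal_pdf m s x).
Proof.
move=> bf; have [mf _] := bf.
have If : (normal_prob m s).-integrable setT (EFin \o f).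
  exact: (@bounded_integrable _ (measurableTypeR R) R (normal_prob m s)).
congr fine.
rewrite -(Radon_Nikodym_change_of_variables (normal_prob_dominates m s))//=.
apply: ae_eq_integral => //.
- apply: emeasurable_funM; first exact/measurable_EFinP.
  apply: (measurable_int mu).
  by apply: Radon_Nikodym_integrable; exact: normal_prob_dominates.
- by apply/measurable_EFinP/measurable_funM => //; exact: measurable_normal_pdf.
- rewrite [X in ae_eq _ _ _ X](_ : _ = (fun x => (f x)%:E * (normal_pdf m s x)%:E)%E)//.
  apply: ae_eqe_mul2l => /=.
  rewrite Radon_NikodymE//=; first exact: normal_prob_dominates.
  move=> dom; case: cid => /= h [h1 h2 h3].
  apply: integral_ae_eq => //=.
  + by apply/measurable_EFinP; exact: measurable_normal_pdf.
  + by move=> E _ mE; rewrite -h3.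
Qed.

Lemma centered_normal_cos (v a b : R) : 0 <= v ->
  \int[centered_normal v]_x cos (a * x + b) = expR (- (v * a ^+ 2 / 2)) * cos b.
Proof.
move=> v0; rewrite /centered_normal; have [->|vn0] := eqVneq v 0.
  rewrite /Rintegral integral_dirac//; last first.
    by apply/measurable_EFinP; case: (bounded_measurable_cos a b).
  by rewrite diracE in_setT mul1e/= mulr0 add0r !mul0r oppr0 expR0 mul1r.
have vgt0 : 0 < v by rewrite lt_neqAle eq_sym vn0.
rewrite Rintegral_normal_prob; last exact: bounded_measurable_cos.
by rewrite normal_pdf_cos ?sqrtr_gt0// sqr_sqrtr.
Qed.

(** The density is jointly measurable in v and x, so that its integral over
    A is measurable in v. All v < 0 share one law, because their square
    roots are 0. *)
Lemma measurable_centered_normal (A : set (measurableTypeR R)) : measurable A ->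
  measurable_fun setT (fun v : R => centered_normal v A).
Proof.
move=> mA.
pose g (z : measurableTypeR R * measurableTypeR R) : R :=
  (Num.sqrt (z.1 * pi *+ 2)) `^ (-1) * expR (- z.2 ^+ 2 * ((z.1 *+ 2) `^ (-1))) * \1_A z.2.
pose h (v : R) := (\int[mu]_x (g (v, x))%:E)%E.
have mg : measurable_fun setT g.
  have m1 : measurable_fun setT (fun z : measurableTypeR R * measurableTypeR R => z.1).
    exact: measurable_fst.
  have m2 : measurable_fun setT (fun z : measurableTypeR R * measurableTypeR R => z.2).
    exact: measurable_snd.
  have mV (k : measurableTypeR R * measurableTypeR R -> R) : measurable_fun setT k ->
      measurable_fun setT (fun z => k z `^ (-1)).
    by move=> mk; exact: (measurableT_comp (@measurable_powR R (-1)) mk).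
  have mc c : measurable_fun setT (fun z : measurableTypeR R * measurableTypeR R => z.1 * c).
    exact: measurable_funM.
  apply: measurable_funM; last first.
    exact: (measurableT_comp (@measurable_indic _ _ R setT A mA) m2).
  apply: measurable_funM.
    apply: mV; under eq_fun do rewrite -mulr_natr -mulrA.
    have msq : measurable_fun setT (@Num.sqrt R).
      by apply: continuous_measurable_fun; exact: sqrt_continuous.
    exact: (measurableT_comp msq (mc _)).
  apply: (measurableT_comp (@measurable_expR R)); apply: measurable_funM.
    by apply: measurableT_comp => //=; exact: measurable_funX.
  by apply: mV; under eq_fun do rewrite -mulr_natr; exact: mc.
have mh : measurable_fun setT h.
  apply: (@measurable_fun_fubini_tonelli_F _ _ _ _ R mu (EFin \o g)) => //.
  - exact/measurable_EFinP.
  - by move=> z; rewrite lee_fin !mulr_ge0 ?powR_ge0 ?expR_ge0.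
have -> : (fun v : R => centered_normal v A) = (fun v : R =>
    if v == 0 then (centered_normal (0 : R) A) else
    if v < 0 then (centered_normal (-1 : R) A) else h v).
  apply/funext => v; case: ifPn => [/eqP ->//|vn0]; case: ifPn => v0.
    rewrite /centered_normal (negbTE vn0) oppr_eq0 oner_eq0.
    by rewrite !ler0_sqrtr ?ltW// oppr_le0.
  rewrite -leNgt in v0.
  have vgt0 : 0 < v by rewrite lt_neqAle eq_sym vn0.
  have sn0 : Num.sqrt v != 0 by rewrite sqrtr_eq0 -ltNge.
  rewrite /centered_normal (negbTE vn0) /= /normal_prob integral_mkcond.
  apply: eq_integral => x _; rewrite /g /= patchE.
  rewrite /normal_pdf (negbTE sn0) /normal_fun /normal_peak subr0 sqr_sqrtr//.
  rewrite !powR_inv1 ?mulrn_wge0// indicE; case: (x \in A); last by rewrite mulr0.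
  by rewrite mulr1.
apply: measurable_fun_ifT => //.
  exact: measurable_fun_eqr.
apply: measurable_fun_ifT => //.
exact: measurable_fun_ltr.
Qed.

End centered_normal.

(** * Mixtures of laws *)

Section mixture_probability.
Context d (T : measurableType d) (R : realType) (P : probability T R).
Variables (mu : T -> law R) (hmu : random_probability mu).

Definition mixture_base (u : unit) : {measure set T -> \bar R} := P.
Definition mixture_kernel (z : unit * T) :
  {measure set (measurableTypeR R) -> \bar R} := mu z.2.

HB.instance Definition _ := isKernel.Build _ _ _ _ R mixture_base
  (fun U _ => measurable_cst (P U)).
HB.instance Definition _ := Kernel_isProbability.Build _ _ _ _ R mixture_base
  (fun=> probability_setT P).

Let measurable_mixture_kernel U : measurable U ->
  measurable_fun setT (mixture_kernel ^~ U).
Proof.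
move=> mU; have h := hmu mU.
exact: (measurableT_comp h measurable_snd).
Qed.

HB.instance Definition _ := isKernel.Build _ _ _ _ R mixture_kernel
  measurable_mixture_kernel.
HB.instance Definition _ := Kernel_isProbability.Build _ _ _ _ R mixture_kernel
  (fun z => probability_setT (mu z.2)).

(** The mixture is the composition of P, seen as a constant kernel, with the
    kernel w |-> mu w: hence it is a measure, and its integrals are iterated
    integrals. *)
Definition mixture_measure : set (measurableTypeR R) -> \bar R :=
  kcomp mixture_base mixture_kernel tt.

HB.instance Definition _ := Measure.on mixture_measure.

Let mixture_setT : mixture_measure setT = 1%E.
Proof.
transitivity (\int[P]_(w in setT) (cst 1%E w))%E; last first.
  by rewrite integral_cst// mul1e; exact: (@probability_setT _ _ _ P).
by apply: eq_integral => w _; exact: (@probability_setT _ _ _ (mu w)).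
Qed.

HB.instance Definition _ := Measure_isProbability.Build _ _ _ mixture_measure
  mixture_setT.

Definition mixture_law : law R := mixture_measure.

Lemma mixture_lawE : mixture P mu = mixture_law.
Proof. by []. Qed.

Lemma bounded_Rintegral_random (f : measurableTypeR R -> R) :
  bounded_measurable f -> bounded_measurable (fun w => \int[mu w]_x f x).
Proof.
move=> bf; have [mf [C fC]] := bf; split; last first.
  by exists C => w; exact: Rintegral_prob_bound.
have bg : bounded_measurable (fun x => f x + C).
  by apply: bounded_measurableD => //; exact: bounded_measurable_cst.
(* adding C makes the integrand nonnegative, as measurability of integrals
   against a kernel requires *)
have -> : (fun w => \int[mu w]_x f x) =
    (fun w => fine (\int[mu w]_x (f x + C)%:E)%E - C).
  apply/funext => w; rewrite bounded_integralE//=.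
  rewrite RintegralD//; last 2 first.
  - exact: bounded_integrable.
  - by apply: bounded_integrable => //; exact: bounded_measurable_cst.
  by rewrite Rintegral_prob_cst addrK.
apply: measurable_funB => //; apply: measurableT_comp => //.
apply: measurable_fun_integral_kernel => //.
  by move=> x; rewrite lee_fin; have := fC x; rewrite ler_norml; lra.
by apply/measurable_EFinP; case: bg.
Qed.

Lemma Rintegral_mixture (f : measurableTypeR R -> R) : bounded_measurable f ->
  \int[mixture_law]_x f x = \int[P]_w \int[mu w]_x f x.
Proof.
move=> bf; have [mf [C fC]] := bf.
have bg : bounded_measurable (fun x => f x + C).
  by apply: bounded_measurableD => //; exact: bounded_measurable_cst.
have gE (m : law R) : \int[m]_x (f x + C) = \int[m]_x f x + C.
  rewrite RintegralD//; last 2 first.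
  - exact: bounded_integrable.
  - by apply: bounded_integrable => //; exact: bounded_measurable_cst.
  by rewrite Rintegral_prob_cst.
have : (\int[mixture_law]_x (f x + C)%:E = \int[P]_w (\int[mu w]_x (f x + C)%:E))%E.
  apply: (@integral_kcomp _ _ _ _ _ _ R mixture_base mixture_kernel tt
    (fun x => (f x + C)%:E)).
    by move=> x; rewrite lee_fin; have := fC x; rewrite ler_norml; lra.
  by apply/measurable_EFinP; case: bg.
rewrite bounded_integralE//.
under eq_integral do rewrite bounded_integralE// gE.
rewrite bounded_integralE//; last first.
  apply: bounded_measurableD; last exact: bounded_measurable_cst.
  exact: bounded_Rintegral_random.
rewrite gE RintegralD//; last 2 first.
- by apply: bounded_integrable => //; exact: bounded_Rintegral_random.
- by apply: bounded_integrable => //; exact: bounded_measurable_cst.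
rewrite Rintegral_prob_cst => -[].
by move/addIr.
Qed.

End mixture_probability.

(** * Elementary inequalities *)

Section elementary_bounds.
Context (R : realType).
Implicit Types (x y a : R).

(** Applied repeatedly, this yields the Taylor bounds of sine and cosine
    from 1 - sin x >= 0 and 1 - cos x >= 0. *)
Lemma ge0_of_derive (f df : R -> R) :
  (forall x, is_derive x (1 : R) f (df x)) -> (forall x, 0 <= x -> 0 <= df x) ->
  f 0 = 0 -> forall x, 0 <= x -> 0 <= f x.
Proof.
move=> dfE df0 f0 x x0.
have cf : {within `[0, x], continuous f}.
  apply: continuous_subspaceT => y.
  by apply: differentiable_continuous; apply/derivable1_diffP; case: (dfE y).
have [c /[!in_itv]/= /andP[c0 cx] H] := MVT_segment x0 (fun y _ => dfE y) cf.
by move: H; rewrite f0 !subr0 => ->; rewrite mulr_ge0// df0.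
Qed.

Lemma cos_ge_taylor1 x : 0 <= x -> 0 <= x - 1 + cos x.
Proof.
apply: (@ge0_of_derive (fun x => x - 1 + cos x) (fun x => 1 - sin x)).
- by move=> y; apply: is_derive_eq; rewrite /GRing.scale/=; ring.
- by move=> y _; rewrite subr_ge0 sin_le1.
- by rewrite cos0; ring.
Qed.

Lemma sin_ge_taylor2 x : 0 <= x -> 0 <= 2^-1 * x ^+ 2 - x + sin x.
Proof.
apply: (@ge0_of_derive (fun x => 2^-1 * x ^+ 2 - x + sin x) (fun x => x - 1 + cos x)).
- by move=> y; apply: is_derive_eq; rewrite /GRing.scale/=; field.
- exact: cos_ge_taylor1.
- by rewrite sin0; ring.
Qed.

Lemma cos_le_taylor3 x : 0 <= x -> 0 <= 6^-1 * x ^+ 3 - (cos x - 1 + 2^-1 * x ^+ 2).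
Proof.
apply: (@ge0_of_derive (fun x => 6^-1 * x ^+ 3 - (cos x - 1 + 2^-1 * x ^+ 2))
  (fun x => 2^-1 * x ^+ 2 - x + sin x)).
- by move=> y; apply: is_derive_eq; rewrite /GRing.scale/=; field.
- exact: sin_ge_taylor2.
- by rewrite cos0; ring.
Qed.

Lemma sin_le_id x : 0 <= x -> 0 <= x - sin x.
Proof.
move=> x0; have -> : x - sin x = -1 * sin x + x by ring.
apply: (@ge0_of_derive (fun x => -1 * sin x + x) (fun x => 1 - cos x)) x0.
- by move=> y; apply: is_derive_eq; rewrite /GRing.scale/=; ring.
- by move=> y _; rewrite subr_ge0 cos_le1.
- by rewrite sin0; ring.
Qed.

Lemma cos_ge_taylor2 x : 0 <= x -> 0 <= cos x - 1 + 2^-1 * x ^+ 2.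
Proof.
apply: (@ge0_of_derive (fun x => cos x - 1 + 2^-1 * x ^+ 2) (fun x => x - sin x)).
- by move=> y; apply: is_derive_eq; rewrite /GRing.scale/=; field.
- exact: sin_le_id.
- by rewrite cos0; ring.
Qed.

Lemma sin_ge_taylor3 x : 0 <= x -> 0 <= sin x - x + 6^-1 * x ^+ 3.
Proof.
apply: (@ge0_of_derive (fun x => sin x - x + 6^-1 * x ^+ 3)
  (fun x => cos x - 1 + 2^-1 * x ^+ 2)).
- by move=> y; apply: is_derive_eq; rewrite /GRing.scale/=; field.
- exact: cos_ge_taylor2.
- by rewrite sin0; ring.
Qed.

Lemma cos_taylor2 a x :
  `|cos (a + x) - (cos a - x * sin a - 2^-1 * x ^+ 2 * cos a)| <= `|x| ^+ 3.
Proof.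
rewrite cosD.
have -> : cos a * cos x - sin a * sin x - (cos a - x * sin a - 2^-1 * x ^+ 2 * cos a) =
  cos a * (cos x - 1 + 2^-1 * x ^+ 2) - sin a * (sin x - x) by ring.
have c6 : `|cos x - 1 + 2^-1 * x ^+ 2| <= 6^-1 * `|x| ^+ 3.
  rewrite -[cos x]cos_norm -[x ^+ 2](real_normK (num_real x)).
  have := cos_ge_taylor2 (normr_ge0 x); have := cos_le_taylor3 (normr_ge0 x).
  have x3 : 0 <= `|x| ^+ 3 by exact: exprn_ge0.
  by move=> H1 H2; rewrite ler_norml; lra.
have s6 : `|sin x - x| <= 6^-1 * `|x| ^+ 3.
  have [x0|x0] := leP 0 x.
    have := sin_ge_taylor3 x0; have := sin_le_id x0.
    have x3 : 0 <= x ^+ 3 by exact: exprn_ge0.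
    by rewrite (ger0_norm x0) => H1 H2; rewrite ler_norml; lra.
  have x0' : 0 <= - x by lra.
  have := sin_ge_taylor3 x0'; have := sin_le_id x0'; rewrite sinN.
  have x3 : 0 <= (- x) ^+ 3 by exact: exprn_ge0.
  by rewrite (ltr0_norm x0) => H1 H2; rewrite ler_norml; lra.
apply: le_trans (ler_normB _ _) _; rewrite !normrM.
have x3 : 0 <= `|x| ^+ 3 by exact: exprn_ge0.
apply: (@le_trans _ _ (6^-1 * `|x| ^+ 3 + 6^-1 * `|x| ^+ 3)); last lra.
apply: lerD; rewrite -[leRHS]mul1r; apply: ler_pM => //.
  exact: cos_max.
exact: sin_max.
Qed.

Lemma expRN_taylor1 x : 0 <= x -> `|expR (- x) - 1 + x| <= x ^+ 2.
Proof.
move=> x0; have H1 := expR_ge1Dx (- x); have H2 := expR_ge1Dx x.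
rewrite ger0_norm; last lra.
have : expR (- x) <= (1 + x)^-1.
  by rewrite expRN lef_pV2 ?posrE ?expR_gt0//; lra.
suff : (1 + x)^-1 <= 1 - x + x ^+ 2 by lra.
rewrite -[leLHS]mul1r ler_pdivrMr; last lra.
have -> : (1 - x + x ^+ 2) * (1 + x) = 1 + x ^+ 3 by ring.
by rewrite lerDl exprn_ge0.
Qed.

End elementary_bounds.

Lemma expRN_lipschitz (R : realType) (x y : R) : 0 <= x -> 0 <= y ->
  `|expR (- x) - expR (- y)| <= `|x - y|.
Proof.
move=> x0 y0; wlog xy : x y x0 y0 / x <= y.
  by move=> H; have [/H|/ltW/H yx] := leP x y; [exact|rewrite distrC [X in _ <= X]distrC; exact: yx].
have -> : expR (- y) = expR (- x) * expR (- (y - x)) by rewrite -expRD; congr expR; ring.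
rewrite -[X in X - _]mulr1 -mulrBr normrM (ger0_norm (expR_ge0 _)) [leRHS]distrC.
rewrite ger0_norm; last by rewrite subr_ge0 -[leRHS]expR0 ler_expR; lra.
have e1 : expR (- x) <= 1 by rewrite -[leRHS]expR0 ler_expR; lra.
have := expR_ge1Dx (- (y - x)); have := expR_ge0 (- x).
have : expR (- (y - x)) <= 1 by rewrite -[leRHS]expR0 ler_expR; lra.
rewrite (@ger0_norm _ (y - x)); last lra.
move: (expR _) (expR _) e1 => u v; nra.
Qed.

Lemma cos_lipschitz (R : realType) (x y : R) : `|cos x - cos y| <= `|x - y|.
Proof.
wlog xy : x y / y <= x.
  by move=> H; have [/H//|/ltW/H] := leP y x; rewrite distrC [X in _ <= X -> _]distrC.
have t0 : 0 <= x - y by rewrite subr_ge0.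
rewrite (ger0_norm t0) ler_norml; apply/andP; split; rewrite -subr_ge0.
  have := @ge0_of_derive R (fun t => t + cos (y + t) - cos y) (fun t => 1 - sin (y + t)).
  move=> /(_ _ _ _ _ t0); rewrite subrKC => H.
  have -> : cos x - cos y - - (x - y) = x - y + cos x - cos y by ring.
  apply: H.
  - by move=> t; apply: is_derive_eq; rewrite /GRing.scale/=; ring.
  - by move=> t _; rewrite subr_ge0 sin_le1.
  - by rewrite addr0; lra.
have := @ge0_of_derive R (fun t => t - cos (y + t) + cos y) (fun t => 1 + sin (y + t)).
move=> /(_ _ _ _ _ t0); rewrite subrKC => H.
have -> : x - y - (cos x - cos y) = x - y - cos x + cos y by ring.
apply: H.
- by move=> t; apply: is_derive_eq; rewrite /GRing.scale/=; ring.
- by move=> t _; have := sin_geN1 (y + t); lra.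
- by rewrite addr0; lra.
Qed.

Section real_sequences.
Context (R : realType).

Lemma harmonic_increments (u : nat -> R) : (forall n, `|u n.+1 - u n| <= n.+1%:R^-1) ->
  forall n m, (n <= m)%N -> `|u m - u n| <= (m - n)%:R / n.+1%:R.
Proof.
move=> du n; elim=> [|m IH]; first by rewrite leqn0 => /eqP ->; rewrite !subrr normr0 mul0r.
rewrite leq_eqVlt => /predU1P[->|]; first by rewrite subrr normr0 subnn mul0r.
rewrite ltnS => nm; rewrite subSn// -[(m - n).+1%:R]natr1 mulrDl mul1r.
have -> : u m.+1 - u n = (u m - u n) + (u m.+1 - u m) by ring.
apply: le_trans (ler_normD _ _) _; apply: lerD; first exact: IH.
by apply: le_trans (du m) _; rewrite lef_pV2 ?posrE// ler_nat ltnS.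
Qed.

(** From (k + 1)^3 to (k + 2)^3 there are at most 7 (k + 1)^2 steps of size
    at most (k + 1)^-3, so that u moves by at most 7 / (k + 1) between two
    consecutive cubes. *)
Lemma cvg_of_cubes (u : nat -> R) : (forall n, `|u n.+1 - u n| <= n.+1%:R^-1) ->
  cvgn (fun k => u (k.+1 ^ 3)%N) -> cvgn u.
Proof.
move=> du /cvg_ex[l /= ul]; apply/cvg_ex; exists l.
have inc := harmonic_increments du.
have block K n : (K.+1 ^ 3 <= n)%N -> exists2 k, (K <= k)%N & (k.+1 ^ 3 <= n < k.+2 ^ 3)%N.
  elim: n => [|n IH]; first by rewrite leqn0 expn_eq0.
  rewrite leq_eqVlt => /predU1P[<-|].
    by exists K => //; rewrite leqnn/= ltn_exp2r.
  rewrite ltnS => /IH[k Kk /andP[k1 k2]].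
  have [nk|nk] := ltnP n.+1 (k.+2 ^ 3)%N.
    by exists k => //; rewrite nk andbT leqW.
  exists k.+1; first exact: leqW.
  by rewrite nk/=; apply: leq_ltn_trans k2 _; rewrite ltn_exp2r.
apply/cvgrPdist_le => e e0.
have e20 : 0 < e / 2 by rewrite divr_gt0.
move/cvgrPdist_le : ul => /(_ _ e20)[K1 _ HK1].
pose K2 := Num.bound (7 / (e / 2)).
have K2P k : (K2 <= k)%N -> 7 / k.+1%:R <= e / 2.
  move=> kk; rewrite ler_pdivrMr// mulrC -ler_pdivrMr//.
  apply: le_trans (_ : K2%:R <= _); last by rewrite ler_nat leqW.
  by apply/ltW/archi_boundP; rewrite divr_ge0// ltW.
exists ((maxn K1 K2).+1 ^ 3)%N => // n /= /block[k].
rewrite geq_max => /andP[k1 k2] /andP[kn nk].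
have -> : l - u n = (l - u (k.+1 ^ 3)%N) - (u n - u (k.+1 ^ 3)%N) by ring.
rewrite [e]splitr; apply: le_trans (ler_normB _ _) _; apply: lerD; first exact: HK1.
apply: le_trans (inc _ _ kn) _; apply: le_trans (K2P k k2).
rewrite ler_pdivrMr// mulrAC ler_pdivlMr//.
apply: (@le_trans _ _ ((7 * k.+1 ^ 2)%:R * k.+1%:R)).
  rewrite ler_wpM2r// ler_nat; rewrite leq_subLR; apply: ltnW; apply: leq_trans nk _.
  by rewrite !expnS !expn0; nia.
by rewrite -!natrM ler_nat -mulnA -expnSr leq_mul.
Qed.

Lemma sum_inv_sqr_le K : \sum_(0 <= k < K) (k.+1%:R ^+ 2)^-1 <= 2 :> R.
Proof.
case: K => [|K]; first by rewrite big_geq.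
suff H : \sum_(0 <= k < K.+1) (k.+1%:R ^+ 2)^-1 <= 2 - K.+1%:R^-1 :> R.
  by apply: le_trans H _; rewrite lerBlDr lerDl invr_ge0.
elim: K => [|K IH]; first by rewrite big_nat1 expr1n invr1; lra.
rewrite big_nat_recr//=; apply: le_trans (lerD IH (lexx _)) _.
have K1 : 0 < K.+1%:R :> R by [].
rewrite -[K.+2%:R]natr1; move: (K.+1%:R) K1 => t t0.
have : 0 <= (t * (t + 1) ^+ 2)^-1 by rewrite invr_ge0 !mulr_ge0 ?sqr_ge0//; lra.
have -> : (t * (t + 1) ^+ 2)^-1 = (t^-1 - (t + 1)^-1) - (t + 1) ^- 2.
  by field; rewrite !gt_eqF//; lra.
by lra.
Qed.

End real_sequences.

(** * One step of the urn *)

Section urn_step.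
Context (R : realType).
Implicit Types (n j : nat) (x y m : R) (g h : R -> R).

Definition urn_total n : R := (4 * n + 2)%:R.

(** The transition operator over a period which starts with total weight S
    and left weight S x. Both walkers leave 0 in turn: they choose the left
    edge twice with probability x (S x + 1) / (S + 1), once with probability
    2 x (1 - x) S / (S + 1), or never; a walker which comes back has added 2
    to the weight of its edge. *)
Definition urn_step n g x : R :=
  (1 - x) * (urn_total n * (1 - x) + 1) / (urn_total n + 1) *
    g (urn_total n * x / urn_total n.+1) +
  2 * x * (1 - x) * urn_total n / (urn_total n + 1) *
    g ((urn_total n * x + 2) / urn_total n.+1) +
  x * (urn_total n * x + 1) / (urn_total n + 1) *
    g ((urn_total n * x + 4) / urn_total n.+1).

(** Both edges have weight at least 1. *)
Definition urn_domain n x := 1 <= urn_total n * x <= urn_total n - 1.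

Lemma urn_totalE n : urn_total n = 4 * n%:R + 2.
Proof. by rewrite /urn_total natrD natrM. Qed.

Lemma urn_totalS n : urn_total n.+1 = urn_total n + 4.
Proof. by rewrite !urn_totalE -natr1; ring. Qed.

Lemma urn_total_ge2 n : 2 <= urn_total n.
Proof. by rewrite urn_totalE lerDr mulr_ge0. Qed.

Lemma urn_domain01 n x : urn_domain n x -> 0 < x < 1.
Proof.
move=> /andP[]; have := urn_total_ge2 n.
move: (urn_total n) => S S2 H1 H2.
apply/andP; split.
  by rewrite -(@pmulr_rgt0 _ S); lra.
by rewrite -(@ltr_pM2l _ S); lra.
Qed.

Lemma urn_step_affine n (a b : R) g x :
  urn_step n (fun y => a + b * g y) x = a + b * urn_step n g x.
Proof.
rewrite /urn_step; have := urn_total_ge2 n; move: (urn_total n) => S S2.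
move: (g _) (g _) (g _) => u v w; field; rewrite gt_eqF//; lra.
Qed.

Lemma urn_stepD n g h x :
  urn_step n (fun y => g y + h y) x = urn_step n g x + urn_step n h x.
Proof. by rewrite /urn_step; ring. Qed.

Lemma urn_stepZ n (a : R) g x :
  urn_step n (fun y => a * g y) x = a * urn_step n g x.
Proof. by rewrite /urn_step; ring. Qed.

Lemma urn_step_cst n (a : R) x : urn_step n (fun=> a) x = a.
Proof.
rewrite /urn_step; have := urn_total_ge2 n; move: (urn_total n) => S S2.
by field; rewrite gt_eqF//; lra.
Qed.

Lemma urn_step_mono n g h x : urn_domain n x ->
  (forall y, urn_domain n.+1 y -> `|y - x| <= n.+1%:R^-1 -> g y <= h y) ->
  urn_step n g x <= urn_step n h x.
Proof.
move=> dx gh; have /andP[x0 x1] := urn_domain01 dx.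
have S2 := urn_total_ge2 n.
have dom i : 0 <= i <= (4 : R) ->
    urn_domain n.+1 ((urn_total n * x + i) / urn_total n.+1).
  move=> i04; have S0 : urn_total n.+1 != 0 by rewrite gt_eqF// urn_totalS; lra.
  rewrite /urn_domain [_ * (_ / _)]mulrC divfK// urn_totalS.
  by move: dx; rewrite /urn_domain; lra.
have near_x i : 0 <= i <= (4 : R) ->
    `|(urn_total n * x + i) / urn_total n.+1 - x| <= n.+1%:R^-1.
  move=> i04; have S0 : 0 < urn_total n.+1 by rewrite urn_totalS; lra.
  have -> : (urn_total n * x + i) / urn_total n.+1 - x = (i - 4 * x) / urn_total n.+1.
    by rewrite urn_totalS in S0 *; field; rewrite gt_eqF.
  rewrite normrM normfV (gtr0_norm S0) ler_pdivrMr//.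
  apply: (@le_trans _ _ 4); first by rewrite ler_norml; lra.
  rewrite urn_totalE mulrDr mulrCA mulVf ?pnatr_eq0// mulr1.
  by rewrite lerDl.
have Sx0 : 0 <= urn_total n * x by rewrite mulr_ge0; lra.
have Sx1 : 0 <= urn_total n * (1 - x) by rewrite mulr_ge0; lra.
rewrite /urn_step; apply: lerD; first apply: lerD.
- apply: ler_wpM2l; first by apply: divr_ge0; [apply: mulr_ge0|]; lra.
  by apply: gh; [have := dom 0|have := near_x 0]; rewrite addr0; apply; lra.
- apply: ler_wpM2l; last by apply: gh; [apply: dom|apply: near_x]; lra.
  by apply: divr_ge0; [rewrite -mulrA; apply: mulr_ge0; [|rewrite mulrC]|]; lra.
- apply: ler_wpM2l; last by apply: gh; [apply: dom|apply: near_x]; lra.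
  by apply: divr_ge0; [apply: mulr_ge0|]; lra.
Qed.

Lemma urn_step_norm n g h x : urn_domain n x ->
  (forall y, urn_domain n.+1 y -> `|y - x| <= n.+1%:R^-1 -> `|g y| <= h y) ->
  `|urn_step n g x| <= urn_step n h x.
Proof.
move=> dx gh; rewrite ler_norml; apply/andP; split.
  rewrite lerNl -mulN1r -urn_stepZ; apply: urn_step_mono => // y dy yx; have := gh y dy yx.
  by rewrite mulN1r ler_norml => /andP[]; rewrite lerNl.
by apply: urn_step_mono => // y dy yx; have := gh y dy yx; rewrite ler_norml => /andP[].
Qed.

Lemma urn_step_id n x : urn_step n id x = x.
Proof.
rewrite /urn_step urn_totalS; have := urn_total_ge2 n; move: (urn_total n) => S S2.
by field; rewrite !gt_eqF//; lra.
Qed.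

Definition urn_var n : R :=
  8 * (urn_total n + 2) / ((urn_total n + 1) * (urn_total n + 4) ^+ 2).

Lemma urn_var_ge0 n : 0 <= urn_var n.
Proof.
have S2 := urn_total_ge2 n; rewrite /urn_var divr_ge0//; first lra.
by rewrite mulr_ge0 ?sqr_ge0//; lra.
Qed.

Lemma urn_step_sqr n m x :
  urn_step n (fun y => (y - m) ^+ 2) x = (x - m) ^+ 2 + urn_var n * (x * (1 - x)).
Proof.
rewrite /urn_step /urn_var urn_totalS; have := urn_total_ge2 n.
move: (urn_total n) => S S2; field; rewrite !gt_eqF//; lra.
Qed.

Lemma urn_step_var n x :
  urn_step n (fun y => y * (1 - y)) x = (1 - urn_var n) * (x * (1 - x)).
Proof.
have -> : (fun y => y * (1 - y)) = (fun y => 4^-1 + (- 1) * (y - 2^-1) ^+ 2) :> (R -> R).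
  by apply/funext => y; field.
by rewrite urn_step_affine urn_step_sqr; field.
Qed.

(** The differences 1/j - 1/(j + 1) sum to 1/n over j >= n: this makes 1/2
    the constant in the limiting variance. The relative error 2/j also sums
    to O(1/n) when weighted by these differences. *)
Lemma urn_var_bounds j : (0 < j)%N ->
  j%:R^-1 - j.+1%:R^-1 - 2 / j%:R * (j%:R^-1 - j.+1%:R^-1) <= 2 * urn_var j <=
  j%:R^-1 - j.+1%:R^-1.
Proof.
move=> j0; have j1 : 1 <= j%:R :> R by rewrite ler1n.
rewrite /urn_var urn_totalE -natr1; move: (j%:R) j1 => t t1.
have -> : 2 * (8 * (4 * t + 2 + 2) / ((4 * t + 2 + 1) * (4 * t + 2 + 4) ^+ 2)) =
  (t^-1 - (t + 1)^-1) - (t^-1 - (t + 1)^-1) *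
    ((28 * t ^+ 2 + 56 * t + 27) / ((4 * t + 3) * (2 * t + 3) ^+ 2)).
  field; rewrite !gt_eqF//; nra.
have w0 : 0 <= t^-1 - (t + 1)^-1.
  by rewrite subr_ge0 lef_pV2 ?posrE//; lra.
move: (t^-1 - (t + 1)^-1) w0 => w w0.
have D0 : 0 < (4 * t + 3) * (2 * t + 3) ^+ 2 by rewrite mulr_gt0 ?exprn_gt0//; lra.
apply/andP; split.
  rewrite lerD2l lerN2 mulrC ler_wpM2r//.
  rewrite ler_pdivrMr// mulrAC ler_pdivlMr//; last lra.
  nra.
rewrite lerBlDr lerDl mulr_ge0// divr_ge0// ?(ltW D0)//; nra.
Qed.
End urn_step.

Section urn_functions.
Context (R : realType).
Implicit Types (n j : nat) (x y m l phi : R).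

(** In terms of the two weights a = S x and b = S (1 - x), the function is
    1/a + 1/b, and the mean of each inverse decreases at least by the same
    factor. The numerators 4 u - 2 and 4 u - 4 in the proof are nonnegative
    because the weights are at least 1. *)
Lemma urn_step_inv n x : urn_domain n x ->
  urn_step n (fun y => (urn_total R n.+1 * (y * (1 - y)))^-1) x <=
  (1 - 4 / (5 * urn_total R n)) * (urn_total R n * (x * (1 - x)))^-1.
Proof.
rewrite /urn_domain /urn_step urn_totalS; have := urn_total_ge2 R n.
move: (urn_total R n) => S S2 dx.
pose a := S * x; pose b := S * (1 - x).
have a1 : 1 <= a by rewrite /a; lra.
have b1 : 1 <= b by rewrite /b; lra.
have SE : S = a + b by rewrite /a /b; ring.
have xE : x = a / (a + b) by rewrite -SE /a; field; rewrite gt_eqF//; lra.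
have -> : (1 - 4 / (5 * S)) * (S * (x * (1 - x)))^-1 =
    (1 - 4 / (5 * S)) * (a^-1 + b^-1).
  by congr (_ * _); rewrite SE xE; field; rewrite !gt_eqF//; lra.
have key (u v : R) : 1 <= u -> 1 <= v ->
    v * (v + 1) / ((u + v) * (u + v + 1)) * u^-1 +
    2 * u * v / ((u + v) * (u + v + 1)) * (u + 2)^-1 +
    u * (u + 1) / ((u + v) * (u + v + 1)) * (u + 4)^-1 <=
    (1 - 4 / (5 * (u + v))) * u^-1.
  move=> u1 v1; rewrite -subr_ge0.
  have -> : (1 - 4 / (5 * (u + v))) * u^-1 -
     (v * (v + 1) / ((u + v) * (u + v + 1)) * u^-1 +
     2 * u * v / ((u + v) * (u + v + 1)) * (u + 2)^-1 +
     u * (u + 1) / ((u + v) * (u + v + 1)) * (u + 4)^-1) =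
    ((v * (4 * u - 2) * (u + 4) + (u + 1) * (4 * u - 4) * (u + 2)) * 4) /
    (5 * u * (u + 2) * (u + 4) * ((u + v) * (u + v + 1))).
    by field; rewrite !gt_eqF//; nra.
  apply: divr_ge0; last by rewrite !mulr_ge0//; lra.
  apply: mulr_ge0 => //; apply: addr_ge0; rewrite !mulr_ge0//; lra.
have K1 := key a b a1 b1; have K2 := key b a b1 a1.
have inv (i : R) : 0 <= i <= 4 ->
    ((S + 4) * ((a + i) / (S + 4) * (1 - (a + i) / (S + 4))))^-1 =
    (a + i)^-1 + (b + (4 - i))^-1.
  by move=> i04; rewrite SE; field; rewrite !gt_eqF//; lra.
have a0 : a / (S + 4) = (a + 0) / (S + 4) by rewrite addr0.
rewrite -/a a0 !inv; try lra.
apply: le_trans (_ : _ <= (1 - 4 / (5 * (a + b))) * a^-1 + (1 - 4 / (5 * (b + a))) * b^-1) _.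
  apply: le_trans (lerD K1 K2); rewrite le_eqVlt; apply/orP; left; apply/eqP.
  by rewrite SE xE; field; rewrite !gt_eqF//; lra.
by rewrite (addrC b a) -SE mulrDr.
Qed.

(** A Taylor expansion of order 2 around x, where the first order term
    vanishes because the step preserves the mean, and a step moves by at
    most 1/(n + 1). *)
Lemma urn_step_cos n l m phi x : urn_domain n x ->
  `|urn_step n (fun y => cos (l * (y - m) + phi)) x -
    (1 - 2^-1 * l ^+ 2 * (urn_var R n * (x * (1 - x)))) * cos (l * (x - m) + phi)|
  <= `|l| ^+ 3 / n.+1%:R ^+ 3.
Proof.
move=> dx; have /andP[x0 x1] := urn_domain01 dx.
set A := l * (x - m) + phi.
pose g (y : R) := cos (l * (y - m) + phi) -
  (cos A - (l * (y - x)) * sin A - 2^-1 * (l * (y - x)) ^+ 2 * cos A).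
have -> : urn_step n (fun y => cos (l * (y - m) + phi)) x -
    (1 - 2^-1 * l ^+ 2 * (urn_var R n * (x * (1 - x)))) * cos A = urn_step n g x.
  have -> : g = (fun y => cos (l * (y - m) + phi) + (- cos A + ((l * sin A) * (y - x)
     + (2^-1 * l ^+ 2 * cos A) * (y - x) ^+ 2))).
    by apply/funext => y; rewrite /g; ring.
  rewrite urn_stepD urn_stepD urn_step_cst urn_stepD urn_stepZ urn_stepZ urn_step_sqr.
  have -> : urn_step n (fun y => y - x) x = 0.
    have -> : (fun y => y - x) = (fun y => - x + 1 * id y) by apply/funext => y /=; ring.
    by rewrite urn_step_affine urn_step_id; ring.
  by ring.
pose c : R := `|l| ^+ 3 / n.+1%:R ^+ 3.
rewrite -[leRHS](urn_step_cst n c x); apply: urn_step_norm => // y dy yx.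
apply: (@le_trans _ _ (`|l * (y - x)| ^+ 3)).
  have -> : g y = cos (A + l * (y - x)) -
     (cos A - (l * (y - x)) * sin A - 2^-1 * (l * (y - x)) ^+ 2 * cos A).
    by rewrite /g /A; congr (cos _ - _); ring.
  exact: cos_taylor2.
rewrite normrM exprMn ler_wpM2l ?exprn_ge0// -exprVn.
by rewrite ler_pXn2r// nnegrE invr_ge0.
Qed.

(** These sum to 1/n over j >= n. *)
Definition harmonic_step j : R := j%:R^-1 - j.+1%:R^-1.

Lemma harmonic_stepE j : (0 < j)%N -> harmonic_step j = (j%:R * j.+1%:R)^-1.
Proof.
move=> j0; have j0R : 0 < j%:R :> R by rewrite ltr0n.
by rewrite /harmonic_step -natr1; field; rewrite !gt_eqF//; lra.
Qed.

(** The factor exp (- c / j) accounts for the variance which the chain still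
    accumulates after time j, computed as if it stayed at the state m that
    it has at time n. The four terms of the error bound come from the Taylor
    remainder, from the relative error of [urn_var_bounds], from the second
    order term of the exponential, and from the distance between x (1 - x)
    and m (1 - m). *)
Lemma urn_step_gauss n j l m phi x c : (0 < n <= j)%N -> urn_domain j x ->
  0 <= m <= 1 -> c = l ^+ 2 * (m * (1 - m)) / 4 ->
  `|urn_step j (fun y => expR (- (c / j.+1%:R)) * cos (l * (y - m) + phi)) x -
    expR (- (c / j%:R)) * cos (l * (x - m) + phi)| <=
  harmonic_step j * (`|l| ^+ 3 / n%:R + 2 * l ^+ 2 / n%:R + l ^+ 4 / n%:R ^+ 2 +
     l ^+ 2 / 4 * `|x - m|).
Proof.
move=> /andP[n0 nj] dx m01 cE.
have j0 : (0 < j)%N by exact: leq_trans nj.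
have /andP[x0 x1] := urn_domain01 dx.
have v01 : 0 <= m * (1 - m) <= 1 by nra.
pose w := harmonic_step j.
have c0 : 0 <= c by rewrite cE divr_ge0// mulr_ge0 ?sqr_ge0//; lra.
have jn : n%:R <= j%:R :> R by rewrite ler_nat.
have n0' : 0 < n%:R :> R by rewrite ltr0n.
have j0' : 0 < j%:R :> R by rewrite ltr0n.
have w0 : 0 <= w.
  by rewrite /w harmonic_stepE// invr_ge0 mulr_ge0.
have wn : w <= (n%:R ^+ 2)^-1.
  rewrite /w harmonic_stepE// lef_pV2 ?posrE ?mulr_gt0 ?exprn_gt0// expr2.
  by apply: ler_pM => //; rewrite ?ler_nat ?(leq_trans nj)// ltW.
pose r := c * w.
have r0 : 0 <= r by rewrite mulr_ge0.
rewrite urn_stepZ.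
have -> : expR (- (c / j%:R)) = expR (- (c / j.+1%:R)) * expR (- r).
  by rewrite -expRD /r /w /harmonic_step; congr expR; ring.
rewrite -mulrA -mulrBr normrM gtr0_norm ?expR_gt0//.
apply: (@le_trans _ _ (1 * `|urn_step j (fun y => cos (l * (y - m) + phi)) x -
    expR (- r) * cos (l * (x - m) + phi)|)).
  apply: ler_wpM2r => //; rewrite -expR0 ler_expR oppr_le0 divr_ge0//.
rewrite mul1r.
have H1 := urn_step_cos l m phi dx.
have H2 := expRN_taylor1 r0.
set C := cos (l * (x - m) + phi) in H1 *.
set E := urn_step _ _ _ in H1 *.
have C1 : `|C| <= 1 by exact: cos_max.
have -> : E - expR (- r) * C =
   (E - (1 - 2^-1 * l ^+ 2 * (urn_var R j * (x * (1 - x)))) * C) +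
   (- (expR (- r) - 1 + r) + (r - 2^-1 * l ^+ 2 * (urn_var R j * (x * (1 - x))))) * C.
  by ring.
have H3 : `|r - 2^-1 * l ^+ 2 * (urn_var R j * (x * (1 - x)))| <=
    w * (2 * l ^+ 2 / n%:R + l ^+ 2 / 4 * `|x - m|).
  have -> : r - 2^-1 * l ^+ 2 * (urn_var R j * (x * (1 - x))) =
     l ^+ 2 / 4 * (w * (m * (1 - m) - x * (1 - x)) + (w - 2 * urn_var R j) * (x * (1 - x))).
    by rewrite /r cE; field.
  rewrite normrM [`|l ^+ 2 / 4|]ger0_norm ?divr_ge0 ?sqr_ge0//.
  have -> : w * (2 * l ^+ 2 / n%:R + l ^+ 2 / 4 * `|x - m|) =
     l ^+ 2 / 4 * (w * `|x - m| + 8 / n%:R * w).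
    by field; rewrite gt_eqF.
  rewrite ler_wpM2l ?divr_ge0 ?sqr_ge0//.
  apply: le_trans (ler_normD _ _) _; apply: lerD.
    rewrite normrM (ger0_norm w0) ler_wpM2l//.
    have -> : m * (1 - m) - x * (1 - x) = (x - m) * (x + m - 1) by ring.
    by rewrite normrM ler_piMr// ler_norml; lra.
  have /andP[V1 V2] : w - 2 / j%:R * w <= 2 * urn_var R j <= w := urn_var_bounds R j0.
  have xx : 0 <= x * (1 - x) <= 1 by nra.
  have D0 : 0 <= w - 2 * urn_var R j by rewrite subr_ge0.
  rewrite ger0_norm; last by apply: mulr_ge0 => //; case/andP: xx.
  apply: (@le_trans _ _ (w - 2 * urn_var R j)); first by rewrite ler_piMr//; case/andP: xx.
  apply: (@le_trans _ _ (2 / j%:R * w)); first lra.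
  rewrite ler_wpM2r//; apply: ler_pM => //.
  - by rewrite ler_nat.
  - by rewrite lef_pV2 ?posrE.
have H4 : `|l| ^+ 3 / j.+1%:R ^+ 3 <= w * (`|l| ^+ 3 / n%:R).
  rewrite [leRHS]mulrCA ler_wpM2l ?exprn_ge0// /w harmonic_stepE// -invfM.
  rewrite lef_pV2 ?posrE ?mulr_gt0 ?exprn_gt0// [leRHS]exprS [_ ^+ 2]expr2 mulrC.
  have jS : j%:R <= j.+1%:R :> R by rewrite ler_nat.
  have jn' : n%:R <= j.+1%:R :> R by exact: le_trans jS.
  apply: ler_pM; [by rewrite ltW| |exact: jn'|].
    by rewrite mulr_ge0.
  by rewrite ler_wpM2r.
have H5 : r ^+ 2 <= w * (l ^+ 4 / n%:R ^+ 2).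
  have -> : r ^+ 2 = w * (w * c ^+ 2) by rewrite /r; ring.
  rewrite ler_wpM2l// mulrC ler_pM ?sqr_ge0//.
  rewrite cE; have -> : l ^+ 4 = (l ^+ 2) ^+ 2 by rewrite -exprM.
  have l20 := sqr_ge0 l.
  by rewrite ler_pXn2r ?nnegrE//; nra.
apply: le_trans (ler_normD _ _) _.
apply: (@le_trans _ _ (`|l| ^+ 3 / j.+1%:R ^+ 3 + (r ^+ 2 +
   w * (2 * l ^+ 2 / n%:R + l ^+ 2 / 4 * `|x - m|)))).
  apply: lerD => //; rewrite normrM -[leRHS]mulr1; apply: ler_pM => //.
  apply: le_trans (ler_normD _ _) _; rewrite normrN; exact: lerD.
apply: le_trans (lerD H4 (lerD H5 (lexx _))) _.
by rewrite /w; lra.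
Qed.

End urn_functions.

(** * Urn processes *)

Section urn_process.
Context d (T : measurableType d) (R : realType) (P : probability T R).
Variables (Y : nat -> T -> R) (past : nat -> T -> T -> Prop).

Definition past_set n (B : set T) := forall w w', past n w w' -> B w -> B w'.
Definition past_fun n (f : T -> R) := forall w w', past n w w' -> f w = f w'.

(** The relation past n means that two sample points have the same history
    up to time n; past_set n are then the events known at time n and
    past_fun n the variables known at time n. In the Markov property the
    test function g may depend on the past, so that conditioning reduces to
    integrals over events of the past. *)
Record urn_process : Prop := UrnProcess {
  urn_pastS : forall n w w', past n.+1 w w' -> past n w w' ;
  urn_past_measurable : forall n B, past_set n B -> measurable B ;
  urn_adapted : forall n, past_fun n (Y n) ;
  urn_in_domain : forall n w, urn_domain n (Y n w) ;
  urn_markov : forall n B (g : T -> R -> R), past_set n B ->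
    (forall y, past_fun n (g ^~ y)) ->
    (exists C, forall w y, urn_domain n.+1 y -> `|g w y| <= C) ->
    \int[P]_(w in B) g w (Y n.+1 w) = \int[P]_(w in B) urn_step n (g w) (Y n w) }.

Hypothesis UP : urn_process.

Lemma past_fun_measurable n f : past_fun n f -> measurable_fun setT f.
Proof.
move=> pf _ A mA; rewrite setTI; apply: (urn_past_measurable UP (n := n)).
by move=> w w' ww'; rewrite /= (pf _ _ ww').
Qed.

Lemma past_le n m w w' : (n <= m)%N -> past m w w' -> past n w w'.
Proof.
elim: m => [|m IH]; first by rewrite leqn0 => /eqP ->.
rewrite leq_eqVlt => /predU1P[->//|]; rewrite ltnS => nm pm.
by apply: IH => //; exact: (urn_pastS UP).
Qed.

Lemma past_set_le n m B : (n <= m)%N -> past_set n B -> past_set m B.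
Proof. by move=> nm pB w w' /(past_le nm); exact: pB. Qed.

Lemma past_fun_le n m f : (n <= m)%N -> past_fun n f -> past_fun m f.
Proof. by move=> nm pf w w' /(past_le nm); exact: pf. Qed.

Lemma urn_process01 n w : 0 < Y n w < 1.
Proof. exact: urn_domain01 (urn_in_domain UP n w). Qed.

Lemma past_comp_bounded n j (f : T -> R -> R) : (n <= j)%N ->
  (forall y, past_fun n (f ^~ y)) ->
  (exists C, forall w y, urn_domain j y -> `|f w y| <= C) ->
  bounded_measurable (fun w => f w (Y j w)).
Proof.
move=> nj pf [C fC]; split; last by exists C => w; apply/fC/(urn_in_domain UP).
apply: (@past_fun_measurable j) => w w' ww'.
by rewrite (urn_adapted UP ww'); apply: (pf _ _ _ (past_le nj ww')).
Qed.

(** The estimates of moments and of characteristic functions below are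
    instances of this, for functions f which contain a correction that
    decreases by the error made at each step. *)
Lemma urn_supermartingale n N B (f : nat -> T -> R -> R) : (n <= N)%N ->
  past_set n B -> (forall j y, past_fun n (f j ^~ y)) ->
  (forall j, exists C, forall w y, urn_domain j y -> `|f j w y| <= C) ->
  (forall j w x, (n <= j)%N -> urn_domain j x -> urn_step j (f j.+1 w) x <= f j w x) ->
  \int[P]_(w in B) f N w (Y N w) <= \int[P]_(w in B) f n w (Y n w).
Proof.
move=> nN pB pf bf fS; elim: N nN => [|N IH]; first by rewrite leqn0 => /eqP ->.
rewrite leq_eqVlt => /predU1P[->//|]; rewrite ltnS => nN; apply: le_trans (IH nN).
rewrite (urn_markov UP (past_set_le nN pB) (fun y => past_fun_le nN (pf _ y)) (bf _)).
have mB : measurable B by exact: (urn_past_measurable UP pB).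
apply: Rintegral_mono => //; last 2 first.
- exact: (past_comp_bounded nN (pf N) (bf N)).
- by move=> w _; apply: fS => //; exact: (urn_in_domain UP).
have [C fC] := bf N.+1.
apply: (@past_comp_bounded n N (fun w => urn_step N (f N.+1 w))) => //.
  by move=> y w w' ww'; rewrite /urn_step !(pf _ _ _ _ ww').
exists C => w y dy; rewrite -[C](urn_step_cst N C y); apply: urn_step_norm => //.
by move=> z dz _; exact: fC.
Qed.

Lemma urn_sqr_le n N B : (0 < n <= N)%N -> past_set n B ->
  \int[P]_(w in B) (Y N w - Y n w) ^+ 2 <=
  (n%:R^-1 - N%:R^-1) * fine (P B).
Proof.
move=> /andP[n0 nN] pB; have mB := urn_past_measurable UP pB.
pose f j w y := (y - Y n w) ^+ 2 + (j%:R^-1 - N%:R^-1).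
have := @urn_supermartingale n N B f nN pB.
have -> : (fun w => f N w (Y N w)) = (fun w => (Y N w - Y n w) ^+ 2).
  by apply/funext => w; rewrite /f subrr addr0.
have -> : (fun w => f n w (Y n w)) = (fun w => n%:R^-1 - N%:R^-1).
  by apply/funext => w; rewrite /f subrr expr0n/= add0r.
rewrite Rintegral_cst//; apply.
- by move=> j y w w' ww'; rewrite /f (urn_adapted UP ww').
- move=> j; exists (1 + `|j%:R^-1 - N%:R^-1|) => w y /urn_domain01 y01.
  apply: le_trans (ler_normD _ _) _; rewrite lerD2r.
  rewrite ger0_norm ?sqr_ge0//; have := urn_process01 n w; nra.
move=> j w x nj dx.
have j0 : (0 < j)%N by exact: leq_trans nj.
rewrite /f urn_stepD urn_step_cst urn_step_sqr.
have /andP[_ V] := urn_var_bounds R j0; have := urn_domain01 dx.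
have V0 := urn_var_ge0 R j.
move=> x01; have : urn_var R j * (x * (1 - x)) <= urn_var R j.
  by rewrite ler_piMr//; nra.
move: V V0; move: (j%:R^-1) (j.+1%:R^-1) (N%:R^-1) (urn_var R j) ((x - _) ^+ 2) => a b c V e.
lra.
Qed.

(** Compared with [urn_sqr_le] this keeps the factor Y_n (1 - Y_n), by means
    of the supermartingale (y - Y_n)^2 + y (1 - y) / j: the drift of the
    square is V y (1 - y), and 1/j - 1/(j + 1) pays for it. *)
Lemma urn_weighted_sqr_le n N B (h : T -> R) : (0 < n <= N)%N -> past_set n B ->
  past_fun n h -> (exists C, forall w, 0 <= h w <= C) ->
  \int[P]_(w in B) (h w * (Y N w - Y n w) ^+ 2) <=
  \int[P]_(w in B) (h w * (Y n w * (1 - Y n w) / n%:R)).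
Proof.
move=> /andP[n0 nN] pB ph [C hC]; have mB := urn_past_measurable UP pB.
pose f j w y := h w * ((y - Y n w) ^+ 2 + j%:R^-1 * (y * (1 - y))).
have pf j y : past_fun n (f j ^~ y).
  by move=> w w' ww'; rewrite /f (urn_adapted UP ww') (ph _ _ ww').
have bf j : exists D, forall w y, urn_domain j y -> `|f j w y| <= D.
  exists (C * (1 + 1)) => w y /urn_domain01 y01; have /andP[h0 hC'] := hC w.
  have jV : 0 <= (j%:R^-1 : R) <= 1.
    rewrite invr_ge0 ler0n/=; case: j => [|j]; first by rewrite invr0 ler01.
    by rewrite invf_le1 ?ler1n.
  have Yn := urn_process01 n w.
  have yy : 0 <= y * (1 - y) <= 1 by nra.
  have s0 := sqr_ge0 (y - Y n w).
  have s1 : (y - Y n w) ^+ 2 <= 1 by nra.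
  have jy : 0 <= j%:R^-1 * (y * (1 - y)) <= 1.
    by move: jV yy; move: (j%:R^-1) (y * (1 - y)) => u v; nra.
  by rewrite ger0_norm ?ler_pM ?mulr_ge0//; lra.
apply: le_trans (_ : _ <= \int[P]_(w in B) f N w (Y N w)) _.
  apply: Rintegral_mono => //.
  - apply: (@past_comp_bounded n N (fun w y => h w * (y - Y n w) ^+ 2)) => //.
      by move=> y w w' ww'; rewrite (urn_adapted UP ww') (ph _ _ ww').
    exists C => w y /urn_domain01 y01; have /andP[h0 hC'] := hC w.
    have Yn := urn_process01 n w.
    rewrite ger0_norm; last by apply: mulr_ge0 => //; exact: sqr_ge0.
    by apply: le_trans hC'; rewrite ler_piMr//; nra.
  - exact: (past_comp_bounded nN (pf N) (bf N)).
  move=> w _; rewrite /f; have /andP[h0 _] := hC w; rewrite ler_wpM2l// lerDl.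
  by rewrite mulr_ge0//; have := urn_process01 N w; nra.
apply: le_trans (@urn_supermartingale n N B f nN pB pf bf _) _; last first.
  apply: Rintegral_mono => //.
  - exact: (past_comp_bounded (leqnn n) (pf n) (bf n)).
  - have := past_comp_bounded (leqnn n) (pf n) (bf n).
    by congr (bounded_measurable _); apply/funext => w;
      rewrite /f subrr expr0n/= add0r; congr (_ * _); rewrite mulrC.
  by move=> w _; rewrite /f subrr expr0n/= add0r [_^-1 * _]mulrC.
move=> j w x nj dx.
have j0 : (0 < j)%N by exact: leq_trans nj.
rewrite /f urn_stepZ urn_stepD urn_stepZ urn_step_sqr urn_step_var.
have /andP[h0 _] := hC w; rewrite ler_wpM2l// -addrA lerD2l.
have /andP[_ V] := urn_var_bounds R j0; have := urn_domain01 dx.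
have V0 := urn_var_ge0 R j.
have J0 : 0 <= j.+1%:R^-1 :> R by rewrite invr_ge0.
move=> x01; have : 0 <= x * (1 - x) by nra.
move: V V0 J0; move: (j%:R^-1) (j.+1%:R^-1) (urn_var R j) (x * (1 - x)) => u v V s.
move=> H1 H2 H3 H4.
have -> : V * s + v * ((1 - V) * s) = (V + v - v * V) * s by ring.
rewrite ler_wpM2r//; nra.
Qed.

End urn_process.

(** * Almost sure convergence *)

Section urn_convergence.
Context d (T : measurableType d) (R : realType) (P : probability T R).
Variables (Y : nat -> T -> R) (past : nat -> T -> T -> Prop).
Hypothesis UP : urn_process P Y past.

Lemma urn_measurable n : measurable_fun setT (Y n).
Proof. exact: (past_fun_measurable UP (urn_adapted UP (n := n))). Qed.

Lemma urn_bounded n : bounded_measurable (Y n).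
Proof.
split; first exact: urn_measurable.
exists 1 => w; have /andP[H1 H2] := urn_process01 UP n w.
by rewrite ger0_norm ltW.
Qed.

Lemma past_setT n : past_set past n setT.
Proof. by []. Qed.

(** The operator [urn_step] does not see a function that vanishes within
    distance 1/(n + 1) of the state, so an increment larger than this has
    probability zero. *)
Lemma urn_increment_ae : {ae P, forall w, forall n, `|Y n.+1 w - Y n w| <= n.+1%:R^-1}.
Proof.
apply: ae_foralln => n.
pose A : set T := [set w | n.+1%:R^-1 < `|Y n.+1 w - Y n w|].
pose g (w : T) (y : R) : R := if n.+1%:R^-1 < `|y - Y n w| then 1 else 0.
have mA : measurable A.
  apply: (urn_past_measurable UP (n := n.+1)) => w w' ww'; rewrite /A/=.
  by rewrite (urn_adapted UP ww') (urn_adapted UP (urn_pastS UP ww')).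
exists A; split => //; last by move=> w /= /negP; rewrite -ltNge.
have gA : (fun w => g w (Y n.+1 w)) = (fun w => \1_A w).
  apply/funext => w; rewrite /g indicE; case: ifPn => H.
    by rewrite mem_set.
  by rewrite memNset//= => H'; rewrite H' in H.
have pg y : past_fun past n (g ^~ y).
  by move=> w w' ww'; rewrite /g (urn_adapted UP ww').
have bg : exists C : R, forall w y, urn_domain n.+1 y -> `|g w y| <= C.
  by exists 1 => w y _; rewrite /g; case: ifP; rewrite ?normr1 ?normr0.
have := urn_markov UP (@past_setT n) pg bg.
rewrite gA.
rewrite -fine_prob_indic//.
have -> : \int[P]_w urn_step n (g w) (Y n w) = 0.
  rewrite -[RHS](Rintegral_prob_cst P 0); apply: eq_Rintegral => w _.
  apply/eqP; rewrite -normr_le0 -(urn_step_cst n 0 (Y n w)).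
  apply: urn_step_norm; first exact: (urn_in_domain UP).
  by move=> y _; rewrite /g leNgt => /negbTE ->; rewrite normr0.
by move=> PA; apply/eqP; rewrite -fine_eq0; [exact/eqP|exact: fin_num_measure].
Qed.

(** By the bound on second moments, the increments between the cubes (k +
    1)^3 and (k + 2)^3 have means O(k^-2). So they are almost surely
    summable, and [cvg_of_cubes] concludes. *)
Lemma urn_cvg_ae : {ae P, forall w, cvgn (fun n => Y n w)}.
Proof.
pose D k w : R := `|Y (k.+2 ^ 3)%N w - Y (k.+1 ^ 3)%N w|.
have bD k : bounded_measurable (D k).
  by apply/bounded_measurable_norm/bounded_measurableB; exact: urn_bounded.
have D0 k w : (0 <= (D k w)%:E)%E by rewrite lee_fin normr_ge0.
have iD k : \int[P]_w D k w <= 2 * (k.+1%:R ^+ 2)^-1.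
  (* the mean of |D| is bounded through |D| <= a / 2 + D^2 / (2 a) *)
  pose a : R := (k.+1%:R ^+ 2)^-1.
  have a0 : 0 < a by rewrite invr_gt0 exprn_gt0.
  have bD2 : bounded_measurable (fun w => (Y (k.+2 ^ 3)%N w - Y (k.+1 ^ 3)%N w) ^+ 2).
    by apply/bounded_measurable_sqr/bounded_measurableB; exact: urn_bounded.
  apply: (@le_trans _ _ (\int[P]_w (2^-1 * a +
     2^-1 * a^-1 * (Y (k.+2 ^ 3)%N w - Y (k.+1 ^ 3)%N w) ^+ 2))).
    apply: Rintegral_mono => //.
      apply: bounded_measurableD; first exact: bounded_measurable_cst.
      by apply: bounded_measurableM => //; exact: bounded_measurable_cst.
    move=> w _; rewrite -[_ ^+ 2](real_normK (num_real _)) -/(D k w).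
    rewrite -subr_ge0; have -> : 2^-1 * a + 2^-1 * a^-1 * D k w ^+ 2 - D k w =
      (a - D k w) ^+ 2 / (2 * a) by field; rewrite gt_eqF.
    by rewrite divr_ge0 ?sqr_ge0// mulr_ge0// ltW.
  rewrite RintegralD//; last 2 first.
  - by apply: bounded_integrable => //; exact: bounded_measurable_cst.
  - apply: bounded_integrable => //.
    by apply: bounded_measurableM => //; exact: bounded_measurable_cst.
  rewrite Rintegral_prob_cst RintegralZl//; last exact: bounded_integrable.
  have k3 : (0 < k.+1 ^ 3 <= k.+2 ^ 3)%N by rewrite expn_gt0/= leq_exp2r.
  have := urn_sqr_le UP k3 (@past_setT _).
  rewrite (fine_probability_setT P) mulr1 => H.
  apply: (@le_trans _ _ (2^-1 * a + 2^-1 * a^-1 *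
     ((k.+1 ^ 3)%:R^-1 - (k.+2 ^ 3)%:R^-1))).
    by rewrite lerD2l ler_wpM2l// mulr_ge0// invr_ge0 ltW.
  rewrite !natrX /a -[k.+2%:R]natr1.
  have : 1 <= k.+1%:R :> R by rewrite ler1n.
  move: (k.+1%:R) => t t1.
  rewrite -subr_ge0.
  have -> : 2 * t ^- 2 - (2^-1 * t ^- 2 + 2^-1 * (t ^- 2)^-1 * (t ^- 3 - (t + 1) ^- 3)) =
    (3 * t * (t + 1) ^+ 3 - t ^+ 2 * (3 * t ^+ 2 + 3 * t + 1)) / (2 * t ^+ 3 * (t + 1) ^+ 3).
    by field; rewrite !gt_eqF//; lra.
  apply: divr_ge0; first nra.
  by rewrite !mulr_ge0 ?exprn_ge0//; lra.
have sumD : (\int[P]_w (\sum_(0 <= k <oo) (D k w)%:E) < +oo)%E.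
  rewrite integral_nneseries//; last first.
    by move=> k; apply/measurable_EFinP; case: (bD k).
  apply: (@le_lt_trans _ _ 4%:E); last exact: ltry.
  apply: lime_le.
    by apply: is_cvg_nneseries => k _ _; apply: integral_ge0 => w _; exact: D0.
  apply: nearW => K.
  apply: (@le_trans _ _ (\sum_(0 <= k < K) (2 * (k.+1%:R ^+ 2)^-1)%:E)%E).
    by apply: lee_sum => k _; rewrite bounded_integralE// lee_fin.
  rewrite sumEFin lee_fin -mulr_sumr.
  have := sum_inv_sqr_le R K; lra.
have Dfin : {ae P, forall w, (\sum_(0 <= k <oo) (D k w)%:E < +oo)%E}.
  have : {ae P, forall w, [set: T] w -> (\sum_(0 <= k <oo) (D k w)%:E)%E \is a fin_num}.
    apply: integrable_ae => //; apply/integrableP; split.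
      apply: ge0_emeasurable_sum => // k _.
      by apply/measurable_EFinP; case: (bD k).
    rewrite (_ : (fun _ => _) = (fun w => \sum_(0 <= k <oo) (D k w)%:E)%E)//.
    by apply/funext => w; rewrite gee0_abs// nneseries_ge0.
  by apply: filterS => w /(_ I); rewrite fin_numElt => /andP[].
apply: filterS2 urn_increment_ae Dfin => w inc fin.
apply: cvg_of_cubes => //.
pose v k := Y (k.+1 ^ 3)%N w.
have cD : cvgn (series (fun k => `|v k.+1 - v k|)).
  apply: nondecreasing_is_cvgn.
    by apply: nondecreasing_series => k _ _.
  exists (fine (\sum_(0 <= k <oo) (D k w)%:E)%E) => _ [K _ <-].
  rewrite -lee_fin fineK; last first.
    by rewrite ge0_fin_numE// nneseries_ge0.
  rewrite /series/= -sumEFin; exact: nneseries_lim_ge.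
have cv := normed_cvg cD.
apply/cvg_ex; exists (limn (series (fun k => v k.+1 - v k)) + v 0%N).
rewrite (_ : (fun k => _) = (fun k => series (fun k => v k.+1 - v k) k + v 0%N)).
  by apply: cvgD; [exact: cv|exact: cvg_cst].
by apply/funext => k; rewrite seriesEnat/= telescope_sumr// subrK.
Qed.

End urn_convergence.

(** Countably many conditions, so that the set of convergence of random
    variables is measurable. *)
Lemma cauchy_cvgn_nat (R : realType) (u : nat -> R) :
  cvgn u <-> forall k, exists n, forall i, `|u (n + i)%N - u n| <= k.+1%:R^-1.
Proof.
split=> [/cvg_ex[l /= ul] k|H].
  have e0 : 0 < k.+1%:R^-1 / 2 :> R by rewrite divr_gt0.
  move/cvgrPdist_le : ul => /(_ _ e0)[n _ nP]; exists n => i.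
  have -> : u (n + i)%N - u n = (l - u n) - (l - u (n + i)%N) by ring.
  rewrite [leRHS]splitr; apply: le_trans (ler_normB _ _) _.
  by apply: lerD; apply: nP => //=; exact: leq_addr.
apply/cauchy_cvgP; apply: cauchy_exP => e e0.
have [n nP] := H (Num.bound e^-1).
exists (u n); exists n => // i /= ni; rewrite /ball/= distrC -(subnKC ni).
apply: le_lt_trans (nP _) _; rewrite invf_plt ?posrE//.
apply: lt_le_trans (archi_boundP _) _; first by rewrite invr_ge0 ltW.
by rewrite ler_nat.
Qed.

(** Off the set of convergence limn has the default value 0, so that it is
    everywhere the pointwise limit of the sequence multiplied by the
    indicator of this set. *)
Lemma measurable_limn d (T : measurableType d) (R : realType) (f : nat -> T -> R) :
  (forall n, measurable_fun setT (f n)) ->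
  measurable_fun setT (fun w => limn (fun n => f n w)).
Proof.
move=> mf; pose C := [set w | cvgn (fun n => f n w)].
have mC : measurable C.
  have -> : C = \bigcap_k \bigcup_n \bigcap_i
      [set w | `|f (n + i)%N w - f n w| <= k.+1%:R^-1].
    apply/seteqP; split => w /=.
      by move=> /cauchy_cvgn_nat cw k _; have [n nP] := cw k; exists n => // i _; exact: nP.
    move=> H; apply/cauchy_cvgn_nat => k; have [n _ nP] := H k I; exists n => i.
    exact: nP.
  apply: bigcapT_measurable => k; apply: bigcupT_measurable => n.
  apply: bigcapT_measurable => i.
  have mD : measurable_fun setT (fun w => `|f (n + i)%N w - f n w|).
    by apply: measurableT_comp => //; exact: measurable_funB.
  rewrite -[X in measurable X]setTI.
  rewrite (_ : [set w | _] = (fun w => `|f (n + i)%N w - f n w|) @^-1` `]-oo, k.+1%:R^-1]).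
    exact: mD.
  by apply/seteqP; split => w /=; rewrite in_itv.
apply: (@measurable_fun_cvg _ _ _ _ (fun n w => f n w * \1_C w)).
  by move=> n; apply: measurable_funM => //; exact: measurable_indic.
move=> w _; rewrite indicE; case: (boolP (w \in C)) => wC.
  under eq_fun do rewrite mulr1.
  by move: wC; rewrite inE.
under eq_fun do rewrite mulr0.
rewrite (dvgP _); first exact: cvg_cst.
by move: wC; rewrite notin_setE.
Qed.

Section urn_limit.
Context d (T : measurableType d) (R : realType) (P : probability T R).
Variables (Y : nat -> T -> R) (past : nat -> T -> T -> Prop).
Hypothesis UP : urn_process P Y past.

Definition urn_limit (w : T) : R := limn (fun n => Y n w).

Lemma urn_limit01 w : 0 <= urn_limit w <= 1.
Proof.
rewrite /urn_limit; have [cw|ncw] := pselect (cvgn (fun n => Y n w)).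
  have H n : 0 < Y n w < 1 := urn_process01 UP n w.
  apply/andP; split.
    by apply: limr_ge => //; apply: nearW => n; case/andP: (H n) => /ltW.
  by apply: limr_le => //; apply: nearW => n; case/andP: (H n) => _ /ltW.
by rewrite (dvgP ncw) lexx ler01.
Qed.

Lemma urn_limit_measurable : measurable_fun setT urn_limit.
Proof. by apply: measurable_limn => n; exact: urn_measurable UP n. Qed.

Lemma urn_limit_bounded : bounded_measurable urn_limit.
Proof.
split; first exact: urn_limit_measurable.
by exists 1 => w; have /andP[H1 H2] := urn_limit01 w; rewrite ger0_norm.
Qed.

Lemma urn_cvg_limit : {ae P, forall w, Y n w @[n --> \oo] --> urn_limit w}.
Proof. exact: urn_cvg_ae UP. Qed.

Lemma urn_limit_weighted_sqr_le n B (h : T -> R) : (0 < n)%N -> past_set past n B ->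
  past_fun past n h -> (exists C, forall w, 0 <= h w <= C) ->
  \int[P]_(w in B) (h w * (urn_limit w - Y n w) ^+ 2) <=
  \int[P]_(w in B) (h w * (Y n w * (1 - Y n w) / n%:R)).
Proof.
move=> n0 pB ph hC; have mB := urn_past_measurable UP pB.
have [C hC'] := hC.
have mh : measurable_fun setT h by exact: (past_fun_measurable UP ph).
have H : \int[P]_(w in B) (h w * (Y N w - Y n w) ^+ 2) @[N --> \oo] -->
    \int[P]_(w in B) (h w * (urn_limit w - Y n w) ^+ 2).
  apply: (@bounded_convergence _ _ _ _ _ _ _ C) => //.
  - move=> N; apply: measurable_funM => //.
    apply: measurable_funX; apply: measurable_funB; exact: urn_measurable UP _.
  - apply: measurable_funM => //.
    apply: measurable_funX; apply: measurable_funB; last exact: urn_measurable UP _.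
    exact: urn_limit_measurable.
  - move=> N w; have := urn_process01 UP N w; have := urn_process01 UP n w => ? ?.
    have /andP[h0 hc] := hC' w; rewrite ger0_norm; last by apply: mulr_ge0 => //; exact: sqr_ge0.
    by apply: le_trans hc; rewrite ler_piMr//; nra.
  apply: filterS urn_cvg_limit => w cw _; apply: cvgM; first exact: cvg_cst.
  under eq_fun do rewrite expr2. rewrite expr2.
  by apply: cvgM; apply: cvgB => //; exact: cvg_cst.
rewrite -(cvg_lim _ H)//; apply: limr_le; first by apply/cvg_ex; eexists; exact: H.
by exists n => // N /= nN; apply: (urn_weighted_sqr_le UP _ pB ph hC); rewrite n0.
Qed.
Lemma urn_limit_sqr_le n B : (0 < n)%N -> past_set past n B ->
  \int[P]_(w in B) (urn_limit w - Y n w) ^+ 2 <= n%:R^-1 * fine (P B).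
Proof.
move=> n0 pB; have mB := urn_past_measurable UP pB.
have H1 : exists C : R, forall w : T, 0 <= (1 : R) <= C.
  by exists 1 => _; rewrite ler01 lexx.
have := @urn_limit_weighted_sqr_le n B (fun=> 1) n0 pB (fun _ _ _ => erefl) H1.
under eq_Rintegral do rewrite mul1r.
move=> /le_trans; apply; rewrite -Rintegral_cst//; apply: Rintegral_mono => //.
- have b1 := bounded_measurable_cst T (1 : R); have bY := urn_bounded UP n.
  apply: bounded_measurableM => //.
  apply: bounded_measurableM; last exact: bounded_measurable_cst.
  apply: bounded_measurableM => //; exact: bounded_measurableB.
- exact: bounded_measurable_cst.
move=> w _; rewrite mul1r ler_piMl ?invr_ge0//; have := urn_process01 UP n w; nra.
Qed.

End urn_limit.

(** * The limit avoids the endpoints *)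

Section urn_endpoints.
Context d (T : measurableType d) (R : realType) (P : probability T R).
Variables (Y : nat -> T -> R) (past : nat -> T -> T -> Prop).
Hypothesis UP : urn_process P Y past.

Lemma urn_domain_inv n y : urn_domain n y ->
  0 < (urn_total R n * (y * (1 - y)))^-1 <= 2.
Proof.
move=> dy; have S2 := urn_total_ge2 R n; move: dy; rewrite /urn_domain.
move: (urn_total R n) S2 => S S2 dy.
have H : 2^-1 <= S * (y * (1 - y)).
  have : S - 1 <= (S * y) * (S - S * y) by nra.
  have -> : (S * y) * (S - S * y) = S * (S * (y * (1 - y))) by ring.
  by move: (S * (y * (1 - y))) => z; nra.
rewrite invr_gt0 (lt_le_trans _ H) ?invr_gt0//=.
by rewrite -[leRHS]invrK lef_pV2 ?posrE ?invr_gt0// (lt_le_trans _ H) ?invr_gt0.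
Qed.

(** Multiplication by the factor 1 - 4 / (5 (4 j + 2)) of [urn_step_inv]
    brings the value at j + 1 below the value at j. So the mean of 1 / (S Y
    (1 - Y)) decreases at least like the inverse of this sequence, which
    diverges with the harmonic series. *)
Definition harmonic_weight N : R := 1 + 5^-1 * series harmonic N.

Lemma harmonic_weight_ge1 N : 1 <= harmonic_weight N.
Proof.
by rewrite lerDl mulr_ge0 ?invr_ge0// /series/= sumr_ge0// => k _; exact: harmonic_ge0.
Qed.

Lemma urn_inv_le N :
  \int[P]_w (urn_total R N * (Y N w * (1 - Y N w)))^-1 <= 2 / harmonic_weight N.
Proof.
have bN := harmonic_weight_ge1 N.
pose f j (w : T) (y : R) := harmonic_weight j * (urn_total R j * (y * (1 - y)))^-1.
have pf j y : past_fun past 0%N (f j ^~ y) by [].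
have bf j : exists C, forall w y, urn_domain j y -> `|f j w y| <= C.
  exists (harmonic_weight j * 2) => w y /urn_domain_inv /andP[H1 H2].
  have bj := harmonic_weight_ge1 j.
  by rewrite /f ger0_norm ?mulr_ge0 ?ler_wpM2l//; lra.
have := @urn_supermartingale _ _ _ P Y past UP 0%N N setT f (leq0n N) (@past_setT _ T past 0) pf bf.
have bI : bounded_measurable (fun w => (urn_total R N * (Y N w * (1 - Y N w)))^-1).
  apply: (@past_comp_bounded _ _ _ P Y past UP 0%N N
    (fun w y => (urn_total R N * (y * (1 - y)))^-1)) => //.
  exists 2 => w y /urn_domain_inv /andP[H1 H2]; rewrite ger0_norm//; exact: ltW.
rewrite /f RintegralZl//; last exact: bounded_integrable.
move=> H; rewrite ler_pdivlMr; last lra.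
rewrite mulrC; apply: le_trans (H _) _; last first.
  rewrite -[leRHS](Rintegral_prob_cst P); apply: Rintegral_mono => //.
  - exact: (past_comp_bounded UP (leq0n 0) (pf 0%N) (bf 0%N)).
  - exact: bounded_measurable_cst.
  move=> w _; have /urn_domain_inv/andP[_] := urn_in_domain UP 0 w.
  by rewrite /harmonic_weight /series/= big_geq// mulr0 addr0 mul1r.
move=> j w x _ dx; rewrite urn_stepZ.
have bj := harmonic_weight_ge1 j.
apply: le_trans (ler_wpM2l _ (urn_step_inv dx)) _.
  by have := harmonic_weight_ge1 j.+1; lra.
rewrite [leLHS]mulrA ler_wpM2r//.
  by have /urn_domain_inv/andP[/ltW] := dx.
have -> : harmonic_weight j.+1 = harmonic_weight j + 5^-1 * j.+1%:R^-1.
  by rewrite /harmonic_weight !seriesEnat/= big_nat_recr//= mulrDr addrA.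
have -> : 4 / (5 * urn_total R j) = 5^-1 * (j.+1%:R^-1 + (2 * j%:R + 1)^-1 * j.+1%:R^-1).
  rewrite urn_totalE -[j.+1%:R]natr1; have : 0 <= j%:R :> R by [].
  by move: (j%:R) => t t0; field; rewrite !gt_eqF//; lra.
have u0 : 0 <= j.+1%:R^-1 :> R by rewrite invr_ge0.
have v0 : 0 <= (2 * j%:R + 1)^-1 :> R by rewrite invr_ge0 addr_ge0// mulr_ge0.
move: (harmonic_weight j) (j.+1%:R^-1) ((2 * j%:R + 1)^-1) bj u0 v0 => b u v b1 u0 v0.
have H1 : 1 * u <= (b + 5^-1 * u) * (u + v * u).
  by apply: ler_pM => //; [lra|rewrite lerDl mulr_ge0].
have -> : (b + 5^-1 * u) * (1 - 5^-1 * (u + v * u)) =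
  b + 5^-1 * (1 * u - (b + 5^-1 * u) * (u + v * u)) by field.
by rewrite gerDl pmulr_rle0 ?invr_gt0// subr_le0.
Qed.

(** Where the limit is 0 or 1, the square (Y_oo - Y_n)^2 is Y_n^2 or (1 -
    Y_n)^2, and dividing it by (Y_n (1 - Y_n))^2 gives at least 1. By
    [urn_limit_weighted_sqr_le] the mean of this quotient is at most that of
    1 / (n Y_n (1 - Y_n)), which tends to 0 by [urn_inv_le]. *)
Lemma urn_limit_interior : P [set w | urn_limit Y w * (1 - urn_limit Y w) = 0] = 0%E.
Proof.
set A := [set w | _].
have mL : measurable_fun setT (fun w => urn_limit Y w * (1 - urn_limit Y w)).
  by apply: measurable_funM; [|apply: measurable_funB => //]; exact: urn_limit_measurable UP.
have mA : measurable A.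
  rewrite -[X in measurable X]setTI.
  rewrite (_ : A = (fun w => urn_limit Y w * (1 - urn_limit Y w)) @^-1` [set 0])//.
  exact: mL.
apply/eqP; rewrite -fine_eq0 ?fin_num_measure//; apply/eqP; apply/eqP.
rewrite eq_le fine_ge0// andbT leNgt; apply/negP => A0.
have key n : (0 < n)%N -> harmonic_weight n <= 12 / fine (P A).
  move=> n0; have bn := harmonic_weight_ge1 n.
  rewrite ler_pdivlMr// mulrC -ler_pdivlMr; last lra.
  pose h w := ((Y n w * (1 - Y n w)) ^+ 2)^-1.
  have S2 := urn_total_ge2 R n.
  have dn w : 0 < (Y n w * (1 - Y n w))^-1 <= 2 * urn_total R n.
    have /urn_domain_inv/andP[H1 H2] := urn_in_domain UP n w.
    have S0 : 0 < urn_total R n by lra.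
    have -> : (Y n w * (1 - Y n w))^-1 =
        urn_total R n * (urn_total R n * (Y n w * (1 - Y n w)))^-1.
      by rewrite [in RHS]invfM mulrA divff ?mul1r ?gt_eqF.
    by rewrite mulr_gt0//= mulrC ler_wpM2r// ltW.
  have ph : past_fun past n h by move=> w w' ww'; rewrite /h (urn_adapted UP ww').
  have hC : exists C, forall w, 0 <= h w <= C.
    exists ((2 * urn_total R n) ^+ 2) => w; have /andP[H1 H2] := dn w.
    rewrite /h -exprVn sqr_ge0/= ler_pXn2r// nnegrE; [exact: ltW|lra].
  have bh : bounded_measurable h.
    split; first exact: past_fun_measurable UP _ _ ph.
    by have [C CP] := hC; exists C => w; have /andP[H1 H2] := CP w; rewrite ger0_norm.
  have bY := urn_bounded UP n; have bL := urn_limit_bounded UP.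
  have b1 : bounded_measurable (fun w => h w * (urn_limit Y w - Y n w) ^+ 2).
    apply: bounded_measurableM => //.
    by apply/bounded_measurable_sqr/bounded_measurableB.
  apply: (@le_trans _ _ (\int[P]_w (h w * (urn_limit Y w - Y n w) ^+ 2))).
    rewrite fine_prob_indic//.
    apply: Rintegral_mono => //; first exact: bounded_measurable_indic.
    move=> w _; rewrite indicE; case: (boolP (w \in A)) => [|_]; last first.
      by apply: mulr_ge0; [have [C CP] := hC; have /andP[] := CP w|exact: sqr_ge0].
    rewrite inE /A/= => /eqP.
    have Y01 := urn_process01 UP n w.
    rewrite mulf_eq0 subr_eq0 => /orP[/eqP ->|/eqP <-].
    - rewrite /h sub0r sqrrN -[_^-1]mul1r exprMn mulrAC ler_pdivlMr ?mul1r.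
        by rewrite ler_piMr ?sqr_ge0//; nra.
      by rewrite mulr_gt0 ?exprn_gt0//; lra.
    - rewrite /h -[_^-1]mul1r exprMn mulrAC ler_pdivlMr ?mul1r.
        by rewrite ler_piMl ?sqr_ge0//; nra.
      by rewrite mulr_gt0 ?exprn_gt0//; lra.
  apply: le_trans (urn_limit_weighted_sqr_le UP n0 (@past_setT _ T past n) ph hC) _.
  have bI : bounded_measurable (fun w => (urn_total R n * (Y n w * (1 - Y n w)))^-1).
    apply: (@past_comp_bounded _ _ _ P Y past UP 0%N n
      (fun w y => (urn_total R n * (y * (1 - y)))^-1)) => //.
    exists 2 => w y /urn_domain_inv /andP[H1 H2]; rewrite ger0_norm//; exact: ltW.
  have n0R : 0 < n%:R :> R by rewrite ltr0n.
  rewrite (_ : (fun w => _) = (fun w => urn_total R n / n%:R *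
      (urn_total R n * (Y n w * (1 - Y n w)))^-1)); last first.
    apply/funext => w; rewrite /h; have := urn_process01 UP n w; move: (Y n w) => y y01.
    by field; rewrite !gt_eqF//; lra.
  rewrite RintegralZl//; last exact: bounded_integrable.
  have -> : 12 / harmonic_weight n = 6 * (2 / harmonic_weight n) by ring.
  apply: ler_pM; [by rewrite divr_ge0//; lra| | |exact: urn_inv_le].
    by apply: Rintegral_ge0 => w _; have /urn_domain_inv/andP[/ltW] := urn_in_domain UP n w.
  by rewrite ler_pdivrMr// urn_totalE; have : 1 <= n%:R :> R by [rewrite ler1n]; lra.
have := @dvg_harmonic R; apply; apply: nondecreasing_is_cvgn.
  by apply: nondecreasing_series => k _ _; exact: harmonic_ge0.
exists (5 * (12 / fine (P A))) => _ [n _ <-].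
case: n => [|n].
  by rewrite /series/= big_geq// mulr_ge0// divr_ge0// ltW.
have := key n.+1 isT; rewrite /harmonic_weight; lra.
Qed.

End urn_endpoints.

(** * Conditional characteristic functions of the deviation *)

Section urn_cos.
Context d (T : measurableType d) (R : realType) (P : probability T R).
Variables (Y : nat -> T -> R) (past : nat -> T -> T -> Prop).
Hypothesis UP : urn_process P Y past.

Definition urn_variance n w : R := Y n w * (1 - Y n w).

Lemma urn_variance01 n w : 0 <= urn_variance n w <= 1.
Proof. by have := urn_process01 UP n w; rewrite /urn_variance; nra. Qed.

Lemma urn_variance_past n : past_fun past n (urn_variance n).
Proof. by move=> w w' ww'; rewrite /urn_variance (urn_adapted UP ww'). Qed.

(** The sum over j >= n of the errors of [urn_step_gauss], where the
    distance |Y_j - Y_n| has been replaced by 2 / sqrt n, a bound on its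
    mean. *)
Definition urn_error (l : R) n : R := n%:R^-1 *
  (`|l| ^+ 3 / n%:R + 2 * l ^+ 2 / n%:R + l ^+ 4 / n%:R ^+ 2 +
   l ^+ 2 / 4 * (2 / Num.sqrt n%:R)).

Lemma sqr_le_linear (x k : R) : 0 < k -> `|x| <= k * x ^+ 2 + k^-1.
Proof.
move=> k0; rewrite -[x ^+ 2](real_normK (num_real x)) -subr_ge0.
have -> : k * `|x| ^+ 2 + k^-1 - `|x| =
   (k * `|x| - 2^-1) ^+ 2 / k + 3 / 4 / k by field; rewrite gt_eqF.
by rewrite addr_ge0// !divr_ge0// ?sqr_ge0 ?ltW// divr_ge0.
Qed.

Lemma measurable_cos_fun (f : T -> R) : measurable_fun setT f ->
  bounded_measurable (fun w => cos (f w)).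
Proof.
move=> mf; split; last by exists 1 => w; exact: cos_max.
apply: (@measurableT_comp _ _ _ _ _ _ (@cos R)) => //.
by apply: continuous_measurable_fun; exact: continuous_cos.
Qed.

Lemma measurable_expRN_fun (f : T -> R) : measurable_fun setT f ->
  (forall w, 0 <= f w) -> bounded_measurable (fun w => expR (- f w)).
Proof.
move=> mf f0; split.
  by apply: (@measurableT_comp _ _ _ _ _ _ (@expR R)) => //; exact: measurableT_comp.
exists 1 => w; rewrite ger0_norm ?expR_ge0// -expR0 ler_expR oppr_le0//.
Qed.

(** Write u_j for the function of [urn_step_gauss]. For both signs s = 1 and
    s = -1, s u_j + e_j is a supermartingale, where e_j bounds the errors
    that remain to be made after time j. *)
Lemma urn_cos_finite n N B (l : R) (phi : T -> R) : (0 < n <= N)%N ->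
  past_set past n B -> past_fun past n phi ->
  `|\int[P]_(w in B) (expR (- (l ^+ 2 * urn_variance n w / 4 / N%:R)) *
       cos (l * (Y N w - Y n w) + phi w)) -
    \int[P]_(w in B) (expR (- (l ^+ 2 * urn_variance n w / 4 / n%:R)) *
       cos (phi w))| <= urn_error l n * fine (P B).
Proof.
move=> /andP[n0 nN] pB pphi; have mB := urn_past_measurable UP pB.
have n0R : 0 < n%:R :> R by rewrite ltr0n.
set k : R := Num.sqrt n%:R.
have k0 : 0 < k by rewrite sqrtr_gt0.
have kk : k * k = n%:R by rewrite -expr2 sqr_sqrtr// ltW.
pose c w := l ^+ 2 * urn_variance n w / 4.
have c0 w : 0 <= c w.
  by have /andP[v0 _] := urn_variance01 n w; rewrite /c divr_ge0// mulr_ge0// sqr_ge0.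
pose A : R := `|l| ^+ 3 / n%:R + 2 * l ^+ 2 / n%:R + l ^+ 4 / n%:R ^+ 2.
have A0 : 0 <= A.
  have l4 : l ^+ 4 = (l ^+ 2) ^+ 2 by rewrite -exprM.
  by rewrite /A l4; apply: addr_ge0; first apply: addr_ge0; apply: divr_ge0 => //;
    first [exact: exprn_ge0|exact: sqr_ge0|rewrite mulr_ge0 ?sqr_ge0].
pose u j (w : T) (y : R) := expR (- (c w / j%:R)) * cos (l * (y - Y n w) + phi w).
have u1 j w y : `|u j w y| <= 1.
  rewrite normrM ger0_norm ?expR_ge0// mulr_ile1 ?expR_ge0 ?cos_max//.
  by rewrite -[leRHS]expR0 ler_expR oppr_le0 divr_ge0.
(* the remaining harmonic steps sum to 1/j, and |y - Y n w| is at most k (y -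
   Y n w)^2 + 1/k with k = sqrt n; the term y (1 - y) / j pays for the later
   growth of this square *)
pose e j (w : T) (y : R) := j%:R^-1 * (A + l ^+ 2 / 4 *
   (k * ((y - Y n w) ^+ 2 + j%:R^-1 * (y * (1 - y))) + k^-1)).
have pc w w' : past n w w' -> c w = c w'.
  by move=> ww'; rewrite /c (urn_variance_past ww').
have pu j y : past_fun past n (u j ^~ y).
  by move=> w w' ww'; rewrite /u (pc _ _ ww') (urn_adapted UP ww') (pphi _ _ ww').
have pe j y : past_fun past n (e j ^~ y).
  by move=> w w' ww'; rewrite /e (urn_adapted UP ww').
have e0 j w y : 0 <= y <= 1 -> 0 <= e j w y.
  move=> y01; rewrite mulr_ge0 ?invr_ge0// addr_ge0// mulr_ge0 ?divr_ge0 ?sqr_ge0//.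
  rewrite addr_ge0 ?invr_ge0 ?(ltW k0)// mulr_ge0 ?(ltW k0)// addr_ge0 ?sqr_ge0//.
  by rewrite mulr_ge0 ?invr_ge0//; nra.
have main (s : R) : `|s| = 1 ->
    s * \int[P]_(w in B) u N w (Y N w) - s * \int[P]_(w in B) u n w (Y n w) <=
    urn_error l n * fine (P B).
  move=> s1.
  pose f j w y := s * u j w y + e j w y.
  have pf j y : past_fun past n (f j ^~ y).
    by move=> w w' ww'; rewrite /f (pu _ _ _ _ ww') (pe _ _ _ _ ww').
  have bu j : exists C, forall w y, urn_domain j y -> `|s * u j w y| <= C.
    by exists 1 => w y _; rewrite normrM s1 mul1r.
  have be j : exists C, forall w y, urn_domain j y -> `|e j w y| <= C.
    exists (j%:R^-1 * (A + l ^+ 2 / 4 * (k * (1 + j%:R^-1 * 1) + k^-1))).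
    move=> w y /urn_domain01 y01; rewrite ger0_norm; last by apply: e0; lra.
    rewrite ler_wpM2l ?invr_ge0// lerD2l ler_wpM2l ?divr_ge0 ?sqr_ge0// lerD2r.
    rewrite ler_wpM2l ?(ltW k0)//; apply: lerD.
      by have := urn_process01 UP n w; nra.
    by rewrite ler_wpM2l ?invr_ge0//; nra.
  have bf j : exists C, forall w y, urn_domain j y -> `|f j w y| <= C.
    have [C1 H1] := bu j; have [C2 H2] := be j; exists (C1 + C2) => w y dy.
    by apply: le_trans (ler_normD _ _) _; apply: lerD; [exact: H1|exact: H2].
  have H : forall j w x, (n <= j)%N -> urn_domain j x -> urn_step j (f j.+1 w) x <= f j w x.
    move=> j w x nj dx; have j0 : (0 < j)%N by exact: leq_trans nj.
    have x01 := urn_domain01 dx.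
    have m01 : 0 <= Y n w <= 1 by have := urn_process01 UP n w; lra.
    have nnj : (0 < n <= j)%N by rewrite n0.
    have G := @urn_step_gauss R n j l (Y n w) (phi w) x (c w) nnj dx m01 erefl.
    rewrite -/A in G.
    pose w_ : R := harmonic_step R j.
    have w0 : 0 <= w_ by rewrite /w_ harmonic_stepE// invr_ge0 mulr_ge0.
    pose br := (x - Y n w) ^+ 2 + j%:R^-1 * (x * (1 - x)).
    have br_step : urn_step j (fun y => (y - Y n w) ^+ 2 + j.+1%:R^-1 * (y * (1 - y))) x <= br.
      rewrite urn_stepD urn_stepZ urn_step_sqr urn_step_var -addrA lerD2l.
      have /andP[_ V] := urn_var_bounds R j0.
      have V0 := urn_var_ge0 R j.
      have J0 : 0 <= j.+1%:R^-1 :> R by rewrite invr_ge0.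
      have : 0 <= x * (1 - x) by nra.
      move: V V0 J0; move: (j%:R^-1) (j.+1%:R^-1) (urn_var R j) (x * (1 - x)) => a b V q.
      move=> H1 H2 H3 H4.
      have -> : V * q + b * ((1 - V) * q) = (V + b - b * V) * q by ring.
      by rewrite ler_wpM2r//; nra.
    have step_e : urn_step j (e j.+1 w) x <=
        j.+1%:R^-1 * (A + l ^+ 2 / 4 * (k * br + k^-1)).
      have -> : e j.+1 w = (fun y => j.+1%:R^-1 * (A + l ^+ 2 / 4 * k^-1) +
         (j.+1%:R^-1 * (l ^+ 2 / 4 * k)) * ((y - Y n w) ^+ 2 + j.+1%:R^-1 * (y * (1 - y)))).
        by apply/funext => y; rewrite /e; ring.
      rewrite urn_step_affine.
      have -> : j.+1%:R^-1 * (A + l ^+ 2 / 4 * (k * br + k^-1)) =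
        j.+1%:R^-1 * (A + l ^+ 2 / 4 * k^-1) + (j.+1%:R^-1 * (l ^+ 2 / 4 * k)) * br by ring.
      rewrite lerD2l ler_wpM2l//; apply: mulr_ge0; first by rewrite invr_ge0.
      by apply: mulr_ge0; [rewrite divr_ge0// sqr_ge0|exact: ltW].
    have step_u : s * urn_step j (u j.+1 w) x - s * u j w x <=
        w_ * (A + l ^+ 2 / 4 * (k * br + k^-1)).
      rewrite -mulrBr; apply: le_trans (ler_norm _) _; rewrite normrM s1 mul1r.
      apply: le_trans G _; rewrite ler_wpM2l// lerD2l ler_wpM2l ?divr_ge0 ?sqr_ge0//.
      apply: le_trans (sqr_le_linear _ k0) _; rewrite lerD2r ler_wpM2l ?(ltW k0)//.
      by rewrite lerDl mulr_ge0 ?invr_ge0//; nra.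
    rewrite /f urn_stepD urn_stepZ.
    have -> : e j w x = j.+1%:R^-1 * (A + l ^+ 2 / 4 * (k * br + k^-1)) +
        w_ * (A + l ^+ 2 / 4 * (k * br + k^-1)).
      by rewrite /w_ /harmonic_step /e -/br; ring.
    rewrite [leLHS]addrC [leRHS]addrCA; apply: lerD step_e _.
    by rewrite -lerBlDl.
  have SM := urn_supermartingale UP nN pB pf bf H.
  have bmu j : (n <= j)%N -> bounded_measurable (fun w => s * u j w (Y j w)).
    move=> nj; apply: (@past_comp_bounded _ _ _ P Y past UP n j (fun w y => s * u j w y)) => //.
    by move=> y w w' ww'; rewrite (pu _ _ _ _ ww').
  have bmu' j : (n <= j)%N -> bounded_measurable (fun w => u j w (Y j w)).
    move=> nj; apply: (@past_comp_bounded _ _ _ P Y past UP n j (fun w y => u j w y)) => //.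
    by exists 1 => w y _.
  have bmf := past_comp_bounded UP nN (pf N) (bf N).
  have bmfn := past_comp_bounded UP (leqnn n) (pf n) (bf n).
  rewrite lerBlDl -!RintegralZl//; last 2 first.
  - by apply: bounded_integrable => //; exact: bmu'.
  - by apply: bounded_integrable => //; exact: bmu'.
  apply: le_trans (_ : _ <= \int[P]_(w in B) f N w (Y N w)) _.
    apply: Rintegral_mono => //; first exact: bmu.
    by move=> w _; rewrite lerDl e0//; have := urn_process01 UP N w; lra.
  apply: le_trans SM _; rewrite -Rintegral_cst// -RintegralD//; last 2 first.
  - by apply: bounded_integrable => //; exact: bmu.
  - by apply: bounded_integrable => //; exact: bounded_measurable_cst.
  apply: Rintegral_mono => //.
    by apply: bounded_measurableD; [exact: bmu|exact: bounded_measurable_cst].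
  move=> w _; rewrite lerD2l /e /urn_error -/A subrr expr0n/= add0r.
  rewrite ler_wpM2l ?invr_ge0// lerD2l ler_wpM2l ?divr_ge0 ?sqr_ge0//.
  have /andP[_ v1] := urn_variance01 n w.
  have -> : k * (n%:R^-1 * (Y n w * (1 - Y n w))) = k^-1 * urn_variance n w.
    by rewrite /urn_variance -kk; field; rewrite gt_eqF.
  have : k^-1 * urn_variance n w <= k^-1 by rewrite ler_piMr// invr_ge0 ltW.
  by rewrite -/k; lra.
have E0 : (fun w => u n w (Y n w)) = (fun w => expR (- (c w / n%:R)) * cos (phi w)).
  by apply/funext => w; rewrite /u subrr mulr0 add0r.
have M1 := main 1 (normr1 _).
have M2 : _ := main (-1) _.
rewrite normrN normr1 in M2; have {}M2 := M2 erefl.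
rewrite E0 /u in M1 M2.
by rewrite ler_norml; apply/andP; split; lra.
Qed.

End urn_cos.

Section urn_cos_limit.
Context d (T : measurableType d) (R : realType) (P : probability T R).
Variables (Y : nat -> T -> R) (past : nat -> T -> T -> Prop).
Hypothesis UP : urn_process P Y past.
Let Yinf := urn_limit Y.

Lemma urn_error_le (l t : R) n : (0 < n)%N -> `|l| <= t * Num.sqrt n%:R ->
  urn_error l n <= (t ^+ 3 + 3 * t ^+ 2 + t ^+ 4) / Num.sqrt n%:R.
Proof.
move=> n0; set s := Num.sqrt n%:R.
have s1 : 1 <= s by rewrite /s -[leLHS]sqrtr1 ler_sqrt// ler1n.
have nE : n%:R = s ^+ 2 by rewrite sqr_sqrtr.
move=> ls; rewrite /urn_error -/s nE.
have -> : l ^+ 4 = `|l| ^+ 4 by rewrite -[4%N]/(2 * 2)%N !exprM real_normK// num_real.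
rewrite -[l ^+ 2]real_normK ?num_real//.
move: (`|l|) (normr_ge0 l) ls => a a0 ats.
have t0 : 0 <= t by rewrite -(@pmulr_lge0 _ s); [exact: le_trans ats|lra].
pose b := a / s.
have b0 : 0 <= b by rewrite divr_ge0//; lra.
have bt : b <= t by rewrite ler_pdivrMr//; lra.
have -> : a = b * s by rewrite /b divfK// gt_eqF//; lra.
have -> : (s ^+ 2)^-1 * ((b * s) ^+ 3 / s ^+ 2 + 2 * (b * s) ^+ 2 / s ^+ 2 +
   (b * s) ^+ 4 / (s ^+ 2) ^+ 2 + (b * s) ^+ 2 / 4 * (2 / s)) =
   (b ^+ 3 + (2 * b ^+ 2) * s^-1 + b ^+ 4 * s^-1 + b ^+ 2 / 2) / s.
  by field; rewrite gt_eqF//; lra.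
have sV : 0 <= s^-1 <= 1 by rewrite invr_ge0 invf_le1; lra.
rewrite ler_wpM2r//; first by case/andP: sV.
have b2 : b ^+ 2 <= t ^+ 2 by rewrite ler_pXn2r.
have b3 : b ^+ 3 <= t ^+ 3 by rewrite ler_pXn2r.
have b4 : b ^+ 4 <= t ^+ 4 by rewrite ler_pXn2r.
have c2 : 0 <= b ^+ 2 by rewrite sqr_ge0.
have c4 : 0 <= b ^+ 4 by rewrite exprn_ge0.
have d2 : (2 * b ^+ 2) * s^-1 <= 2 * b ^+ 2 by rewrite ler_piMr; lra.
have d4 : b ^+ 4 * s^-1 <= b ^+ 4 by rewrite ler_piMr; lra.
lra.
Qed.

Lemma urn_variance_bounded n : bounded_measurable (urn_variance Y n).
Proof.
split; first exact: (past_fun_measurable UP (urn_variance_past UP (n := n))).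
by exists 1 => w; have /andP[H1 H2] := urn_variance01 UP n w; rewrite ger0_norm.
Qed.

(** As B is any event and phi any phase known at time n, this is an estimate
    of the conditional characteristic function of the deviation. *)
Lemma urn_cos_limit n B (l : R) (phi : T -> R) : (0 < n)%N ->
  past_set past n B -> past_fun past n phi ->
  `|\int[P]_(w in B) cos (l * (Yinf w - Y n w) + phi w) -
    \int[P]_(w in B) (expR (- (l ^+ 2 * urn_variance Y n w / 4 / n%:R)) *
       cos (phi w))| <= urn_error l n * fine (P B).
Proof.
move=> n0 pB pphi; have mB := urn_past_measurable UP pB.
have mphi : measurable_fun setT phi by exact: (past_fun_measurable UP pphi).
have [mv _] := urn_variance_bounded n.
have mY k : measurable_fun setT (Y k) by exact: urn_measurable UP k.
have mYinf : measurable_fun setT Yinf by exact: urn_limit_measurable UP.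
pose c w := l ^+ 2 * urn_variance Y n w / 4.
have c0 w : 0 <= c w.
  by have /andP[v0 _] := urn_variance01 UP n w; rewrite /c divr_ge0// mulr_ge0// sqr_ge0.
have mc : measurable_fun setT c by apply: measurable_funM => //; apply: measurable_funM.
have H : \int[P]_(w in B) (expR (- (c w / N%:R)) *
       cos (l * (Y N w - Y n w) + phi w)) @[N --> \oo] -->
     \int[P]_(w in B) cos (l * (Yinf w - Y n w) + phi w).
  apply: (@bounded_convergence _ _ _ _ _ _ _ 1) => //.
  - move=> N; apply: measurable_funM.
      have [] // := @measurable_expRN_fun _ _ _ (fun w => c w / N%:R) _ _.
        exact: measurable_funM.
      by move=> w; rewrite divr_ge0.
    have [] // := @measurable_cos_fun _ _ _ (fun w => l * (Y N w - Y n w) + phi w) _.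
    by apply: measurable_funD => //; apply: measurable_funM => //; exact: measurable_funB.
  - have [] // := @measurable_cos_fun _ _ _ (fun w => l * (Yinf w - Y n w) + phi w) _.
    by apply: measurable_funD => //; apply: measurable_funM => //; exact: measurable_funB.
  - move=> N w; rewrite normrM ger0_norm ?expR_ge0// mulr_ile1 ?expR_ge0 ?cos_max//.
    by rewrite -[leRHS]expR0 ler_expR oppr_le0 divr_ge0.
  apply: filterS (urn_cvg_limit UP) => w cw _.
  rewrite -[X in _ --> X]mul1r; apply: cvgM.
    rewrite -[X in _ --> X]expR0; apply: continuous_cvg; first exact: continuous_expR.
    rewrite -[X in _ --> X]oppr0; apply: cvgN; rewrite -[X in _ --> X](mulr0 (c w)); apply: cvgM; first exact: cvg_cst.
    by rewrite -cvg_shiftS; exact: cvg_harmonic.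
  apply: continuous_cvg; first exact: continuous_cos.
  apply: cvgD; last exact: cvg_cst.
  apply: cvgM; first exact: cvg_cst.
  by apply: cvgB => //; exact: cvg_cst.
have H2 : `|\int[P]_(w in B) (expR (- (c w / N%:R)) *
       cos (l * (Y N w - Y n w) + phi w)) -
    \int[P]_(w in B) (expR (- (c w / n%:R)) * cos (phi w))| @[N --> \oo] -->
    `|\int[P]_(w in B) cos (l * (Yinf w - Y n w) + phi w) -
    \int[P]_(w in B) (expR (- (c w / n%:R)) * cos (phi w))|.
  by apply: cvg_norm; apply: cvgB => //; exact: cvg_cst.
rewrite -(cvg_lim _ H2)//; apply: limr_le; first by apply/cvg_ex; eexists; exact: H2.
by exists n => // N /= nN; apply: (urn_cos_finite UP); rewrite ?n0.
Qed.

Lemma urn_gauss_limit (c : R) (B : set T) : 0 <= c -> measurable B ->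
  \int[P]_(w in B) expR (- (c * urn_variance Y n w)) @[n --> \oo] -->
  \int[P]_(w in B) expR (- (c * (Yinf w * (1 - Yinf w)))).
Proof.
move=> c0 mB.
have mYinf : measurable_fun setT Yinf by exact: urn_limit_measurable UP.
apply: (@bounded_convergence _ _ _ _ _ _ _ 1) => //.
- move=> n; have [] // := @measurable_expRN_fun _ _ _ (fun w => c * urn_variance Y n w) _ _.
    by apply: measurable_funM => //; have [] := urn_variance_bounded n.
  by move=> w; rewrite mulr_ge0//; have /andP[] := urn_variance01 UP n w.
- have [] // := @measurable_expRN_fun _ _ _ (fun w => c * (Yinf w * (1 - Yinf w))) _ _.
    by apply: measurable_funM => //; apply: measurable_funM => //; exact: measurable_funB.
  by move=> w; rewrite mulr_ge0//; have := urn_limit01 UP w; rewrite -/Yinf; nra.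
- move=> n w; rewrite ger0_norm ?expR_ge0// -[leRHS]expR0 ler_expR oppr_le0 mulr_ge0//.
  by have /andP[] := urn_variance01 UP n w.
apply: filterS (urn_cvg_limit UP) => w cw _.
apply: continuous_cvg; first exact: continuous_expR.
apply: cvgN; apply: cvgM; first exact: cvg_cst.
by apply: cvgM => //; apply: cvgB => //; exact: cvg_cst.
Qed.

Lemma urn_interior_ae : {ae P, forall w, 0 < Yinf w * (1 - Yinf w)}.
Proof.
exists [set w | Yinf w * (1 - Yinf w) = 0]; split.
- have mYinf : measurable_fun setT Yinf by exact: urn_limit_measurable UP.
  rewrite -[X in measurable X]setTI.
  rewrite (_ : [set w | _] = (fun w => Yinf w * (1 - Yinf w)) @^-1` [set 0])//.
  have mf : measurable_fun setT (fun w => Yinf w * (1 - Yinf w)).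
    by apply: measurable_funM => //; exact: measurable_funB.
  exact: mf.
- exact: urn_limit_interior UP.
move=> w /= H; have := urn_limit01 UP w; rewrite -/Yinf => H2.
by apply/eqP; rewrite eq_le [X in _ && X](_ : _ = true) ?andbT ?leNgt; [exact/negP|nra].
Qed.

(** By [urn_limit_interior] the exponent almost surely tends to - oo. *)
Lemma urn_gauss_vanish : \int[P]_w expR (- (n%:R * (Yinf w * (1 - Yinf w)))) @[n --> \oo] --> 0.
Proof.
rewrite -(Rintegral_prob_cst P 0).
have mYinf : measurable_fun setT Yinf by exact: urn_limit_measurable UP.
apply: (@bounded_convergence _ _ _ _ _ _ _ 1) => //.
- move=> n; have [] // := @measurable_expRN_fun _ _ _ (fun w => n%:R * (Yinf w * (1 - Yinf w))) _ _.
    by apply: measurable_funM => //; apply: measurable_funM => //; exact: measurable_funB.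
  by move=> w; rewrite mulr_ge0//; have := urn_limit01 UP w; rewrite -/Yinf; nra.
- move=> n w; rewrite ger0_norm ?expR_ge0// -[leRHS]expR0 ler_expR oppr_le0 mulr_ge0//.
  by have := urn_limit01 UP w; rewrite -/Yinf; nra.
apply: filterS urn_interior_ae => w; move: (_ * _) => v v0 _.
apply/norm_cvg0P.
apply: (@squeeze_cvgr _ _ _ _ (fun=> 0) (fun n => v^-1 * n%:R^-1)).
- exists 1%N => // n /= n0; rewrite normr_ge0/= ger0_norm ?expR_ge0// expRN -invfM.
  have nv0 : 0 < n%:R * v by rewrite mulr_gt0// ltr0n.
  rewrite lef_pV2 ?posrE ?expR_gt0 ?(mulrC v)//.
  by have := expR_ge1Dx (n%:R * v); lra.
- exact: cvg_cst.
rewrite -[X in _ --> X](mulr0 v^-1); apply: cvgM; first exact: cvg_cst.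
by rewrite -cvg_shiftS; exact: cvg_harmonic.
Qed.

End urn_cos_limit.

Section urn_limit_law.
Context d (T : measurableType d) (R : realType) (P : probability T R).
Variables (Y : nat -> T -> R) (past : nat -> T -> T -> Prop).
Hypothesis UP : urn_process P Y past.
Local Notation Yinf := (urn_limit Y).

Lemma urn_deviation_cos n B (l b : R) : (0 < n)%N -> past_set past n B ->
  `|\int[P]_(w in B) cos (l * (Y n w - Yinf w) + b) -
    cos b * \int[P]_(w in B) expR (- (l ^+ 2 / 4 / n%:R * urn_variance Y n w))| <=
  urn_error (- l) n * fine (P B).
Proof.
move=> n0 pB; have mB := urn_past_measurable UP pB.
have := @urn_cos_limit _ _ _ _ _ _ UP n B (- l) (fun=> b) n0 pB (fun _ _ _ => erefl).
rewrite sqrrN => H.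
have -> : \int[P]_(w in B) cos (l * (Y n w - Yinf w) + b) =
    \int[P]_(w in B) cos (- l * (Yinf w - Y n w) + b).
  by apply: eq_Rintegral => w _; congr cos; ring.
have [mv _] := urn_variance_bounded UP n.
have b2 : bounded_measurable (fun w => expR (- (l ^+ 2 / 4 / n%:R * urn_variance Y n w))).
  apply: (@measurable_expRN_fun _ _ _ (fun w => l ^+ 2 / 4 / n%:R * urn_variance Y n w)).
    exact: measurable_funM.
  by move=> w; have /andP[v0 _] := urn_variance01 UP n w; rewrite mulr_ge0// !divr_ge0// sqr_ge0.
rewrite -RintegralZl//; last exact: bounded_integrable.
suff -> : \int[P]_(w in B) (cos b * expR (- (l ^+ 2 / 4 / n%:R * urn_variance Y n w))) =
  \int[P]_(w in B) (expR (- (l ^+ 2 * urn_variance Y n w / 4 / n%:R)) * cos b) by [].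
by apply: eq_Rintegral => w _; rewrite mulrC; congr (expR (- _) * _); ring.
Qed.

(** The conditional law of the deviation given B is close to the centered
    normal law of variance y (1 - y) / 2. The time q at which B is known may
    precede n: between q and n the chain moves by O(1 / sqrt q) in mean on
    B, and so does the variance. *)
Lemma urn_conditional_cos q n B (th b y e : R) : (0 < q <= n)%N ->
  past_set past q B -> 0 <= y <= 1 ->
  {ae P, forall w, B w -> `|Y q w - y| <= e} ->
  `|\int[P]_(w in B) cos (th * (Num.sqrt n%:R * (Y n w - Yinf w)) + b) -
    cos b * expR (- (th ^+ 2 / 4 * (y * (1 - y)))) * fine (P B)| <=
  ((`|th| ^+ 3 + 3 * `|th| ^+ 2 + `|th| ^+ 4) / Num.sqrt n%:R +
   th ^+ 2 / 4 * (2 / Num.sqrt q%:R + e)) * fine (P B).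
Proof.
move=> /andP[q0 qn] pB y01 Bye; have n0 : (0 < n)%N by exact: leq_trans qn.
have mB := urn_past_measurable UP pB.
have PB0 : 0 <= fine (P B) by rewrite fine_ge0.
have pBn := past_set_le UP qn pB.
have := urn_deviation_cos (th * Num.sqrt n%:R) b n0 pBn.
have -> : \int[P]_(w in B) cos (th * Num.sqrt n%:R * (Y n w - Yinf w) + b) =
    \int[P]_(w in B) cos (th * (Num.sqrt n%:R * (Y n w - Yinf w)) + b).
  by apply: eq_Rintegral => w _; rewrite mulrA.
have nn0 : n%:R != 0 :> R by rewrite pnatr_eq0 -lt0n.
have -> : (th * Num.sqrt n%:R) ^+ 2 / 4 / n%:R = th ^+ 2 / 4.
  by rewrite exprMn sqr_sqrtr//; field.
set c := th ^+ 2 / 4; have c0 : 0 <= c by rewrite divr_ge0// sqr_ge0.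
have bv := urn_variance_bounded UP n; have [mv _] := bv.
have v01 := urn_variance01 UP n.
have bE : bounded_measurable (fun w => expR (- (c * urn_variance Y n w))).
  apply: (@measurable_expRN_fun _ _ _ (fun w => c * urn_variance Y n w)).
    exact: measurable_funM.
  by move=> w; have /andP[v0 _] := v01 w; rewrite mulr_ge0.
set k := Num.sqrt q%:R; have k0 : 0 < k by rewrite sqrtr_gt0 ltr0n.
have qk : q%:R = k ^+ 2 by rewrite sqr_sqrtr.
have bY j := urn_bounded UP j.
pose h w := c * (k * (Y n w - Y q w) ^+ 2 + (k^-1 + e)).
have bD : bounded_measurable (fun w => (Y n w - Y q w) ^+ 2).
  by apply/bounded_measurable_sqr/bounded_measurableB.
have bkD : bounded_measurable (fun w => k * (Y n w - Y q w) ^+ 2).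
  by apply: bounded_measurableM => //; exact: bounded_measurable_cst.
have bh : bounded_measurable h.
  apply: bounded_measurableM; first exact: bounded_measurable_cst.
  by apply: bounded_measurableD => //; exact: bounded_measurable_cst.
have H2 : `|\int[P]_(w in B) expR (- (c * urn_variance Y n w)) -
    \int[P]_(w in B) expR (- (c * (y * (1 - y))))| <= \int[P]_(w in B) h w.
  apply: Rintegral_dist_le => //; first exact: bounded_measurable_cst.
  apply: filterS Bye => w Bw /Bw Hw.
  apply: le_trans (expRN_lipschitz _ _) _.
  - by have /andP[v0 _] := v01 w; rewrite mulr_ge0.
  - by rewrite mulr_ge0//; nra.
  rewrite -mulrBr normrM ger0_norm// /h ler_wpM2l//.
  have -> : urn_variance Y n w - y * (1 - y) = (Y n w - y) * (1 - Y n w - y).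
    by rewrite /urn_variance; ring.
  rewrite normrM; apply: (@le_trans _ _ `|Y n w - y|).
    rewrite ler_piMr// ler_norml; have := urn_process01 UP n w.
    by move: y01 => /andP[? ?] /andP[? ?]; apply/andP; split; lra.
  have -> : Y n w - y = (Y n w - Y q w) + (Y q w - y) by ring.
  apply: le_trans (ler_normD _ _) _; rewrite addrA; apply: lerD => //.
  exact: sqr_le_linear.
have H3 : \int[P]_(w in B) h w <= c * (2 / k + e) * fine (P B).
  rewrite /h RintegralZl//; last first.
    by apply: bounded_integrable => //; apply: bounded_measurableD => //; exact: bounded_measurable_cst.
  rewrite -mulrA ler_wpM2l// RintegralD//; last 2 first.
  - exact: bounded_integrable.
  - by apply: bounded_integrable => //; exact: bounded_measurable_cst.
  rewrite Rintegral_cst// RintegralZl//; last exact: bounded_integrable.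
  have S := @urn_sqr_le _ _ _ _ _ _ UP q n B (introT andP (conj q0 qn)) pB.
  have S' : \int[P]_(w in B) (Y n w - Y q w) ^+ 2 <= q%:R^-1 * fine (P B).
    by apply: le_trans S _; rewrite ler_wpM2r// gerBl invr_ge0.
  have -> : (2 / k + e) * fine (P B) = k * (q%:R^-1 * fine (P B)) + (k^-1 + e) * fine (P B).
    by rewrite qk; field; rewrite gt_eqF.
  by rewrite lerD2r ler_wpM2l// ltW.
rewrite Rintegral_cst// in H2.
move=> H1; rewrite mulrDl.
have H4 : urn_error (- (th * Num.sqrt n%:R)) n * fine (P B) <=
   (`|th| ^+ 3 + 3 * `|th| ^+ 2 + `|th| ^+ 4) / Num.sqrt n%:R * fine (P B).
  rewrite ler_wpM2r//; apply: urn_error_le => //.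
  by rewrite normrN normrM (ger0_norm (sqrtr_ge0 _)).
set I1 := \int[P]_(w in B) cos _; set I2 := \int[P]_(w in B) expR (- (c * urn_variance Y n w)) in H1 H2.
have -> : I1 - cos b * expR (- (c * (y * (1 - y)))) * fine (P B) =
  (I1 - cos b * I2) + cos b * (I2 - expR (- (c * (y * (1 - y)))) * fine (P B)) by ring.
apply: le_trans (ler_normD _ _) _; apply: lerD; first exact: le_trans H4.
apply: le_trans H3; apply: le_trans H2.
by rewrite normrM ler_piMl// cos_max.
Qed.

Lemma urn_scaled_sqr_le n B : past_set past n B ->
  \int[P]_(w in B) (Num.sqrt n%:R * (Y n w - Yinf w)) ^+ 2 <= fine (P B).
Proof.
move=> pB; have mB := urn_past_measurable UP pB.
have PB0 : 0 <= fine (P B) by rewrite fine_ge0.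
have [->|n0] := posnP n.
  rewrite sqrtr0; under eq_Rintegral do rewrite mul0r expr0n/=.
  by rewrite Rintegral_cst// mul0r.
have bD : bounded_measurable (fun w => (Yinf w - Y n w) ^+ 2).
  apply/bounded_measurable_sqr/bounded_measurableB; first exact: (urn_limit_bounded UP).
  exact: (urn_bounded UP n).
have -> : \int[P]_(w in B) (Num.sqrt n%:R * (Y n w - Yinf w)) ^+ 2 =
    \int[P]_(w in B) (n%:R * (Yinf w - Y n w) ^+ 2).
  by apply: eq_Rintegral => w _; rewrite exprMn sqr_sqrtr//; ring.
rewrite RintegralZl//; last exact: bounded_integrable.
have := urn_limit_sqr_le UP n0 pB.
by rewrite -ler_pdivrMl ?invrK ?ltr0n// invr_gt0 ltr0n.
Qed.
End urn_limit_law.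

(** * The limit has no atom *)

Lemma bounded_Rintegral_sum d (T : measurableType d) (R : realType)
    (P : probability T R) (I : finType) (f : I -> T -> R) :
  (forall i, bounded_measurable (f i)) ->
  bounded_measurable (fun w => \sum_i f i w) /\
  \int[P]_w (\sum_i f i w) = \sum_i \int[P]_w f i w.
Proof.
move=> bf; rewrite unlock /=.
elim: (index_enum I) => [|i s [IH1 IH2]] /=.
  by split; [exact: bounded_measurable_cst|exact: Rintegral_prob_cst].
split; first exact: bounded_measurableD.
by rewrite RintegralD ?IH2//; exact: bounded_integrable.
Qed.

Lemma cos_mean_sqr (R : realType) (K : nat) (x : R) :
  (\sum_(k < K) cos (k.+1%:R * x)) ^+ 2 =
  \sum_(p : 'I_K * 'I_K) (2^-1 * cos ((p.1%:R - p.2%:R) * x) +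
     2^-1 * cos ((p.1.+1%:R + p.2.+1%:R) * x)).
Proof.
rewrite expr2 big_distrlr/= pair_bigA/=; apply: eq_bigr => -[k l] _ /=.
have -> : (k%:R - l%:R) * x = k.+1%:R * x - l.+1%:R * x by rewrite -!natr1; ring.
rewrite mulrDl; move: (k.+1%:R * x) (l.+1%:R * x) => u v.
by rewrite cosB cosD; field.
Qed.

Section urn_no_atom.
Context d (T : measurableType d) (R : realType) (P : probability T R).
Variables (Y : nat -> T -> R) (past : nat -> T -> T -> Prop).
Hypothesis UP : urn_process P Y past.
Let Yinf := urn_limit Y.

(** Let x be proportional to Y_oo - a. On the event Y_oo = a the sum of cos
    (k x) over k = 1, ..., K equals K; the mean of its square is at most K,
    because in the double sum of products the diagonal contributes about K /
    2 and all other terms are cosines of nonzero multiples of x, with small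
    means. So P (Y_oo = a) K^2 <= K for every K. *)
Lemma urn_limit_no_atom (a : R) : P [set w | Yinf w = a] = 0%E.
Proof.
set A := [set w | _].
have mYinf : measurable_fun setT Yinf by exact: urn_limit_measurable UP.
have mA : measurable A.
  rewrite -[X in measurable X]setTI (_ : A = Yinf @^-1` [set a])//; exact: mYinf.
apply/eqP; rewrite -fine_eq0 ?fin_num_measure//; apply/eqP; apply/eqP.
rewrite eq_le fine_ge0// andbT leNgt; apply/negP => A0.
suff H K : (0 < K)%N -> fine (P A) <= K%:R^-1.
  have := H (Num.bound (fine (P A))^-1).+1 isT.
  rewrite leNgt => /negP; apply; rewrite invf_plt ?posrE//.
  apply: lt_le_trans (archi_boundP _) _; first by rewrite invr_ge0 ltW.
  by rewrite ler_nat.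
move=> K0; have K0R : 0 < K%:R :> R by rewrite ltr0n.
(* each cosine of a nonzero multiple of x has mean at most 2 e, so that
   together they contribute at most 2 e K^2 = K / 2 *)
pose e : R := (4 * K%:R)^-1.
have e0 : 0 < e by rewrite invr_gt0 mulr_gt0.
have /cvgrPdist_lt/(_ _ e0)[t _ /(_ t (leqnn t))] := urn_gauss_vanish UP.
rewrite /= sub0r normrN ger0_norm; last by apply: Rintegral_ge0 => w _; exact: expR_ge0.
rewrite -/Yinf => Jt.
(* at frequency tau sqrt n the Gaussian factor of [urn_cos_limit] is exp (- t
   Y_n (1 - Y_n)), and larger multiples only decrease it; th bounds tau times
   the multiples up to 2 K *)
pose tau : R := 2 * Num.sqrt t%:R.
have tau2 : tau ^+ 2 / 4 = t%:R by rewrite exprMn sqr_sqrtr//; field.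
have tau0 : 0 <= tau by rewrite mulr_ge0// sqrtr_ge0.
pose th := 2 * K%:R * tau.
pose C := th ^+ 3 + 3 * th ^+ 2 + th ^+ 4.
have [n [n0 Hn1 Hn2]] : exists n, [/\ (0 < n)%N,
    \int[P]_w expR (- (t%:R * urn_variance Y n w)) <= e & C / Num.sqrt n%:R <= e].
  have J := @urn_gauss_limit _ _ _ P Y past UP t%:R setT (ler0n _ _) measurableT.
  move/cvgrPdist_lt : J => /(_ (e - \int[P]_w expR (- (t%:R * (Yinf w * (1 - Yinf w)))))).
  rewrite subr_gt0 => /(_ Jt)[n1 _ Hn1].
  pose b := (Num.bound ((C / e) ^+ 2)).+1.
  exists (maxn n1 b); split; first by rewrite leq_max ltnS leq0n orbT.
    have := Hn1 (maxn n1 b) (leq_maxl _ _); rewrite distrC => /ltW/(le_trans (ler_norm _)).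
    by rewrite lerD2r.
  have b0 : 0 < (maxn n1 b)%:R :> R by rewrite ltr0n leq_max ltnS leq0n orbT.
  rewrite ler_pdivrMr ?sqrtr_gt0// mulrC -ler_pdivrMr//.
  apply: le_trans (ler_norm _) _; rewrite -sqrtr_sqr ler_sqrt ?(ltW b0)//.
  apply: le_trans (ltW (archi_boundP (sqr_ge0 _))) _.
  by rewrite ler_nat leq_max (leqW (leqnn _)) orbT.
pose x w := tau * Num.sqrt n%:R * (Yinf w - a).
have n0R : 0 < n%:R :> R by rewrite ltr0n.
have mx (i : R) : bounded_measurable (fun w => cos (i * x w)).
  apply: measurable_cos_fun; apply: measurable_funM => //; apply: measurable_funM => //.
  exact: measurable_funB.
have freq (i : R) : 1 <= `|i| -> `|i| <= 2 * K%:R -> \int[P]_w cos (i * x w) <= 2 * e.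
  move=> i1 i2; pose l := i * tau * Num.sqrt n%:R.
  have lt : `|l| <= th * Num.sqrt n%:R.
    rewrite /l /th normrM [`|Num.sqrt _|]ger0_norm ?sqrtr_ge0// ler_wpM2r ?sqrtr_ge0//.
    by rewrite normrM (ger0_norm tau0) ler_wpM2r.
  have pphi : past_fun past n (fun w => l * (Y n w - a)).
    by move=> w w' ww'; rewrite (urn_adapted UP ww').
  have := urn_cos_limit UP l n0 (@past_setT _ T past n) pphi.
  rewrite (fine_probability_setT P) mulr1 => E1.
  have E2 := urn_error_le n0 lt; rewrite -/C in E2.
  have -> : \int[P]_w cos (i * x w) = \int[P]_w cos (l * (urn_limit Y w - Y n w) + l * (Y n w - a)).
    by apply: eq_Rintegral => w _; congr cos; rewrite /x /l /Yinf; ring.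
  have E3 : \int[P]_w (expR (- (l ^+ 2 * urn_variance Y n w / 4 / n%:R)) *
       cos (l * (Y n w - a))) <= e.
    apply: le_trans Hn1.
    have v0 w := urn_variance01 UP n w.
    have [mv _] := urn_variance_bounded UP n.
    have l2 w : 0 <= l ^+ 2 * urn_variance Y n w / 4 / n%:R.
      by rewrite divr_ge0// divr_ge0// mulr_ge0 ?sqr_ge0//; case/andP: (v0 w).
    apply: Rintegral_mono => //.
    - apply: bounded_measurableM.
        apply: measurable_expRN_fun => //.
        by do 2 apply: measurable_funM => //; apply: measurable_funM.
      apply: measurable_cos_fun; apply: measurable_funM => //.
      by apply: measurable_funB => //; exact: urn_measurable UP n.
    - apply: measurable_expRN_fun; first exact: measurable_funM.
      by move=> w; rewrite mulr_ge0//; case/andP: (v0 w).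
    move=> w _; apply: le_trans (ler_norm _) _.
    rewrite normrM ger0_norm ?expR_ge0//.
    apply: (@le_trans _ _ (expR (- (l ^+ 2 * urn_variance Y n w / 4 / n%:R)))).
      by rewrite ler_piMr ?expR_ge0// cos_max.
    rewrite ler_expR lerN2.
    have -> : l ^+ 2 * urn_variance Y n w / 4 / n%:R = i ^+ 2 * (t%:R * urn_variance Y n w).
      rewrite -tau2 /l exprMn exprMn sqr_sqrtr ?(ltW n0R)//.
      by field; rewrite gt_eqF.
    apply: ler_peMl; first by rewrite mulr_ge0//; case/andP: (v0 w).
    by rewrite -real_normK ?num_real// exprn_ege1.
  by move: E1; rewrite ler_norml => /andP[_]; lra.
pose F w := \sum_(p : 'I_K * 'I_K) (2^-1 * cos ((p.1%:R - p.2%:R) * x w) +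
     2^-1 * cos ((p.1.+1%:R + p.2.+1%:R) * x w)).
have bterm (c i : R) : bounded_measurable (fun w => c * cos (i * x w)).
  by apply: bounded_measurableM => //; exact: bounded_measurable_cst.
have [bF IF] := @bounded_Rintegral_sum _ _ _ P _
  (fun (p : 'I_K * 'I_K) w => 2^-1 * cos ((p.1%:R - p.2%:R) * x w) +
     2^-1 * cos ((p.1.+1%:R + p.2.+1%:R) * x w))
  (fun p => bounded_measurableD (bterm _ _) (bterm _ _)).
have PF : fine (P A) * K%:R ^+ 2 <= \int[P]_w F w.
  rewrite fine_prob_indic//.
  rewrite -RintegralZr//; last first.
    by apply: bounded_integrable => //; exact: bounded_measurable_indic.
  apply: Rintegral_mono => //.
    apply: bounded_measurableM; last exact: bounded_measurable_cst.
    exact: bounded_measurable_indic.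
  move=> w _; rewrite /F -cos_mean_sqr indicE; case: (boolP (w \in A)) => [|_]; last first.
    by rewrite mul0r sqr_ge0.
  rewrite inE /A/= => wa; rewrite mul1r /x wa subrr mulr0.
  under eq_bigr do rewrite mulr0 cos0.
  by rewrite sumr_const card_ord.
have IFle : \int[P]_w F w <= K%:R / 2 + K%:R ^+ 2 * (2 * e).
  rewrite IF.
  apply: (@le_trans _ _ (\sum_(p : 'I_K * 'I_K) ((2^-1 * (p.1 == p.2)%:R) + 2 * e))).
    apply: ler_sum => -[k l] _ /=; rewrite RintegralD//; last 2 first.
    - by apply: bounded_integrable => //; exact: bterm.
    - by apply: bounded_integrable => //; exact: bterm.
    rewrite !RintegralZl//; last 2 first.
    - exact: bounded_integrable.
    - exact: bounded_integrable.
    have kK : k%:R <= K%:R - 1 :> R by rewrite lerBrDr natr1 ler_nat.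
    have lK : l%:R <= K%:R - 1 :> R by rewrite lerBrDr natr1 ler_nat.
    have k0 : 0 <= k%:R :> R by [].
    have l0 : 0 <= l%:R :> R by [].
    have H2 : \int[P]_w cos ((k.+1%:R + l.+1%:R) * x w) <= 2 * e.
      apply: freq; rewrite ger0_norm ?addr_ge0// -!natr1; lra.
    have H1 : \int[P]_w cos ((k%:R - l%:R) * x w) <= (k == l)%:R + 2 * e.
      have [->|kl] := eqVneq k l.
        rewrite subrr; under eq_Rintegral do rewrite mul0r cos0.
        by rewrite Rintegral_prob_cst/= lerDl mulr_ge0// ltW.
      rewrite add0r; apply: freq; last by rewrite ler_norml; lra.
      have sep (i j : nat) : (i < j)%N -> 1 <= `|j%:R - i%:R| :> R.
        move=> ij; apply: le_trans (ler_norm _).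
        by rewrite lerBrDr addrC natr1 ler_nat.
      have [kl'|lk] := ssrnat.ltnP k l; first by rewrite distrC; exact: sep.
      apply: sep; rewrite ltn_neqAle lk andbT eq_sym.
      by apply: contra kl => /eqP/val_inj ->.
    by lra.
  rewrite big_split/= sumr_const card_prod card_ord -mulr_sumr.
  rewrite -[(2 * e) *+ _]mulr_natl natrM -expr2 lerD2r mulrC ler_wpM2r//.
  rewrite -(pair_bigA _ (fun k l : 'I_K => (k == l)%:R))/=.
  rewrite -[leRHS]mulr1 -[in leRHS](card_ord K) mulr_natl -sumr_const.
  apply: ler_sum => k _; rewrite (bigD1 k)//= eqxx big1 ?addr0// => l.
  by rewrite eq_sym => /negbTE ->.
have : fine (P A) * K%:R ^+ 2 <= K%:R^-1 * K%:R ^+ 2.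
  apply: le_trans PF (le_trans IFle _).
  by rewrite le_eqVlt; apply/orP; left; apply/eqP; rewrite /e; field; rewrite gt_eqF.
by rewrite ler_pM2r// exprn_gt0.
Qed.

End urn_no_atom.

(** * Conditioning on an event, and convergence in law *)

Section conditioned.
Context d (T : measurableType d) (R : realType) (P : probability T R).

Definition conditioned (B : set T) (mB : measurable B) : probability T R :=
  mnormalize (mrestr P mB) P.

Variables (B : set T) (mB : measurable B).

Lemma conditionedE (A : set T) : P B != 0%E ->
  conditioned mB A = (P (A `&` B) * (fine (P B))^-1%:E)%E.
Proof.
move=> PB; rewrite /conditioned/= /mnormalize/= /mrestr setTI (negbTE PB)/=.
case: ifPn => // /eqP PBoo; have := fin_num_prob P mB.
by rewrite PBoo.
Qed.

Lemma Rintegral_conditioned (f : T -> R) : 0 < fine (P B) -> bounded_measurable f ->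
  \int[conditioned mB]_x f x = (fine (P B))^-1 * \int[P]_(x in B) f x.
Proof.
move=> PB0 bf; have [mf [C fC]] := bf.
have PB : P B != 0%E by apply/eqP => PB; move: PB0; rewrite PB ltxx.
have bg : bounded_measurable (fun x => f x + C).
  by apply: bounded_measurableD => //; exact: bounded_measurable_cst.
have g0 x : 0 <= f x + C by have := fC x; rewrite ler_norml; lra.
have mg : measurable_fun setT (fun x => (f x + C)%:E).
  by apply/measurable_EFinP; case: bg.
have k0 : 0 <= (fine (P B))^-1 by rewrite invr_ge0 ltW.
pose Q := conditioned mB; pose k := NngNum k0.
have H : (\int[Q]_x (f x + C)%:E = (fine (P B))^-1%:E * \int[P]_(x in B) (f x + C)%:E)%E.
  transitivity (\int[mscale k P]_(x in B) (f x + C)%:E)%E; last first.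
    rewrite ge0_integral_mscale//; first exact: measurable_funTS.
    by move=> x _; rewrite lee_fin.
  transitivity (\int[Q]_(x in B) (f x + C)%:E)%E; last first.
    apply: eq_measure_integral => A mA AB; apply: etrans (conditionedE A PB) _.
    by rewrite setIidl// muleC.
  rewrite [RHS]integral_mkcond; apply: ae_eq_integral => //.
    by apply/(measurable_restrictT _ mB); exact: measurable_funTS.
  exists (~` B); split; first exact: measurableC.
    have QB : Q (~` B) = 0%E by rewrite /Q conditionedE// setICl measure0 mul0e.
    exact: QB.
  move=> x /= nx Bx; apply: nx => _.
  by rewrite /patch mem_set.
rewrite !bounded_integralE// -EFinM in H; move: H => -[].
rewrite !RintegralD//; do ?[exact: bounded_integrable|by apply: bounded_integrable => //; exact: bounded_measurable_cst].
rewrite Rintegral_prob_cst Rintegral_cst// => H.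
apply: (@addIr _ C); rewrite H; field; exact: lt0r_neq0.
Qed.

End conditioned.

Section law_of.
Context d (T : measurableType d) (R : realType) (Q : probability T R).
Variables (Z : T -> R) (mZ : measurable_fun setT Z).

Definition law_of : law R :=
  distribution Q (@mfun_Sub _ _ T (measurableTypeR R) Z (mem_set mZ)).

Lemma Rintegral_law_of (f : measurableTypeR R -> R) : bounded_measurable f ->
  \int[law_of]_x f x = \int[Q]_w f (Z w).
Proof.
move=> bf; have [mf [C fC]] := bf.
have bfZ : bounded_measurable (fun w => f (Z w)).
  by split; [exact: measurableT_comp|exists C].
rewrite /Rintegral /law_of integral_distribution//; first exact/measurable_EFinP.
exact: (bounded_integrable Q measurableT bfZ).
Qed.
End law_of.

Section weak_limits.
Context d (T : measurableType d) (R : realType) (P : probability T R).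
Variables (Z : nat -> T -> R) (mZ : forall n, measurable_fun setT (Z n)).
Hypothesis bZ : forall n, bounded_measurable (Z n).

(** The bound on the second moments provides the tightness required by
    [weak_cvg_cos]. *)
Lemma conditioned_weak_cvg (B : nat -> set T) (mB : forall n, measurable (B n))
    (m : law R) (C : R) : (forall n, 0 < fine (P (B n))) ->
  (forall a b : R, (fine (P (B n)))^-1 * \int[P]_(w in B n) cos (a * Z n w + b)
     @[n --> \oo] --> \int[m]_x cos (a * x + b)) ->
  (\forall n \near \oo, \int[P]_(w in B n) Z n w ^+ 2 <= C * fine (P (B n))) ->
  weak_cvg (fun n => law_of (conditioned P (mB n)) (mZ n)) m.
Proof.
move=> PB cf mom; apply: weak_cvg_cos => [a b|e e0].
  apply: cvg_trans (cf a b); apply: near_eq_cvg; apply: nearW => n.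
  rewrite Rintegral_law_of; last exact: bounded_measurable_cos.
  rewrite Rintegral_conditioned//.
  by apply: measurable_cos_fun; apply: measurable_funD => //; exact: measurable_funM.
pose A : R := `|C| / e + 1.
have Ce : 0 <= `|C| / e by rewrite divr_ge0// ltW.
have A1 : 1 <= A by rewrite /A; lra.
exists A; first lra.
near=> n.
have PBn : P (B n) != 0%E.
  by apply/eqP => PB0; have := PB n; rewrite PB0 ltxx.
pose S := [set w | A < `|Z n w|].
have -> : law_of (conditioned P (mB n)) (mZ n) [set x | (A < `|x|)%R] =
  conditioned P (mB n) S by [].
have mS : measurable S by exact: measurable_norm_gt (mZ n).
rewrite conditionedE// setIC -(fineK (fin_num_prob P (measurableI _ _ (mB n) mS))) -EFinM lee_fin.
rewrite ler_pdivrMr//.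
apply: le_trans (second_moment_tail P (mB n) (bZ n) (lt_le_trans ltr01 A1)) _.
have A2 : 0 < A ^+ 2 by rewrite exprn_gt0//; lra.
rewrite mulrC ler_pdivrMr//.
have H : \int[P]_(w in B n) Z n w ^+ 2 <= C * fine (P (B n)) by near: n.
apply: le_trans H _; rewrite mulrAC ler_pM2r//.
have -> : C = e * (C / e) by field; exact: lt0r_neq0.
rewrite ler_pM2l//; apply: (@le_trans _ _ (`|C| / e)).
  by rewrite ler_wpM2r ?invr_ge0 ?(ltW e0)// ler_norm.
by rewrite /A; nra.
Unshelve. all: by end_near. Qed.

Lemma law_weak_cvg (m : law R) (C : R) :
  (forall a b : R, \int[P]_w cos (a * Z n w + b) @[n --> \oo] -->
     \int[m]_x cos (a * x + b)) ->
  (\forall n \near \oo, \int[P]_w Z n w ^+ 2 <= C) ->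
  cvg_in_law P Z m.
Proof.
move=> cf mom; split => //.
have P1 := fine_probability_setT P.
have P1' : P setT != 0%E by apply/eqP => PB0; move: P1; rewrite PB0 => /eqP; rewrite eq_sym oner_eq0.
have -> : (fun n => pushforward P (Z n : T -> measurableTypeR R)) =
    (fun n => law_of (conditioned P measurableT) (mZ n) : set (measurableTypeR R) -> \bar R).
  apply/funext => n; apply/funext => A.
  rewrite -[RHS]/(conditioned P measurableT (Z n @^-1` A)) conditionedE// setIT P1 invr1.
  by rewrite mule1.
apply: (@conditioned_weak_cvg (fun=> setT) (fun=> measurableT) m C).
- by move=> n; rewrite P1.
- by move=> a b; under eq_fun do rewrite P1 invr1 mul1r; exact: cf.
- by rewrite P1 mulr1.
Qed.
End weak_limits.

Lemma cvg_inv_sqrt (R : realType) (C : R) :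
  C / Num.sqrt n%:R @[n --> \oo] --> (0 : R).
Proof.
rewrite -[X in _ --> X](mulr0 C); apply: cvgM; first exact: cvg_cst.
rewrite -cvg_shiftS.
have -> : (fun n : nat => (Num.sqrt n.+1%:R)^-1) = (fun n : nat => Num.sqrt (@harmonic R n)).
  by apply/funext => n; rewrite -sqrtrV.
have H : Num.sqrt (@harmonic R n) @[n --> \oo] --> Num.sqrt (0 : R).
  by apply: continuous_cvg; [exact: sqrt_continuous|exact: cvg_harmonic].
by rewrite sqrtr0 in H.
Qed.

Lemma cvg_of_dist_le (R : realType) (u v e : nat -> R) (l : R) :
  (\forall n \near \oo, `|u n - v n| <= e n) ->
  e n @[n --> \oo] --> 0 -> v n @[n --> \oo] --> l -> u n @[n --> \oo] --> l.
Proof.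
move=> uv e0 vl; have -> : u = (fun n => (u n - v n) + v n) by apply/funext => n; rewrite subrK.
rewrite -[l]add0r; apply: cvgD => //; apply/cvgrPdist_le => eps eps0.
move/cvgrPdist_le : e0 => /(_ _ eps0) H; near=> n.
have H1 : `|u n - v n| <= e n by near: n.
have H2 : `|0 - e n| <= eps by near: n.
rewrite sub0r normrN in H2; rewrite sub0r normrN; apply: le_trans H1 _.
exact: le_trans (ler_norm _) H2.
Unshelve. all: by end_near. Qed.

Lemma cvg_divn k : (0 < k)%N -> (n %/ k)%N @[n --> \oo] --> \oo.
Proof.
move=> k0 A [M _ MA]; exists (M * k)%N => // n /= Mn; apply: MA => /=.
by rewrite leq_divRL.
Qed.

Section normal_mixture.
Context d (T : measurableType d) (R : realType) (P : probability T R).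
Variables (V : T -> R) (c : R).
Hypotheses (mV : measurable_fun setT V) (V0 : forall w, 0 <= V w) (c0 : 0 <= c).

Lemma random_centered_normal : random_probability (fun w => centered_normal (c * V w)).
Proof.
move=> A mA; apply: (measurableT_comp (measurable_centered_normal mA)).
exact: measurable_funM.
Qed.

Lemma mixture_cos (a b : R) :
  \int[mixture_law P random_centered_normal]_x cos (a * x + b) =
  cos b * \int[P]_w expR (- (c * a ^+ 2 / 2 * V w)).
Proof.
rewrite Rintegral_mixture; last exact: bounded_measurable_cos.
rewrite -RintegralZl//; last first.
  apply: bounded_integrable => //.
  apply: (@measurable_expRN_fun _ _ _ (fun w => c * a ^+ 2 / 2 * V w)).
    exact: measurable_funM.
  by move=> w; rewrite mulr_ge0// divr_ge0// mulr_ge0// sqr_ge0.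
apply: eq_Rintegral => w _; rewrite centered_normal_cos ?mulr_ge0// mulrC.
by congr (_ * expR (- _)); ring.
Qed.
End normal_mixture.

Section urn_law.
Context d (T : measurableType d) (R : realType) (P : probability T R).
Variables (Y : nat -> T -> R) (past : nat -> T -> T -> Prop).
Hypothesis UP : urn_process P Y past.
Local Notation Yinf := (urn_limit Y).

Lemma urn_limit_variance_ge0 w : 0 <= Yinf w * (1 - Yinf w).
Proof. by have := urn_limit01 UP w; nra. Qed.

Lemma urn_limit_variance_measurable : measurable_fun setT (fun w => Yinf w * (1 - Yinf w)).
Proof.
have mYinf : measurable_fun setT Yinf by exact: urn_limit_measurable UP.
by apply: measurable_funM => //; exact: measurable_funB.
Qed.

Lemma urn_deviation_bounded n :
  bounded_measurable (fun w => Num.sqrt n%:R * (Y n w - Yinf w)).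
Proof.
apply: bounded_measurableM; first exact: bounded_measurable_cst.
apply: bounded_measurableB; [exact: urn_bounded UP n|exact: urn_limit_bounded UP].
Qed.

Lemma urn_deviation_law :
  cvg_in_law P (fun n w => Num.sqrt n%:R * (Y n w - Yinf w))
    (mixture P (fun w => centered_normal (2^-1 * (Yinf w * (1 - Yinf w))))).
Proof.
have c0 : 0 <= 2^-1 :> R by [].
rewrite (mixture_lawE P (random_centered_normal 2^-1 urn_limit_variance_measurable)).
apply: (@law_weak_cvg _ _ _ _ _ _ _ _ 1).
- by move=> n; have [] := urn_deviation_bounded n.
- exact: urn_deviation_bounded.
- move=> a b; rewrite mixture_cos//; last exact: urn_limit_variance_ge0.
  apply: (@cvg_of_dist_le _ _
    (fun n => cos b * \int[P]_w expR (- (a ^+ 2 / 4 * urn_variance Y n w)))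
    (fun n => (`|a| ^+ 3 + 3 * `|a| ^+ 2 + `|a| ^+ 4) / Num.sqrt n%:R)).
  + exists 1%N => // n /= n0.
    have := urn_deviation_cos UP (a * Num.sqrt n%:R) b n0 (@past_setT _ T past n).
    have -> : \int[P]_w cos (a * Num.sqrt n%:R * (Y n w - Yinf w) + b) =
        \int[P]_w cos (a * (Num.sqrt n%:R * (Y n w - Yinf w)) + b).
      by apply: eq_Rintegral => w _; rewrite mulrA.
    have nn0 : n%:R != 0 :> R by rewrite pnatr_eq0 -lt0n.
    have -> : (a * Num.sqrt n%:R) ^+ 2 / 4 / n%:R = a ^+ 2 / 4.
      by rewrite exprMn sqr_sqrtr//; field.
    move=> /le_trans; apply.
    rewrite (fine_probability_setT P) mulr1; apply: urn_error_le => //.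
    by rewrite normrN normrM (ger0_norm (sqrtr_ge0 _)).
  + exact: cvg_inv_sqrt.
  + apply: cvgM; first exact: cvg_cst.
    have -> : 2^-1 * a ^+ 2 / 2 = a ^+ 2 / 4 by field.
    by apply: urn_gauss_limit UP _ _ _ _ => //; rewrite divr_ge0// sqr_ge0.
- apply: nearW => n; have := urn_scaled_sqr_le UP (@past_setT _ T past n).
  by rewrite (fine_probability_setT P).
Qed.
End urn_law.

(** * Trajectories of the two walkers *)

Section trajectories.
Implicit Types (x : trajectories) (n : nat) (y l : int) (k : 'I_2).

Definition agree n x x' := forall k i, (i <= n)%N -> x k i = x' k i.

(** A history up to time n followed by a jump to y; the values after the
    time n + 1 are never used. *)
Definition extend x n y : trajectories := fun k i =>
  if (i <= n)%N then x k i else if k == mover n.+1 then y else x k n.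

Lemma agree_le n m x x' : (n <= m)%N -> agree m x x' -> agree n x x'.
Proof. by move=> nm xx' k i im; apply: xx'; exact: leq_trans nm. Qed.

Lemma agree_extend n x y : agree n (extend x n y) x.
Proof. by move=> k i im; rewrite /extend im. Qed.

Lemma extend_mover n x y : extend x n y (mover n.+1) n.+1 = y.
Proof. by rewrite /extend ltnn eqxx. Qed.

Lemma extend_stay n x y k : k != mover n.+1 -> extend x n y k n.+1 = x k n.
Proof. by move=> km; rewrite /extend ltnn (negbTE km). Qed.

Lemma agree_extend2 n x x' y : agree n x x' -> agree n.+1 (extend x n y) (extend x' n y).
Proof.
move=> xx' k i im; rewrite /extend; case: leqP => // ni; first exact: xx'.
by rewrite xx'.
Qed.

Lemma crossings_agree n x x' l : agree n x x' -> crossings x n l = crossings x' n l.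
Proof.
move=> xx'; apply: eq_bigr => k _; apply: eq_big_nat => i /andP[i0 iS].
by rewrite !xx'// (leq_trans (leq_pred i)).
Qed.

Lemma crosses_same y l : crosses y y l = false.
Proof. by rewrite /crosses; do ! case: eqP => ? //=; lia. Qed.

Lemma crossingsS x n l : (forall k, k != mover n.+1 -> x k n.+1 = x k n) ->
  crossings x n.+1 l =
  (crossings x n l + crosses (x (mover n.+1) n) (x (mover n.+1) n.+1) l)%N.
Proof.
move=> st; rewrite /crossings.
under eq_bigr do rewrite big_nat_recr//=.
rewrite big_split/=; congr addn; rewrite (bigD1 (mover n.+1))//= big1 ?addn0//.
by move=> k km; rewrite st// crosses_same.
Qed.

Lemma crossings_extend x n y l :
  crossings (extend x n y) n.+1 l = (crossings x n l + crosses (x (mover n.+1) n) y l)%N.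
Proof.
rewrite crossingsS; last first.
  by move=> k km; rewrite extend_stay// agree_extend.
by rewrite (crossings_agree l (@agree_extend n x y)) extend_mover agree_extend.
Qed.

Definition crosses_edge y y' := crosses y y' (-1) || crosses y y' 0.

(** Almost every trajectory is of this form ([valid_ae]); the weights are
    then determined by the number of crossings of the left edge. *)
Record valid_path x : Prop := ValidPath {
  valid_start : forall k, x k 0%N = 0 ;
  valid_stay : forall n k, k != mover n.+1 -> x k n.+1 = x k n ;
  valid_cross : forall n, crosses_edge (x (mover n.+1) n) (x (mover n.+1) n.+1) }.

Lemma crosses_edge_total y y' : crosses_edge y y' ->
  (crosses y y' (-1) + crosses y y' 0 = 1)%N.
Proof. by rewrite /crosses_edge /crosses; do ! case: eqP => ? //=; lia. Qed.

Lemma crosses_edge0 y : crosses_edge 0 y -> y != 0.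
Proof. by rewrite /crosses_edge /crosses; do ! case: eqP => ? //=; lia. Qed.

Lemma crosses_edge_out y y' : y != 0 -> crosses_edge y y' -> y' = 0.
Proof. by rewrite /crosses_edge /crosses; do ! case: eqP => ? //=; lia. Qed.

Lemma valid_crossings x n : valid_path x -> (crossings x n (-1) + crossings x n 0 = n)%N.
Proof.
move=> [xs st cr]; elim: n => [|n IH].
  by rewrite /crossings !big1// => k _; rewrite big_geq.
rewrite !crossingsS; try exact: st.
by rewrite addnACA IH crosses_edge_total ?addn1.
Qed.

Lemma mover4 n : [/\ mover (4 * n).+1 = ord0, mover (4 * n).+2 = ord_max,
  mover (4 * n).+3 = ord0 & mover (4 * n).+4 = ord_max].
Proof. by rewrite /mover /= !negbK oddM. Qed.

Lemma ord2_neq : (ord0 : 'I_2) != ord_max. Proof. by []. Qed.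

Lemma ord2P k : k = ord0 \/ k = ord_max.
Proof. by case: k => -[|[|//]] i; [left|right]; exact: val_inj. Qed.

(** In a period each walker moves twice: away from 0, and back. *)
Lemma valid_center x n k : valid_path x -> x k (4 * n)%N = 0.
Proof.
move=> vx; have [xs st cr] := vx; elim: n k => [|n IH] k; first by rewrite muln0.
have [m1 m2 m3 m4] := mover4 n.
have c1 := cr (4 * n)%N; have c2 := cr (4 * n).+1; have c3 := cr (4 * n).+2.
have c4 := cr (4 * n).+3.
have s1 := st (4 * n)%N; have s2 := st (4 * n).+1; have s3 := st (4 * n).+2.
have s4 := st (4 * n).+3.
rewrite m1 in c1 s1; rewrite m2 in c2 s2; rewrite m3 in c3 s3; rewrite m4 in c4 s4.
have nn : (ord_max : 'I_2) != ord0 by [].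
rewrite !IH in c1; rewrite (s1 _ nn) IH in c2.
have a0 := crosses_edge0 c1; have b0 := crosses_edge0 c2.
rewrite (s2 _ ord2_neq) in c3; have z0 := crosses_edge_out a0 c3.
rewrite (s3 _ nn) in c4; have z1 := crosses_edge_out b0 c4.
have -> : (4 * n.+1 = (4 * n).+4)%N by lia.
by have [->|->] := ord2P k; rewrite ?z1// (s4 _ ord2_neq).
Qed.

End trajectories.

Section jump_operator.
Context (R : realType).
Implicit Types (x : trajectories) (n : nat) (y l : int) (k : 'I_2).

Lemma weightE x n l : weight R x n l = 1 + (crossings x n l)%:R. Proof. by []. Qed.

Lemma weight_gt0 x n l : 0 < weight R x n l.
Proof. by rewrite weightE ltr_pwDl. Qed.

Lemma weight_extend x n y l : weight R (extend x n y) n.+1 l =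
  weight R x n l + (crosses (x (mover n.+1) n) y l)%:R.
Proof. by rewrite !weightE crossings_extend natrD addrA. Qed.

Lemma weight_agree n x x' l : agree n x x' -> weight R x n l = weight R x' n l.
Proof. by move=> xx'; rewrite !weightE (crossings_agree l xx'). Qed.

Lemma left_fraction_agree n x x' : agree n x x' ->
  left_fraction R x n = left_fraction R x' n.
Proof. by move=> xx'; rewrite /left_fraction !(weight_agree _ xx'). Qed.

Lemma jump_prob_agree n x x' y : agree n x x' -> jump_prob R x n y = jump_prob R x' n y.
Proof. by move=> xx'; rewrite /jump_prob !(weight_agree _ xx') xx'. Qed.

(** The conditional mean of F after one more step, given the history x up to
    time n. *)
Definition jump (n : nat) (F : trajectories -> R) x : R :=
  jump_prob R x n (-1) * F (extend x n (-1)) +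
  jump_prob R x n 0 * F (extend x n 0) +
  jump_prob R x n 1 * F (extend x n 1).

Definition local n (F : trajectories -> R) := forall x x', agree n x x' -> F x = F x'.

Lemma jump_local n F : local n.+1 F -> local n (jump n F).
Proof.
move=> lF x x' xx'; rewrite /jump !(jump_prob_agree _ xx').
by rewrite !(lF _ _ (agree_extend2 _ xx')).
Qed.

Lemma jump_center n F x : x (mover n.+1) n = 0 ->
  jump n F x = weight R x n (-1) / (weight R x n (-1) + weight R x n 0) * F (extend x n (-1)) +
    weight R x n 0 / (weight R x n (-1) + weight R x n 0) * F (extend x n 1).
Proof. by move=> x0; rewrite /jump /jump_prob x0 /= mul0r addr0. Qed.

Lemma jump_out n F x : x (mover n.+1) n != 0 -> jump n F x = F (extend x n 0).
Proof.
by move=> x0; rewrite /jump /jump_prob (negbTE x0) /= !mul0r add0r addr0 mul1r.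
Qed.

(** The first two jumps are the draws of the urn, the second one with the
    weights updated by the first; the last two jumps are forced, since both
    walkers are then away from 0. *)
Lemma jump_four n (G : R -> R) x : (forall k, x k (4 * n)%N = 0) ->
  weight R x (4 * n) (-1) + weight R x (4 * n) 0 = urn_total R n ->
  jump (4 * n) (jump (4 * n).+1 (jump (4 * n).+2 (jump (4 * n).+3
    (fun x' => G (left_fraction R x' (4 * n).+4))))) x =
  urn_step n G (left_fraction R x (4 * n)).
Proof.
move=> x0 tot; have [m1 m2 m3 m4] := mover4 n.
have nn : (ord_max : 'I_2) != ord0 by [].
set N := (4 * n)%N in x0 tot m1 m2 m3 m4 *.
have S2 := urn_total_ge2 R n.
pose L := weight R x N (-1); pose Q := weight R x N 0.
have final a b : a != 0 -> b != 0 ->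
    let x2 := extend (extend x N a) N.+1 b in
    jump N.+2 (jump N.+3 (fun x' => G (left_fraction R x' N.+4))) x2 =
    G ((L + ((crosses 0 a (-1))%:R + (crosses 0 b (-1))%:R + (crosses a 0 (-1))%:R + (crosses b 0 (-1))%:R)) /
       ((L + ((crosses 0 a (-1))%:R + (crosses 0 b (-1))%:R + (crosses a 0 (-1))%:R + (crosses b 0 (-1))%:R)) +
        (Q + ((crosses 0 a 0)%:R + (crosses 0 b 0)%:R + (crosses a 0 0)%:R + (crosses b 0 0)%:R)))).
  move=> a0 b0 x2.
  have xa : x2 ord0 N.+2 = a.
    by rewrite /x2 extend_stay ?m2// /extend ltnn m1 eqxx.
  have xb : x2 ord_max N.+2 = b by rewrite /x2 -m2 extend_mover.
  rewrite jump_out ?m3 ?xa//.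
  have xb' : extend x2 N.+2 0 ord_max N.+3 = b by rewrite extend_stay ?m3// xb.
  rewrite jump_out ?m4 ?xb'//.
  congr G; rewrite /left_fraction !weight_extend m4 xb' m3 xa.
  rewrite m2 extend_stay ?m1// !x0.
  by rewrite -/L -/Q; congr (_ / _); ring.
have half a : a != 0 ->
   jump N.+1 (jump N.+2 (jump N.+3 (fun x' => G (left_fraction R x' N.+4)))) (extend x N a) =
   (L + (crosses 0 a (-1))%:R) / (L + (crosses 0 a (-1))%:R + (Q + (crosses 0 a 0)%:R)) *
     jump N.+2 (jump N.+3 (fun x' => G (left_fraction R x' N.+4))) (extend (extend x N a) N.+1 (-1)) +
   (Q + (crosses 0 a 0)%:R) / (L + (crosses 0 a (-1))%:R + (Q + (crosses 0 a 0)%:R)) *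
     jump N.+2 (jump N.+3 (fun x' => G (left_fraction R x' N.+4))) (extend (extend x N a) N.+1 1).
  move=> a0; rewrite jump_center; last by rewrite m2 extend_stay ?m1// x0.
  by rewrite !weight_extend m1 x0.
rewrite jump_center ?m1// !half// !final//= -/L -/Q.
rewrite /urn_step /left_fraction -/L -/Q tot urn_totalS.
have LQ : L + Q = urn_total R n by [].
have QE : Q = urn_total R n - L by rewrite -LQ; ring.
rewrite QE; move: (urn_total R n) S2 => S S2.
have E4 : L + 4 + (S - L) = S + 4 by ring.
have E2 : L + 2 + (S - L + 2) = S + 4 by ring.
have E0 : L + (S - L + 4) = S + 4 by ring.
have E1 : L + 1 + (S - L) = S + 1 by ring.
have E1' : L + (S - L + 1) = S + 1 by ring.
have SL : S * (L / S) = L by field; rewrite gt_eqF//; lra.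
rewrite !(addr0, add0r) SL.
have -> : (1 + 1 + 1 + 1 : R) = 4 by ring.
have -> : (1 + 1 : R) = 2 by ring.
rewrite E4 E2 E0 E1 E1'.
by move: (G _) (G _) (G _) => u v w; field; rewrite !gt_eqF//; lra.
Qed.

End jump_operator.

(** * Events determined by a finite history *)

Section walkers_history.
Context (R : realType) d (T : measurableType d) (P : probability T R).
Variable X : 'I_2 -> nat -> T -> int.
Hypothesis hX : alternating_walkers P X.

Definition same_history n (w w' : T) := agree n (path_of X w) (path_of X w').

Lemma history_step x n y : history X (extend x n y) n.+1 =
  history X x n `&` [set w | X (mover n.+1) n.+1 w = y].
Proof.
apply/seteqP; split => w.
  move=> Hw; split; last by rewrite /= Hw// extend_mover.
  by move=> k i im; rewrite Hw ?agree_extend// leqW.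
move=> [Hw /= wy] k i; rewrite leq_eqVlt => /predU1P[->|im]; last first.
  by rewrite agree_extend//; exact: Hw.
have [->|km] := eqVneq k (mover n.+1); first by rewrite extend_mover.
by rewrite extend_stay// (walker_stay hX)// Hw.
Qed.

Lemma history_split x n : history X x n = history X (extend x n (-1)) n.+1 `|`
  (history X (extend x n 0) n.+1 `|` history X (extend x n 1) n.+1).
Proof.
rewrite !history_step -!setIUr; apply/seteqP; split => [w Hw|w []//].
split => //=; have := walker_vertex hX (mover n.+1) n.+1 w.
by rewrite !inE => /or3P[] /eqP; tauto.
Qed.

Lemma history_disjoint x n y y' : y != y' ->
  history X (extend x n y) n.+1 `&` history X (extend x n y') n.+1 = set0.
Proof.
move=> /eqP yy'; rewrite !history_step; apply/seteqP; split => // w /=.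
by move=> [[_ H1] [_ H2]]; apply: yy'; rewrite -H1 -H2.
Qed.

(** There are finitely many histories with positions in {-1, 0, 1}, so that
    a set which depends only on the history is a finite disjoint union of
    them. The proof goes backwards in time, and splits each history into its
    three continuations. *)
Lemma history_ind (Q : set T -> Prop) n : Q set0 -> (forall x, Q (history X x n)) ->
  (forall A B, A `&` B = set0 -> Q A -> Q B -> Q (A `|` B)) ->
  forall B, past_set same_history n B -> Q B.
Proof.
move=> Q0 Qa QU B pB.
have H x : Q (B `&` history X x n).
  have [[w [Bw Hw]]|ne] := pselect (exists w, B w /\ history X x n w).
    rewrite (_ : B `&` _ = history X x n)//; apply/seteqP; split => w'; first by case.
    move=> Hw'; split=> //; apply: (pB w) => // k i im.
    by rewrite /path_of Hw// Hw'.
  rewrite (_ : B `&` _ = set0)//; apply/seteqP; split => // w [Bw Hw].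
  by apply: ne; exists w.
have {}H i x : (i <= n)%N -> Q (B `&` history X x (n - i)%N).
  elim: i x => [|i IH] x im; first by rewrite subn0.
  have nE : (n - i = (n - i.+1).+1)%N by rewrite subnSK.
  have IH' x' : Q (B `&` history X x' (n - i.+1).+1).
    by rewrite -nE; apply: IH; exact: ltnW.
  rewrite history_split !setIUr; apply: (QU) => //; last first.
    by apply: (QU) => //; rewrite setIACA history_disjoint ?setI0.
  by rewrite -setIUr setIACA setIUr !history_disjoint// setU0 setI0.
have := H n (fun _ _ => 0) (leqnn n); rewrite subnn.
rewrite (_ : history X _ 0 = setT) ?setIT//; apply/seteqP; split => // w _ k i.
by rewrite leqn0 => /eqP ->; rewrite (walker_start hX).
Qed.

Lemma measurable_history x n : measurable (history X x n).
Proof.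
elim: n x => [|n IH] x.
  rewrite (_ : history X x 0 =
    [set w | X ord0 0%N w = x ord0 0%N] `&` [set w | X ord_max 0%N w = x ord_max 0%N]).
    by apply: measurableI; exact: (walker_measurable hX).
  apply/seteqP; split => w /= Hw; first by split; exact: Hw.
  by move=> k i; rewrite leqn0 => /eqP ->; have [->|->] := ord2P k; case: Hw.
rewrite (_ : history X x n.+1 = history X x n `&`
   ([set w | X ord0 n.+1 w = x ord0 n.+1] `&` [set w | X ord_max n.+1 w = x ord_max n.+1])).
  apply: measurableI; first exact: IH.
  by apply: measurableI; exact: (walker_measurable hX).
apply/seteqP; split => w /=.
  by move=> Hw; split; [|split; exact: Hw] => k i im; apply: Hw; exact: leqW.
move=> [H1 [H2 H3]] k i; rewrite leq_eqVlt => /predU1P[->|]; last exact: H1.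
by have [->|->] := ord2P k.
Qed.

Lemma measurable_past n B : past_set same_history n B -> measurable B.
Proof.
apply: (history_ind (Q := fun B => measurable B)) => //.
- by move=> x; exact: measurable_history.
- by move=> A B' _; exact: measurableU.
Qed.

Lemma past_bounded n (f : T -> R) : past_fun same_history n f -> bounded_measurable f.
Proof.
move=> pf; split.
  move=> _ A mA; rewrite setTI; apply: (@measurable_past n) => w w' ww'.
  by rewrite /= (pf _ _ ww').
suff [C HC] : exists C, forall w, [set: T] w -> `|f w| <= C by exists C => w; exact: HC.
apply: (@history_ind (fun B => exists C, forall w, B w -> `|f w| <= C) n) => //.
- by exists 0.
- move=> x; have [[w0 Hw0]|ne] := pselect (exists w, history X x n w); last first.
    by exists 0 => w Hw; exfalso; apply: ne; exists w.
  exists `|f w0| => w Hw; rewrite (pf w w0)// => k i im.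
  by rewrite /path_of Hw// Hw0.
- move=> A B _ [C HC] [D HD]; exists (Num.max C D) => w [/HC|/HD] H.
    by rewrite le_max H.
  by rewrite le_max H orbT.
Qed.

Lemma past_Rintegral_eq n (f g : T -> R) : bounded_measurable f -> bounded_measurable g ->
  (forall x, \int[P]_(w in history X x n) f w = \int[P]_(w in history X x n) g w) ->
  forall B, past_set same_history n B -> \int[P]_(w in B) f w = \int[P]_(w in B) g w.
Proof.
move=> bf bg H B pB.
suff [] : measurable B /\ \int[P]_(w in B) f w = \int[P]_(w in B) g w by [].
move: B pB; apply: history_ind.
- by split; [exact: measurable0|rewrite !Rintegral_set0].
- by move=> x; split; [exact: measurable_history|exact: H].
- move=> A B AB [mA HA] [mB HB]; split; first exact: measurableU.
  have dAB : [disjoint A & B] by apply/disj_setPS; rewrite AB.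
  rewrite !Rintegral_setU//; try by rewrite HA HB.
  - by apply: bounded_integrable => //; exact: measurableU.
  - by apply: bounded_integrable => //; exact: measurableU.
Qed.

Lemma Rintegral_eq_cst (A : set T) (f : T -> R) (c : R) : measurable A ->
  (forall w, A w -> f w = c) -> \int[P]_(w in A) f w = c * fine (P A).
Proof.
move=> mA fc; rewrite -Rintegral_cst//; apply: eq_Rintegral => w.
by rewrite inE => /fc.
Qed.

Lemma history_jump x n y : fine (P (history X (extend x n y) n.+1)) =
  fine (P (history X x n)) * jump_prob R x n y.
Proof.
rewrite history_step (walker_jump hX) fineM//.
by rewrite fin_num_measure//; exact: measurable_history.
Qed.

Lemma path_local n (F : trajectories -> R) : local n F ->
  past_fun same_history n (fun w => F (path_of X w)).
Proof. by move=> lF w w' ww'; exact: lF. Qed.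

(** Both sides are constant on the histories up to time n + 1, respectively
    n, where the equality is the law of the next jump. *)
Lemma one_step n (F : trajectories -> R) B : local n.+1 F -> past_set same_history n B ->
  \int[P]_(w in B) F (path_of X w) = \int[P]_(w in B) jump n F (path_of X w).
Proof.
move=> lF; apply: past_Rintegral_eq.
- exact: past_bounded (path_local lF).
- exact: past_bounded (path_local (jump_local lF)).
move=> x; have mH x' i := measurable_history x' i.
rewrite [RHS](@Rintegral_eq_cst _ _ (jump n F x))//; last first.
  by move=> w Hw; exact: (jump_local lF).
have bF := past_bounded (path_local lF).
have HF y : \int[P]_(w in history X (extend x n y) n.+1) F (path_of X w) =
    F (extend x n y) * (fine (P (history X x n)) * jump_prob R x n y).
  rewrite (@Rintegral_eq_cst _ _ (F (extend x n y)))// ?history_jump//.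
  by move=> w Hw; exact: lF.
pose H_ y := history X (extend x n y) n.+1.
have mHy y : measurable (H_ y) by exact: measurable_history.
have mU : measurable (H_ 0 `|` H_ 1) by exact: measurableU.
have iF A : measurable A -> P.-integrable A (EFin \o (fun w => F (path_of X w))).
  by move=> mA; exact: bounded_integrable.
have d1 : [disjoint H_ (-1) & H_ 0 `|` H_ 1].
  by apply/disj_setPS; rewrite setIUr !history_disjoint// setU0.
have d2 : [disjoint H_ 0 & H_ 1] by apply/disj_setPS; rewrite history_disjoint.
rewrite history_split (Rintegral_setU (mHy _) mU (iF _ (measurableU _ _ (mHy _) mU)) d1).
rewrite (Rintegral_setU (mHy _) (mHy _) (iF _ mU) d2) !HF -history_split /jump.
by ring.
Qed.

(** The jump probability vanishes off the neighbours of the current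
    position. *)
Lemma cross_ae n : {ae P, forall w,
  crosses_edge (X (mover n.+1) n w) (X (mover n.+1) n.+1 w)}.
Proof.
pose F (x : trajectories) : R :=
  if crosses_edge (x (mover n.+1) n) (x (mover n.+1) n.+1) then 0 else 1.
have lF : local n.+1 F by move=> x x' xx'; rewrite /F !xx'.
pose A := [set w | ~~ crosses_edge (X (mover n.+1) n w) (X (mover n.+1) n.+1 w)].
have mA : measurable A.
  apply: (@measurable_past n.+1) => w w' ww'; rewrite /A /=.
  have := ww' (mover n.+1) n (leqnSn n); have := ww' (mover n.+1) n.+1 (leqnn _).
  by rewrite /path_of => -> ->.
exists A; split => //.
- apply/eqP; rewrite -fine_eq0 ?fin_num_measure//; apply/eqP.
  rewrite fine_prob_indic//.
  transitivity (\int[P]_w F (path_of X w)).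
    apply: eq_Rintegral => w _; rewrite indicE /F /path_of.
    by case: ifPn => H; [rewrite memNset//; rewrite /A/= H|rewrite mem_set].
  rewrite (@one_step n)//.
  rewrite -[RHS](Rintegral_prob_cst P 0); apply: eq_Rintegral => w _.
  have := walker_vertex hX (mover n.+1) n w; rewrite !inE => v.
  have v' : path_of X w (mover n.+1) n = X (mover n.+1) n w by [].
  rewrite /jump /jump_prob /F !extend_mover !agree_extend// v'.
  by case/or3P: v => /eqP ->; rewrite /= ?(mul0r, mulr0, addr0).
by move=> w /= /negP.
Qed.

Lemma valid_ae : {ae P, forall w, valid_path (path_of X w)}.
Proof.
apply: filterS (ae_foralln cross_ae) => w cw; split => //.
- by move=> k; exact: (walker_start hX).
- by move=> n k km; exact: (walker_stay hX).
Qed.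

End walkers_history.

(** * The left fraction is an urn process *)

Section walkers_urn.
Context (R : realType) d (T : measurableType d) (P : probability T R).
Variable X : 'I_2 -> nat -> T -> int.
Hypothesis hX : alternating_walkers P X.

Definition period_past n := same_history X (4 * n)%N.

Lemma crosses_le1 (y y' : int) : (crosses y y' (-1) + crosses y y' 0 <= 1)%N.
Proof. by rewrite /crosses; do ! case: eqP => ? //=; lia. Qed.

Lemma crossings_le n w :
  (crossings (path_of X w) n (-1) + crossings (path_of X w) n 0 <= n)%N.
Proof.
elim: n => [|n IH]; first by rewrite /crossings !big1// => k _; rewrite big_geq.
have st : forall k, k != mover n.+1 -> path_of X w k n.+1 = path_of X w k n.
  by move=> k km; exact: (walker_stay hX).
rewrite !crossingsS// addnACA -addn1; apply: leq_add => //; exact: crosses_le1.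
Qed.

(** This must hold at every sample point. So it rests on the inequality of
    [crossings_le], and not on the number of crossings, which is known only
    almost surely. *)
Lemma left_fraction_period_domain n w : urn_domain n (Malt R X n w).
Proof.
rewrite /Malt /N_ /left_fraction /urn_domain.
have H := crossings_le (4 * n) w.
set x := path_of X w in H *; rewrite !weightE.
set a := crossings x _ (-1) in H *; set b := crossings x _ 0 in H *.
have SE : a%:R + b%:R + 2 <= urn_total R n.
  by rewrite /urn_total natrD lerD2r -natrD ler_nat.
have a0 : 0 <= a%:R :> R by []. have b0 : 0 <= b%:R :> R by [].
move: (urn_total R n) (a%:R) (b%:R) SE a0 b0 => S u v SE u0 v0.
have W0 : 0 < 1 + u + (1 + v) by lra.
rewrite mulrA ler_pdivlMr// ler_pdivrMr//; apply/andP; split; nra.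
Qed.

Lemma period_total w : valid_path (path_of X w) -> forall n,
  weight R (path_of X w) n (-1) + weight R (path_of X w) n 0 = n%:R + 2.
Proof.
move=> vx n; rewrite !weightE; have := valid_crossings n vx.
move: (crossings _ _ _) (crossings _ _ _) => a b <-.
by rewrite natrD; ring.
Qed.

Lemma left_fraction_local n : past_fun (same_history X) n (N_ R X n).
Proof. by move=> w w' ww'; exact: left_fraction_agree. Qed.

Lemma period_Rintegral n (G : R -> R) B : past_set (same_history X) (4 * n)%N B ->
  \int[P]_(w in B) G (Malt R X n.+1 w) =
  \int[P]_(w in B) urn_step n G (Malt R X n w).
Proof.
move=> pB; have nE : (4 * n.+1 = (4 * n).+4)%N by lia.
pose F (x : trajectories) : R := G (left_fraction R x (4 * n).+4).
have lF : local (4 * n).+4 F.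
  by move=> x x' xx'; rewrite /F (left_fraction_agree R xx').
have -> : \int[P]_(w in B) G (Malt R X n.+1 w) = \int[P]_(w in B) F (path_of X w).
  by apply: eq_Rintegral => w _; rewrite /Malt nE.
have lF3 := jump_local lF; have lF2 := jump_local lF3; have lF1 := jump_local lF2.
have pS m : past_set (same_history X) (4 * n)%N B ->
    past_set (same_history X) (4 * n + m)%N B.
  by move=> pB' w w' ww'; apply: pB'; apply: agree_le ww'; exact: leq_addr.
rewrite (one_step hX lF); last by rewrite -addn3; exact: pS.
rewrite (one_step hX lF3); last by rewrite -addn2; exact: pS.
rewrite (one_step hX lF2); last by rewrite -addn1; exact: pS.
rewrite (one_step hX lF1)//.
apply: Rintegral_ae_eq.
- exact: (measurable_past hX pB).
- exact: (past_bounded hX (path_local (jump_local lF1))).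
- apply: (@past_bounded _ _ _ P X hX (4 * n)%N) => w w' ww'.
  by rewrite /Malt (left_fraction_local ww').
apply: filterS (valid_ae hX) => w vx _.
rewrite -[RHS]/(urn_step n G (left_fraction R (path_of X w) (4 * n))).
rewrite -jump_four//; first by move=> k; exact: valid_center.
by rewrite period_total// urn_totalE natrM.
Qed.

(** [period_Rintegral] is the Markov property for a test function of the
    state only; on a single history, a test function which depends on the
    past is of this form. *)
Lemma walkers_urn_process : urn_process P (Malt R X) period_past.
Proof.
split.
- move=> n w w'; apply: agree_le; lia.
- by move=> n B pB; exact: (measurable_past hX pB).
- by move=> n w w' ww'; exact: left_fraction_local.
- exact: left_fraction_period_domain.
move=> n B g pB pg [C gC].
have bl : past_fun (same_history X) (4 * n.+1)%N (fun w => g w (Malt R X n.+1 w)).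
  move=> w w' ww'; rewrite /Malt (left_fraction_local ww'); apply: pg.
  by apply: agree_le ww'; lia.
have br : past_fun (same_history X) (4 * n)%N (fun w => urn_step n (g w) (Malt R X n w)).
  move=> w w' ww'; rewrite /Malt (left_fraction_local ww') /urn_step.
  by rewrite !(pg _ _ _ ww').
apply: (past_Rintegral_eq hX (past_bounded hX bl) (past_bounded hX br) _ pB) => x.
have [[w0 Hw0]|ne] := pselect (exists w, history X x (4 * n) w); last first.
  rewrite (_ : history _ _ _ = set0) ?Rintegral_set0//.
  by apply/seteqP; split => // w Hw; exfalso; apply: ne; exists w.
have same w : history X x (4 * n) w -> same_history X (4 * n) w w0.
  by move=> Hw k i im; rewrite /path_of Hw// Hw0.
have pH : past_set (same_history X) (4 * n)%N (history X x (4 * n)).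
  by move=> w w' ww' Hw k i im; rewrite -(Hw k i im); apply/esym; exact: ww'.
transitivity (\int[P]_(w in history X x (4 * n)) g w0 (Malt R X n.+1 w)).
  by apply: eq_Rintegral => w; rewrite inE => /same/pg ->.
rewrite (period_Rintegral (g w0) pH).
apply: eq_Rintegral => w; rewrite inE => /same ww0; rewrite /urn_step.
by rewrite !(pg _ _ _ ww0).
Qed.

Lemma left_fraction_increment w : valid_path (path_of X w) -> forall n,
  `|N_ R X n.+1 w - N_ R X n w| <= n.+1%:R^-1.
Proof.
move=> vx n; have t1 := period_total vx n.+1; have t0 := period_total vx n.
rewrite /N_ /left_fraction t1 t0.
have [xs st cr] := vx.
rewrite (weightE _ _ n.+1) crossingsS; last by move=> k; exact: st.
rewrite natrD addrA -weightE.
have c01 : 0 <= ((crosses (path_of X w (mover n.+1) n) (path_of X w (mover n.+1) n.+1) (-1))%:R : R) <= 1.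
  by case: (crosses _ _ _); rewrite ?lexx ?ler01.
have L0 := weight_gt0 R (path_of X w) n (-1); have Q0 := weight_gt0 R (path_of X w) n 0.
move: c01 L0 Q0 t0; rewrite -[n.+1%:R]natr1.
move: (weight R _ n _) (weight R _ n _) (_%:R : R) => Q L c c01 L0 Q0 t0.
have : 0 <= n%:R :> R by [].
move: (n%:R) t0 => t t0 tge.
have -> : (L + c) / (t + 1 + 2) - L / (t + 2) = (c * (t + 2) - L) / ((t + 1 + 2) * (t + 2)).
  by field; rewrite !gt_eqF//; lra.
have D0 : 0 < (t + 1 + 2) * (t + 2) by rewrite mulr_gt0//; lra.
rewrite normrM normfV (gtr0_norm D0) ler_pdivrMr// [leRHS]mulrC ler_pdivlMr; last lra.
have H : `|c * (t + 2) - L| <= t + 2 by rewrite ler_norml; nra.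
apply: (@le_trans _ _ ((t + 2) * (t + 1))); last nra.
by rewrite ler_wpM2r//; lra.
Qed.

Lemma left_fraction_dist w : valid_path (path_of X w) -> forall n m, (n <= m)%N ->
  `|N_ R X m w - N_ R X n w| <= (m - n)%:R / n.+1%:R.
Proof.
by move=> vx; exact: harmonic_increments (left_fraction_increment vx).
Qed.

End walkers_urn.

(** * Deviation of the left fraction at all times *)

Section walkers_law.
Context (R : realType) d (T : measurableType d) (P : probability T R).
Variable X : 'I_2 -> nat -> T -> int.
Hypothesis hX : alternating_walkers P X.
Local Notation N := (N_ R X).
Local Notation M := (Malt R X).
Local Notation Minf := (Malt_infty R X).
Let UP := walkers_urn_process hX.

Lemma left_fraction_bounded n : bounded_measurable (N n).
Proof. by apply: (past_bounded hX (n := n)); exact: left_fraction_local. Qed.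

Lemma walkers_deviation_bounded n :
  bounded_measurable (fun w => Num.sqrt n%:R * (N n w - Minf w)).
Proof.
apply: bounded_measurableM; first exact: bounded_measurable_cst.
apply: bounded_measurableB; [exact: left_fraction_bounded|exact: urn_limit_bounded UP].
Qed.

Lemma left_fraction_near_period w n : valid_path (path_of X w) ->
  Num.sqrt n%:R * `|N n w - M (n %/ 4)%N w| <= 9 / Num.sqrt n%:R.
Proof.
move=> vx; have [->|n0] := posnP n; first by rewrite sqrtr0 mul0r invr0 mulr0.
have le : (4 * (n %/ 4) <= n)%N by rewrite mulnC leq_divM.
have := left_fraction_dist R vx le; rewrite -/(M (n %/ 4)%N w).
set D := `|_|; set s := Num.sqrt n%:R => H.
have s0 : 0 < s by rewrite sqrtr_gt0 ltr0n.
have ns : n%:R = s ^+ 2 by rewrite sqr_sqrtr.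
rewrite mulrC ler_pdivlMr// -mulrA -expr2 -ns.
apply: le_trans (ler_wpM2r _ H) _ => //.
rewrite mulrAC ler_pdivrMr// -!natrM ler_nat.
have r3 : (n - 4 * (n %/ 4) <= 3)%N.
  by have := divn_eq n 4; have := ltn_pmod n (isT : 0 < 4)%N; lia.
have n3 : (n <= 3 * (4 * (n %/ 4)).+1)%N by lia.
by have := leq_mul r3 n3; lia.
Qed.

(** With q = n / 4 periods, sqrt n (N_n - M_oo) differs by at most 9 / sqrt
    n from sqrt n (M_q - M_oo), whose characteristic function at a is
    estimated at time q with the frequency a sqrt n: the variance n M_q (1 -
    M_q) / (2 q) is close to 2 M_q (1 - M_q). *)
Lemma walkers_deviation_law :
  cvg_in_law P (fun n w => Num.sqrt n%:R * (N n w - Minf w))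
    (mixture P (fun w => centered_normal (2 * (Minf w * (1 - Minf w))))).
Proof.
have P1 := fine_probability_setT P.
have mV := urn_limit_variance_measurable UP.
have c0 : 0 <= 2 :> R by [].
have V0 := urn_limit_variance_ge0 UP.
have bM q := urn_bounded UP q.
have mMinf : measurable_fun setT Minf := urn_limit_measurable UP.
have qn n : ((n %/ 4)%N%:R <= n%:R :> R) && (n%:R <= 4 * (n %/ 4)%N%:R + 3 :> R).
  rewrite -natrM -natrD !ler_nat.
  by have := divn_eq n 4; have := ltn_pmod n (isT : 0 < 4)%N; lia.
rewrite (mixture_lawE P (random_centered_normal 2 mV)).
apply: (@law_weak_cvg _ _ _ _ _ _ _ _ (2 * 81 + 2 * 8)).
- by move=> n; have [] := walkers_deviation_bounded n.
- exact: walkers_deviation_bounded.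
- move=> a b; rewrite mixture_cos//.
  pose K : R := (`|a| * Num.sqrt 8) ^+ 3 + 3 * (`|a| * Num.sqrt 8) ^+ 2 + (`|a| * Num.sqrt 8) ^+ 4.
  pose v q := cos b * \int[P]_w expR (- (a ^+ 2 * urn_variance M q w)).
  apply: (@cvg_of_dist_le _ _ (fun n => v (n %/ 4)%N)
    (fun n => `|a| * 9 / Num.sqrt n%:R + (K + a ^+ 2) / Num.sqrt (n %/ 4)%N%:R)).
  + exists 4%N => // n /= n4; set q := (n %/ 4)%N.
    have q0 : (0 < q)%N by rewrite divn_gt0.
    have /andP[qn1 qn2] := qn n; rewrite -/q in qn1 qn2.
    have q1 : 1 <= q%:R :> R by rewrite ler1n.
    set l := a * Num.sqrt n%:R.
    have S1 := urn_deviation_cos UP l b q0 (@past_setT _ T (period_past X) q).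
    rewrite P1 mulr1 in S1.
    have bcos (Z : T -> R) : bounded_measurable Z -> bounded_measurable (fun w => cos (l * (Z w - Minf w) + b)).
      move=> [mZ _]; apply: measurable_cos_fun; apply: measurable_funD => //.
      by apply: measurable_funM => //; exact: measurable_funB.
    have S0 : `|\int[P]_w cos (l * (N n w - Minf w) + b) -
                \int[P]_w cos (l * (M q w - Minf w) + b)| <= `|a| * 9 / Num.sqrt n%:R.
      rewrite -[leRHS](Rintegral_prob_cst P); apply: Rintegral_dist_le => //.
      * exact/bcos/left_fraction_bounded.
      * exact/bcos/bM.
      * exact: bounded_measurable_cst.
      apply: filterS (valid_ae hX) => w vx _; apply: le_trans (cos_lipschitz _ _) _.
      have -> : l * (N n w - Minf w) + b - (l * (M q w - Minf w) + b) =
        a * (Num.sqrt n%:R * (N n w - M q w)) by rewrite /l; ring.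
      rewrite normrM -mulrA ler_wpM2l// normrM (ger0_norm (sqrtr_ge0 _)).
      exact: left_fraction_near_period.
    have bE c : 0 <= c -> bounded_measurable (fun w => expR (- (c * urn_variance M q w))).
      move=> c0'; apply: (@measurable_expRN_fun _ _ _ (fun w => c * urn_variance M q w)).
        by have [mv _] := urn_variance_bounded UP q; exact: measurable_funM.
      by move=> w; have /andP[v0 _] := urn_variance01 UP q w; rewrite mulr_ge0.
    have a20 : 0 <= a ^+ 2 by rewrite sqr_ge0.
    have l2 : l ^+ 2 = a ^+ 2 * n%:R by rewrite /l exprMn sqr_sqrtr.
    have S2 : `|\int[P]_w expR (- (l ^+ 2 / 4 / q%:R * urn_variance M q w)) -
                \int[P]_w expR (- (a ^+ 2 * urn_variance M q w))| <= a ^+ 2 / Num.sqrt q%:R.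
      have ll : 0 <= l ^+ 2 / 4 / q%:R by rewrite l2 !divr_ge0// mulr_ge0.
      rewrite -[leRHS](Rintegral_prob_cst P); apply: Rintegral_dist_le => //.
      * exact: bE.
      * exact: bE.
      * exact: bounded_measurable_cst.
      apply: nearW => w _; have /andP[v0 v1] := urn_variance01 UP q w.
      apply: le_trans (expRN_lipschitz (mulr_ge0 ll v0) (mulr_ge0 a20 v0)) _.
      rewrite -mulrBl normrM (ger0_norm v0); apply: (@le_trans _ _ `|l ^+ 2 / 4 / q%:R - a ^+ 2|).
        by rewrite ler_piMr.
      have -> : l ^+ 2 / 4 / q%:R - a ^+ 2 = a ^+ 2 * ((n%:R - 4 * q%:R) / (4 * q%:R)).
        by rewrite l2; field; rewrite pnatr_eq0 -lt0n.
      rewrite normrM (ger0_norm a20) ler_wpM2l//.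
      have sq1 : 1 <= Num.sqrt q%:R :> R by rewrite -[leLHS]sqrtr1 ler_sqrt// ler1n.
      have sqq : q%:R = Num.sqrt q%:R ^+ 2 :> R by rewrite sqr_sqrtr.
      have n4q : 4 * q%:R <= n%:R :> R by rewrite -natrM ler_nat mulnC leq_divM.
      rewrite ger0_norm; last by rewrite divr_ge0//; lra.
      rewrite ler_pdivrMr; last lra.
      rewrite [leRHS]mulrC ler_pdivlMr; last lra.
      have H3 : (n%:R - 4 * q%:R) * Num.sqrt q%:R <= 3 * Num.sqrt q%:R :> R.
        by rewrite ler_wpM2r ?sqrtr_ge0//; lra.
      apply: le_trans H3 _; rewrite [in leRHS]sqq.
      by move: sq1; move: (Num.sqrt _) => s *; nra.
    have S3 : urn_error (- l) q <= K / Num.sqrt q%:R.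
      apply: urn_error_le => //; rewrite normrN /l normrM (ger0_norm (sqrtr_ge0 _)) -mulrA.
      rewrite ler_wpM2l// -sqrtrM// ler_wsqrtr//; lra.
    have -> : \int[P]_w cos (a * (Num.sqrt n%:R * (N n w - Minf w)) + b) =
        \int[P]_w cos (l * (N n w - Minf w) + b).
      by apply: eq_Rintegral => w _; rewrite /l mulrA.
    rewrite /v; move: S0 S1 S2 S3; move: (\int[P]_w cos _) (\int[P]_w cos _) => I1 I0.
    move: (\int[P]_w expR _) (\int[P]_w expR _) => I3 I2 S0 S1 S2 S3.
    have -> : I0 - cos b * I3 = (I0 - I1) + ((I1 - cos b * I2) + cos b * (I2 - I3)) by ring.
    apply: le_trans (ler_normD _ _) _; apply: lerD => //.
    apply: le_trans (ler_normD _ _) _; rewrite mulrDl; apply: lerD; first exact: le_trans S3.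
    by rewrite normrM; apply: le_trans S2; rewrite ler_piMl// cos_max.
  + rewrite -[X in _ --> X]addr0; apply: cvgD; first exact: cvg_inv_sqrt.
    apply: (cvg_comp (fun n => n %/ 4)%N (fun q => (K + a ^+ 2) / Num.sqrt q%:R)).
      exact: cvg_divn.
    exact: cvg_inv_sqrt.
  + apply: (cvg_comp (fun n => n %/ 4)%N v); first exact: cvg_divn.
    apply: cvgM; first exact: cvg_cst.
    have -> : 2 * a ^+ 2 / 2 = a ^+ 2 by field.
    by apply: urn_gauss_limit UP _ _ _ _ => //; rewrite sqr_ge0.
exists 4%N => // n /= n4; set q := (n %/ 4)%N.
have q0 : (0 < q)%N by rewrite divn_gt0.
have /andP[qn1 qn2] := qn n; rewrite -/q in qn1 qn2.
have q1 : 1 <= q%:R :> R by rewrite ler1n.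
have n1 : 1 <= n%:R :> R by exact: le_trans qn1.
have S := urn_scaled_sqr_le UP (@past_setT _ T (period_past X) q).
rewrite P1 in S.
pose D w := (Num.sqrt q%:R * (M q w - Minf w)) ^+ 2.
have bD : bounded_measurable D by apply/bounded_measurable_sqr/(urn_deviation_bounded UP).
apply: (@le_trans _ _ (\int[P]_w (2 * 81 + (2 * 8) * D w))); last first.
  rewrite RintegralD//; last 2 first.
  - by apply: bounded_integrable => //; exact: bounded_measurable_cst.
  - by apply: bounded_integrable => //; apply: bounded_measurableM => //; exact: bounded_measurable_cst.
  rewrite Rintegral_prob_cst RintegralZl//; last exact: bounded_integrable.
  by rewrite lerD2l ler_piMr.
apply: Rintegral_ae_mono => //.
- exact/bounded_measurable_sqr/walkers_deviation_bounded.
- apply: bounded_measurableD; first exact: bounded_measurable_cst.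
  by apply: bounded_measurableM => //; exact: bounded_measurable_cst.
apply: filterS (valid_ae hX) => w vx _.
have H := left_fraction_near_period n vx; rewrite -/q in H.
have s1 : 1 <= Num.sqrt n%:R :> R by rewrite -[leLHS]sqrtr1 ler_sqrt// ler1n.
have H9 : Num.sqrt n%:R * `|N n w - M q w| <= 9.
  by apply: le_trans H _; rewrite ler_pdivrMr ?ler_peMr//; lra.
rewrite /D !exprMn !sqr_sqrtr//.
have -> : n%:R * (N n w - Minf w) ^+ 2 =
  n%:R * ((N n w - M q w) + (M q w - Minf w)) ^+ 2 by congr (_ * _ ^+ 2); ring.
have E : n%:R * (N n w - M q w) ^+ 2 <= 81.
  have -> : n%:R * (N n w - M q w) ^+ 2 = (Num.sqrt n%:R * `|N n w - M q w|) ^+ 2.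
    by rewrite exprMn sqr_sqrtr// real_normK// num_real.
  have -> : 81 = 9 ^+ 2 :> R by rewrite -natrX.
  by rewrite ler_pXn2r// nnegrE// mulr_ge0// sqrtr_ge0.
have n8 : n%:R <= 8 * q%:R :> R by lra.
move: (N n w - M q w) (M q w - Minf w) E => x y E.
have y2 : 0 <= y ^+ 2 by rewrite sqr_ge0.
have Hy : n%:R * y ^+ 2 <= 8 * (q%:R * y ^+ 2) by rewrite mulrA ler_wpM2r.
have Hxy : n%:R * (x + y) ^+ 2 <= 2 * (n%:R * x ^+ 2) + 2 * (n%:R * y ^+ 2).
  have -> : 2 * (n%:R * x ^+ 2) + 2 * (n%:R * y ^+ 2) =
    n%:R * (x + y) ^+ 2 + n%:R * (x - y) ^+ 2 by ring.
  by rewrite lerDl mulr_ge0// sqr_ge0.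
lra.
Qed.
End walkers_law.

(** * The filtration of the left fraction *)

Section fraction_filtration.
Context (R : realType) d (T : measurableType d) (P : probability T R).
Variable X : 'I_2 -> nat -> T -> int.
Hypothesis hX : alternating_walkers P X.
Local Notation N := (N_ R X).
Local Notation M := (Malt R X).
Let UP := walkers_urn_process hX.

Definition fraction_atom n w : set T := [set w' | forall i, (i <= n)%N -> N i w' = N i w].

(** These turn out to be the events of the sigma-algebra generated by N_0,
    ..., N_n ([G_saturated], [saturated_G]). *)
Definition saturated n (B : set T) := forall w w', fraction_atom n w w' -> B w -> B w'.

Lemma fraction_atom_sym n w w' : fraction_atom n w w' -> fraction_atom n w' w.
Proof. by move=> H i im; rewrite H. Qed.

Lemma fraction_atom_eq n w w' : fraction_atom n w w' -> fraction_atom n w' = fraction_atom n w.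
Proof.
move=> H; apply/seteqP; split => u Hu i im; first by rewrite Hu// H.
by rewrite Hu// -H.
Qed.

Lemma same_history_atom n w w' : same_history X n w w' -> fraction_atom n w w'.
Proof.
move=> ww' i im; apply/esym; apply: (@left_fraction_local R d T X i).
exact: agree_le ww'.
Qed.

Lemma saturated_past n B : saturated n B -> past_set (same_history X) n B.
Proof. by move=> sB w w' /same_history_atom; exact: sB. Qed.

Lemma fraction_atom_saturated n w : saturated n (fraction_atom n w).
Proof. by move=> u u' /fraction_atom_eq uu' wu; rewrite -(fraction_atom_eq wu) -uu' => i. Qed.

Lemma history_cover n : exists s : seq T, forall w, exists2 w', w' \in s & same_history X n w' w.
Proof.
suff [s Hs] : exists s : seq T, forall w, [set: T] w -> exists2 w', w' \in s & same_history X n w' w.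
  by exists s => w; exact: Hs.
apply: (@history_ind R d T P X hX (fun B => exists s : seq T, forall w, B w ->
  exists2 w', w' \in s & same_history X n w' w) n) => //.
- by exists [::].
- move=> x; have [[w Hw]|ne] := pselect (exists w, history X x n w).
    exists [:: w] => w' Hw'; exists w; first by rewrite inE.
    by move=> k i im; rewrite /path_of Hw// Hw'.
  by exists [::] => w Hw; exfalso; apply: ne; exists w.
move=> A B _ [s Hs] [t Ht]; exists (s ++ t) => w [/Hs|/Ht] [w' w's Hw'];
  by exists w' => //; rewrite mem_cat w's ?orbT.
Qed.

(** There are finitely many histories up to time n, hence finitely many
    atoms. *)
Lemma saturated_ind (Q : set T -> Prop) n : Q set0 -> (forall w, Q (fraction_atom n w)) ->
  (forall A B, A `&` B = set0 -> saturated n A -> saturated n B -> Q A -> Q B -> Q (A `|` B)) ->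
  forall B, saturated n B -> Q B.
Proof.
move=> Q0 Qa QU B sB; have [s Hs] := history_cover n.
have {}Hs w : B w -> exists2 w', w' \in s & fraction_atom n w' w.
  by move=> _; have [w' w's /same_history_atom] := Hs w; exists w'.
elim: s B sB Hs => [|w0 s IH] B sB Hs.
  by rewrite (_ : B = set0)//; apply/seteqP; split => // w /Hs[].
have sD : saturated n (B `\` fraction_atom n w0).
  move=> w w' ww' [Bw nw]; split; first exact: sB ww' Bw.
  by move=> H; apply: nw; exact: fraction_atom_saturated (fraction_atom_sym ww') H.
have QD : Q (B `\` fraction_atom n w0).
  apply: IH => // w [Bw nw]; have [w'] := Hs _ Bw.
  by rewrite inE => /predU1P[->//|w's Hw']; exists w'.
have [[w [Bw Hw]]|ne] := pselect (exists w, B w /\ fraction_atom n w0 w); last first.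
  rewrite (_ : B = B `\` fraction_atom n w0)//; apply/seteqP; split => [w Bw|w []//].
  by split => // Hw; apply: ne; exists w.
have -> : B = fraction_atom n w0 `|` (B `\` fraction_atom n w0).
  apply/seteqP; split => [u Bu|u].
    by have [] := pselect (fraction_atom n w0 u); [left|right].
  by move=> [Hu|[]//]; apply: (sB w) => //; rewrite /= (fraction_atom_eq Hw).
apply: QU => //; first by rewrite setDE setICA setICr setI0.
exact: fraction_atom_saturated.
Qed.

Lemma G_saturated n B : G_ R X n B -> saturated n B.
Proof.
move: B; apply: smallest_sub.
  split => //.
  - by move=> A sA w w' ww' [_ nA]; split => // Aw'; apply: nA; exact: sA (fraction_atom_sym ww') Aw'.
  - by move=> F sF w w' ww' [i _ Fw]; exists i => //; exact: sF ww' Fw.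
move=> B [i /= im [C mC <-]] w w' ww' [_ Cw]; split => //.
by rewrite /= ww'.
Qed.

Lemma G_sigma_algebra n : sigma_algebra setT (G_ R X n).
Proof. exact: smallest_sigma_algebra. Qed.

Lemma fraction_atom_G n w : G_ R X n (fraction_atom n w).
Proof.
have [G0 GC GU] := G_sigma_algebra n.
have GT : G_ R X n setT by rewrite -[setT]setD0; exact: (GC).
have GI A B : G_ R X n A -> G_ R X n B -> G_ R X n (A `&` B).
  move=> GA GB; rewrite -[A `&` B]setCK setCI -setTD; apply: (GC).
  rewrite -bigcup2E; apply: GU => -[|[|i]]/=; rewrite -?setTD//; exact: (GC).
suff H m : (m <= n.+1)%N -> G_ R X n [set w' | forall i, (i < m)%N -> N i w' = N i w].
  by have := H n.+1 (leqnn _).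
elim: m => [|m IH] mn; first by rewrite (_ : [set _ | _] = setT)//; apply/seteqP; split.
have -> : [set w' | forall i, (i < m.+1)%N -> N i w' = N i w] =
    [set w' | forall i, (i < m)%N -> N i w' = N i w] `&` (N m @^-1` [set N m w]).
  apply/seteqP; split => u.
    by move=> Hu; split => [i im|]; apply: Hu => //; exact: ltnW.
  by move=> [Hu Hm] i; rewrite ltnS leq_eqVlt => /predU1P[->//|]; exact: Hu.
apply: GI; first by apply: IH; exact: ltnW.
apply: sub_gen_smallest; exists m => //; exists [set N m w]; first exact: measurable_set1.
by rewrite setTI.
Qed.

Lemma saturated_G n B : saturated n B -> G_ R X n B.
Proof.
have [G0 GC GU] := G_sigma_algebra n.
apply: (saturated_ind (Q := G_ R X n)) => //; first exact: fraction_atom_G.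
move=> A C _ _ _ GA GC'; rewrite -bigcup2E; apply: GU => -[|[|i]]//=.
Qed.

Lemma saturated_measurable n B : saturated n B -> measurable B.
Proof. by move=> /saturated_past; exact: (measurable_past hX). Qed.

Lemma G_sub_sigma_field n : sub_sigma_field (G_ R X n).
Proof.
by split; [exact: G_sigma_algebra|move=> B /G_saturated/saturated_measurable].
Qed.

Lemma G_wrt_measurable n d' (T' : measurableType d') (f : T -> T') :
  (forall w w', fraction_atom n w w' -> f w' = f w) -> wrt_measurable (G_ R X n) f.
Proof.
move=> fE _ [C mC <-]; apply: saturated_G => w w' ww' [_ Cw]; split => //.
by rewrite /= (fE _ _ ww').
Qed.

Lemma Malt_martingale : martingale P (fun n => G_ R X (4 * n)%N) M.
Proof.
have wM n : wrt_measurable (G_ R X (4 * n)%N) (M n).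
  by apply: G_wrt_measurable => w w' /(_ _ (leqnn _)).
have iM n : P.-integrable setT (EFin \o M n).
  by apply: bounded_integrable => //; exact: urn_bounded UP n.
split => //.
- by move=> n; exact: G_sub_sigma_field.
- move=> n B /G_saturated sB; apply: saturated_G => w w' ww'; apply: sB => i im.
  by apply: ww'; apply: leq_trans im _; lia.
move=> n; split => // B /G_saturated sB; have pB := saturated_past sB.
have mB := saturated_measurable sB.
rewrite !bounded_integralE//; try exact: urn_bounded UP _.
rewrite (period_Rintegral hX id pB); congr EFin; apply: eq_Rintegral => w _.
by rewrite urn_step_id.
Qed.
End fraction_filtration.

(** * Almost sure conditional convergence *)

Lemma conditioned_set_eq (R : realType) d (T : measurableType d) (P : probability T R)
    (B B' : set T) (mB : measurable B) (mB' : measurable B') : B = B' ->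
  conditioned P mB = conditioned P mB'.
Proof. by move=> BB'; case: _ / BB' mB' => mB'; rewrite (Prop_irrelevance mB mB'). Qed.

Section conditional_law.
Context (R : realType) d (T : measurableType d) (P : probability T R).
Variable X : 'I_2 -> nat -> T -> int.
Hypothesis hX : alternating_walkers P X.
Local Notation N := (N_ R X).
Local Notation M := (Malt R X).
Local Notation Minf := (Malt_infty R X).
Let UP := walkers_urn_process hX.

Definition fraction_atom_measurable n w : measurable (fraction_atom R X n w) :=
  saturated_measurable hX (@fraction_atom_saturated R d T X n w).

(** Elementary conditioning on the atom of w. On a null atom the value is
    the law of Z under P, which is an arbitrary choice. *)
Definition conditional_law (Z : T -> R) (mZ : measurable_fun setT Z) n w : law R :=
  law_of (conditioned P (fraction_atom_measurable n w)) mZ.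

Lemma conditional_law_is (Z : T -> R) (mZ : measurable_fun setT Z) n :
  is_cond_distribution P (G_ R X n) Z (conditional_law mZ n).
Proof.
have cE A w w' : fraction_atom R X n w w' ->
    conditional_law mZ n w' A = conditional_law mZ n w A.
  move=> /fraction_atom_eq ww'; rewrite /conditional_law.
  by rewrite (conditioned_set_eq P _ (fraction_atom_measurable n w)).
have wm (A : set R) : measurable A -> wrt_measurable (G_ R X n) (fun w => conditional_law mZ n w A).
  by move=> mA; apply: (G_wrt_measurable hX) => w w'; exact: cE.
split=> // A B mA /G_saturated sB.
have mc : measurable_fun setT (fun w => conditional_law mZ n w A).
  move=> _ C mC; have [_] := G_sub_sigma_field hX n; apply.
  by apply: (wm _ mA); exists C.
have mZA : measurable (Z @^-1` A) by rewrite -[X in measurable X]setTI; exact: (mZ).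
have ms B' : saturated R X n B' -> measurable B' := @saturated_measurable R d T P X hX n B'.
move: B sB; apply: (saturated_ind hX).
- by rewrite integral_set0 set0I measure0.
- move=> w; have mw := fraction_atom_measurable n w.
  transitivity (conditional_law mZ n w A * P (fraction_atom R X n w))%E.
    rewrite -integral_cst//; apply: eq_integral => w'.
    by rewrite inE => /cE ->.
  have [P0|P0] := eqVneq (P (fraction_atom R X n w)) 0%E.
    rewrite P0 mule0; apply/esym/eqP; rewrite -measure_le0 -P0.
    by apply: le_measure; rewrite ?inE//; exact: measurableI.
  rewrite -[X in (X * _)%E]/(conditioned P (fraction_atom_measurable n w) (Z @^-1` A)).
  rewrite conditionedE// -muleA -[X in (_ * (_ * X))%E]fineK ?fin_num_measure//.
  by rewrite -EFinM mulVf ?mule1 1?setIC// fine_eq0 ?fin_num_measure.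
move=> C D CD sC sD HC HD; have mC := ms _ sC; have mD := ms _ sD.
rewrite ge0_integral_setU//; last 2 first.
- exact: measurable_funTS.
- exact/disj_set2P.
rewrite HC HD setIUl measureU//; try exact: measurableI.
by rewrite setIACA CD set0I.
Qed.

(** The null atoms at time n are finitely many, so that their union is null. *)
Lemma fraction_atom_gt0 : {ae P, forall w, forall n, 0 < fine (P (fraction_atom R X n w))}.
Proof.
apply: ae_foralln => n; pose D := [set w | P (fraction_atom R X n w) = 0%E].
have sD : saturated R X n D.
  by move=> w w' /fraction_atom_eq ww' Dw; rewrite /D/= ww'.
have mD := saturated_measurable hX sD.
exists D; split => //; last first.
  move=> w /= nw; apply: contrapT => /eqP Pw; apply: nw; rewrite fine_gt0//.
  rewrite lt0e Pw measure_ge0/= ltey_eq fin_num_measure//.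
  exact: fraction_atom_measurable.
rewrite -[D]setTI; have sT : saturated R X n setT by [].
have ms B' : saturated R X n B' -> measurable B' := @saturated_measurable R d T P X hX n B'.
move: sT; move: setT; apply: (saturated_ind hX (Q := fun B => P (B `&` D) = 0%E)).
- by rewrite set0I measure0.
- move=> w; have [Dw|nDw] := pselect (D w).
    apply/eqP; rewrite -measure_le0 -Dw; have mw := fraction_atom_measurable n w.
    by apply: le_measure; rewrite ?inE//; exact: measurableI.
  rewrite (_ : _ `&` _ = set0) ?measure0//; apply/seteqP; split => // u [wu Du].
  by apply: nDw; exact: sD (fraction_atom_sym wu) Du.
move=> C E CE sC sE HC HE.
transitivity (P (C `&` D) + P (E `&` D))%E; last by rewrite HC HE adde0.
rewrite setIUl; apply: measureU; [exact: measurableI (ms _ _) mD|exact: measurableI (ms _ _) mD|].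
by rewrite setIACA CE set0I.
Qed.

Lemma left_fraction01 n w : 0 <= N n w <= 1.
Proof.
have a0 := weight_gt0 R (path_of X w) n (-1); have b0 := weight_gt0 R (path_of X w) n 0.
rewrite /N_ /left_fraction; have s0 := addr_gt0 a0 b0.
by rewrite divr_ge0 ?(ltW a0) ?(ltW s0)//= ler_pdivrMr// mul1r lerDl ltW.
Qed.

Lemma left_fraction_cvg : {ae P, forall w, N n w @[n --> \oo] --> Minf w}.
Proof.
apply: filterS2 (valid_ae hX) (urn_cvg_limit UP) => w vx Mw.
apply: (@cvg_of_dist_le _ _ (fun n => M (n %/ 4)%N w) (fun n => 9 / Num.sqrt n%:R)).
- exists 1%N => // n /= n0; apply: le_trans (left_fraction_near_period R n vx).
  by rewrite ler_peMl// -[leLHS]sqrtr1 ler_sqrt// ler1n.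
- exact: cvg_inv_sqrt.
- by apply: (cvg_comp (fun n => n %/ 4)%N (M ^~ w)) Mw; exact: cvg_divn.
Qed.

Local Notation dev := (fun n w => Num.sqrt n%:R * (M n w - Minf w)).

(** The atom of w at time n is an event of the period q = n / 4 + 1, because
    n <= 4 q. On it N_n is equal to the constant y = N_n(w), and |M_q - y|
    <= 4 / (n + 1) almost surely. So [urn_conditional_cos] applies, and y
    tends to the limit M_oo(w) as n grows. *)
Lemma walkers_conditional_cvg :
  as_cond_cvg P (G_ R X) dev (fun w => centered_normal (2^-1 * (Minf w * (1 - Minf w)))).
Proof.
have bdev n : bounded_measurable (dev n) := urn_deviation_bounded UP n.
have mdev n : measurable_fun setT (dev n) by have [] := bdev n.
split => //.
- by move=> n; exact: (G_sub_sigma_field hX).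
- apply: (@random_centered_normal _ _ _ (fun w => Minf w * (1 - Minf w)) 2^-1).
  exact: urn_limit_variance_measurable UP.
exists (fun n => conditional_law (mdev n) n); split.
  by move=> n; exact: conditional_law_is.
have V0 := urn_limit_variance_ge0 UP.
apply: filterS2 fraction_atom_gt0 left_fraction_cvg => w PA Nw.
have pA q n : (n <= 4 * q)%N -> past_set (period_past X) q (fraction_atom R X n w).
  move=> nq u u' uu'; apply: (saturated_past (@fraction_atom_saturated R d T X n w)).
  exact: agree_le uu'.
apply: (@conditioned_weak_cvg _ _ _ _ dev mdev bdev _ (fun n => fraction_atom_measurable n w) _ 1) => //.
- move=> a b; pose y n := N n w.
  rewrite centered_normal_cos; last by apply: mulr_ge0 => //; exact: (V0 w).
  rewrite mulrC.
  pose K : R := `|a| ^+ 3 + 3 * `|a| ^+ 2 + `|a| ^+ 4.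
  apply: (@cvg_of_dist_le _ _ (fun n => cos b * expR (- (a ^+ 2 / 4 * (y n * (1 - y n)))))
    (fun n => K / Num.sqrt n%:R + a ^+ 2 / 4 * (2 / Num.sqrt (n %/ 4).+1%:R + 4 * n.+1%:R^-1))).
  + exists 1%N => // n /= n0; set q := (n %/ 4).+1.
    have qn : (0 < q <= n)%N.
      by rewrite /q; have := divn_eq n 4; have := ltn_pmod n (isT : 0 < 4)%N; lia.
    have n4q : (n <= 4 * q)%N.
      by rewrite /q; have := divn_eq n 4; have := ltn_pmod n (isT : 0 < 4)%N; lia.
    have q4n : (4 * q - n <= 4)%N.
      by rewrite /q; have := divn_eq n 4; have := ltn_pmod n (isT : 0 < 4)%N; lia.
    have near_y : {ae P, forall w', fraction_atom R X n w w' ->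
        `|M q w' - y n| <= 4 * n.+1%:R^-1}.
      apply: filterS (valid_ae hX) => w' vx Aw'; rewrite /y -(Aw' n (leqnn n)).
      apply: le_trans (left_fraction_dist R vx n4q) _.
      by rewrite ler_wpM2r ?invr_ge0// ler_nat.
    have := urn_conditional_cos UP a b qn (pA _ _ n4q) (left_fraction01 n w) near_y.
    rewrite -/K; move: (PA n); move: (fine (P _)) (\int[P]_(_ in _) _) => p I p0.
    rewrite -ler_pdivrMr// => H.
    have -> : p^-1 * I - cos b * expR (- (a ^+ 2 / 4 * (y n * (1 - y n)))) =
      (I - cos b * expR (- (a ^+ 2 / 4 * (y n * (1 - y n)))) * p) / p.
      by field; exact: lt0r_neq0.
    by rewrite normrM normfV (gtr0_norm p0).
  + rewrite -[X in _ --> X]addr0; apply: cvgD; first exact: cvg_inv_sqrt.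
    rewrite -[X in _ --> X](mulr0 (a ^+ 2 / 4)); apply: cvgM; first exact: cvg_cst.
    rewrite -[X in _ --> X]addr0; apply: cvgD.
      apply: (cvg_comp (fun n => n %/ 4)%N (fun k => 2 / Num.sqrt k.+1%:R)).
        exact: cvg_divn.
      by rewrite (cvg_shiftS (fun k => 2 / Num.sqrt k%:R)); exact: cvg_inv_sqrt.
    rewrite -[X in _ --> X](mulr0 4); apply: cvgM; first exact: cvg_cst.
    exact: cvg_harmonic.
  + apply: cvgM; first exact: cvg_cst.
    apply: continuous_cvg; first exact: continuous_expR.
    have -> : 2^-1 * (Minf w * (1 - Minf w)) * a ^+ 2 / 2 =
      a ^+ 2 / 4 * (Minf w * (1 - Minf w)) by field.
    apply: cvgN; apply: cvgM; first exact: cvg_cst.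
    by apply: cvgM => //; apply: cvgB => //; exact: cvg_cst.
apply: nearW => n; rewrite mul1r.
by apply: (urn_scaled_sqr_le UP); apply: pA; lia.
Qed.
End conditional_law.

Theorem theorem6 (R : realType) (d : measure_display) (T : measurableType d)
    (P : probability T R) (X : 'I_2 -> nat -> T -> int)
    (hX : alternating_walkers P X) :
  let N : nat -> T -> R := N_ R X in
  let G : nat -> set_system T := G_ R X in
  let M : nat -> T -> R := Malt R X in
  let Minf : T -> R := Malt_infty R X in
  let V : T -> R := fun w => Minf w * (1 - Minf w) in
  (* (i) *)
  [/\ martingale P (fun n => G (4 * n)%N) M,
      exists C : R, forall n w, `|M n w| <= C,
      {ae P, forall w, cvgn (fun n => M n w)} &
      {ae P, forall w, `|N n w - Minf w| @[n --> \oo] --> (0 : R)}] /\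
  (* (ii) *)
  [/\ as_cond_cvg P G
        (fun n w => Num.sqrt n%:R * (M n w - Minf w))
        (fun w => centered_normal (2^-1 * V w)),
      cvg_in_law P
        (fun n w => Num.sqrt n%:R * (M n w - Minf w))
        (mixture P (fun w => centered_normal (2^-1 * V w))) &
      cvg_in_law P
        (fun n w => Num.sqrt n%:R * (N n w - Minf w))
        (mixture P (fun w => centered_normal (2 * V w)))] /\
  (* (iii) *)
  (forall a : R, 0 <= a <= 1 -> P [set w | Minf w = a] = 0%E) /\
  ~ (exists a : R, {ae P, forall w, Minf w = a}).
Proof.
move=> N G M Minf V; have UP := walkers_urn_process hX.
split.
  split.
  - exact: Malt_martingale.
  - by exists 1 => n w; have /andP[m0 m1] := left_fraction01 R X (4 * n) w; rewrite ger0_norm.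
  - exact: urn_cvg_ae UP.
  apply: filterS (left_fraction_cvg hX) => w Nw.
  have H : `|N n w - Minf w| @[n --> \oo] --> `|Minf w - Minf w|.
    by apply: cvg_norm; apply: cvgB => //; exact: cvg_cst.
  by rewrite subrr normr0 in H.
split.
  split.
  - exact: walkers_conditional_cvg.
  - exact: urn_deviation_law UP.
  - exact: walkers_deviation_law.
split => [a _|[a Ha]]; first exact: urn_limit_no_atom UP a.
have A0 : P [set w | Minf w = a] = 0%E := urn_limit_no_atom UP a.
have mA : measurable [set w | Minf w = a].
  rewrite -[X in measurable X]setTI (_ : [set w | _] = Minf @^-1` [set a])//.
  exact: (urn_limit_measurable UP).
suff : (1 : R) = 0 by move/eqP; rewrite oner_eq0.
rewrite -(Rintegral_prob_cst P 1) -[RHS](congr1 fine A0).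
rewrite [RHS]fine_prob_indic//.
apply: Rintegral_ae_eq => //.
- exact: bounded_measurable_cst.
- exact: bounded_measurable_indic.
by apply: filterS Ha => w wa _; rewrite indicE mem_set.
Qed.
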